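(* Let the sigma-function $\sigma(\lambda)$ of a Hankel operator $H$ satisfy $\operatorname{supp}\sigma\subset[0,\infty)$ and $\sigma\in L^\infty(\mathbb{R}_+)$, and let the function $\eta$ on $(-1,1)$ be defined by $$\eta(\mu)=\sigma(\lambda),\qquad \mu=\frac{\lambda-1/2}{\lambda+1/2}\in(-1,1),\quad\lambda\in\mathbb{R}_+ .$$ Then $Q=\mathbf{U}_0^{-1}H\mathbf{U}_0$ is the Hankel operator in the space $l^2(\mathbb{Z}_+)$ with matrix elements $$q_n=\int_{-1}^1\eta(\mu)\,\mu^n\,d\mu .$$
   Context: $\mathbb{R}_+=(0,\infty)$, $\mathbb{Z}_+=\{0,1,2,\dots\}$. A Hankel operator in $l^2(\mathbb{Z}_+)$ with matrix elements $q_n$ acts by $(Qg)_n=\sum_{m=0}^\infty q_{n+m}g_m$, $g=(g_0,g_1,\dots)$. The unitary operator $\mathbf{U}_0:l^2(\mathbb{Z}_+)\to L^2(\mathbb{R}_+)$ is $(\mathbf{U}_0g)(t)=\sum_{n=0}^\infty g_n e^{-t/2}L_n^0(t)$, where $L_n^\kappa(t)=n!^{-1}e^tt^{-\kappa}\frac{d^n}{dt^n}(e^{-t}t^{n+\kappa})$ are the Laguerre polynomials. The Hankel operator $H$ with kernel $h\in C_0^\infty(\mathbb{R}_+)'$ (formally $(Hf)(t)=\int_0^\infty h(t+s)f(s)\,ds$) in $L^2(\mathbb{R}_+)$ is defined by the form $(Hf_1,f_2)=\langle h,\bar f_1\star f_2\rangle$, $f_1,f_2\in C_0^\infty(\mathbb{R}_+)$,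 $(\bar f_1\star f_2)(t)=\int_0^t\overline{f_1(s)}f_2(t-s)\,ds$, where $\langle\cdot,\cdot\rangle$ is antilinear in the second argument ($\langle h,F\rangle=\int h\overline F$ for functions). With $(\mathsf{L}f)(\lambda)=\int_0^\infty e^{-t\lambda}f(t)\,dt$ and $\mathcal{Y}=\mathsf{L}\,C_0^\infty(\mathbb{R}_+)$ (topology transported by $\mathsf{L}$), the sigma-function of $H$ is the unique continuous antilinear functional $\sigma\in\mathcal{Y}'$ with $\langle h,F\rangle=\langle\sigma,\mathsf{L}F\rangle$ for all $F\in C_0^\infty(\mathbb{R}_+)$. The assumption on $\sigma$ means that $\langle\sigma,w\rangle=\int_0^\infty\sigma(\lambda)\overline{w(\lambda)}\,d\lambda$, $w\in\mathcal{Y}$, with a function $\sigma\in L^\infty(\mathbb{R}_+)$, i.e. $h(t)=\int_0^\infty e^{-t\lambda}\sigma(\lambda)\,d\lambda$; then $H$ is bounded. *)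

(* Defs.v *)
From HB Require Import structures.
From mathcomp Require Import all_boot all_order all_algebra.
From mathcomp Require Import complex.
From mathcomp Require Import all_classical all_reals all_analysis.

Set Implicit Arguments.
Unset Strict Implicit.
Unset Printing Implicit Defensive.

Import Order.TTheory GRing.Theory Num.Theory.
Import numFieldNormedType.Exports.

Local Open Scope classical_set_scope.
Local Open Scope ring_scope.

Section HankelDefs.
Context {R : realType}.
Local Notation C := R[i].
Local Notation mu := (@lebesgue_measure R).
Implicit Types (f g F w : R -> C) (D : set R).

Definition Rplus : set R := `]0, +oo[.

Definition re f : R -> R := fun t => complex.Re (f t).
Definition im f : R -> R := fun t => complex.Im (f t).
Definition modulus (z : C) : R := ComplexField.Normc.normc z.
Definition ofreal (x : R) : C := Complex x 0.

Definition cmeasurable D f : Prop :=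
  measurable_fun D (re f) /\ measurable_fun D (im f).

Definition cintegral D f : C :=
  Complex (\int[mu]_(t in D) re f t) (\int[mu]_(t in D) im f t).

(** [L^2(R_+)] and [L^oo(R_+)]: elements are functions on [R], of which only
    the values on [Rplus] matter, up to almost everywhere equality. *)

Definition L2 f : Prop :=
  cmeasurable Rplus f /\
  (\int[mu]_(t in Rplus) ((modulus (f t)) ^+ 2)%:E < +oo)%E.

Definition L2norm f : R :=
  Num.sqrt (\int[mu]_(t in Rplus) (modulus (f t)) ^+ 2).

Definition L2inner f g : C := cintegral Rplus (fun t => f t * (g t)^*).

Definition L2eq f g : Prop := {ae mu, forall t, Rplus t -> f t = g t}.

Definition Linfty f : Prop :=
  cmeasurable Rplus f /\
  exists M : R, {ae mu, forall t, Rplus t -> modulus (f t) <= M}.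

Definition bounded_operator (H : (R -> C) -> (R -> C)) : Prop :=
  [/\ forall f, L2 f -> L2 (H f),
      forall (c : C) f g, L2 f -> L2 g ->
        L2eq (H (fun t => c * f t + g t)) (fun t => c * H f t + H g t)
    & exists M : R, forall f, L2 f -> L2norm (H f) <= M * L2norm f].

(** Test functions: elements of [C_0^oo(R_+)] are extended by zero to [R]. *)

Definition smooth f : Prop := forall (n : nat) (t : R),
  derivable (derive1n n (re f)) t 1 /\ derivable (derive1n n (im f)) t 1.

Definition cderive1n (n : nat) f : R -> C :=
  fun t => Complex (derive1n n (re f) t) (derive1n n (im f) t).

Definition supported_in (x y : R) f : Prop :=
  forall t, ~ (x <= t <= y) -> f t = 0.

Definition test_function f : Prop :=
  smooth f /\ exists x y : R, 0 < x /\ supported_in x y f.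

Definition antilinear_on (V : set (R -> C)) (h : (R -> C) -> C) : Prop :=
  forall (c : C) f g, V f -> V g ->
    h (fun t => c * f t + g t) = c^* * h f + h g.

(** Continuity for the usual (inductive limit) topology of [C_0^oo(R_+)]: on
    each compact [[x, y]] of [R_+], [h] is bounded by the supremum of finitely
    many derivatives. *)
Definition test_continuous (h : (R -> C) -> C) : Prop :=
  forall x y : R, 0 < x -> exists (N : nat) (K : R),
    forall F, test_function F -> supported_in x y F ->
    forall M : R,
      (forall (k : nat) (t : R), (k <= N)%N -> modulus (cderive1n k F t) <= M) ->
      modulus (h F) <= K * M.

(** [C_0^oo(R_+)'] consists of antilinear functionals: [h F] is [<h, F>]. *)
Definition test_distribution (h : (R -> C) -> C) : Prop :=
  antilinear_on test_function h /\ test_continuous h.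

(** [F] having compact support in [R_+], [laplace F] is defined (and analytic)
    on the whole line, hence determined by its values on [Rplus]. *)
Definition laplace F : R -> C :=
  fun l => cintegral Rplus (fun t => ofreal (expR (- (t * l))) * F t).

Definition laplace_space : set (R -> C) :=
  [set w | exists2 F, test_function F & w = laplace F].

(** The topology of [laplace_space] is transported from [C_0^oo(R_+)] by
    [laplace]. *)
Definition laplace_dual (s : (R -> C) -> C) : Prop :=
  antilinear_on laplace_space s /\ test_continuous (s \o laplace).

Definition is_sigma_function (h s : (R -> C) -> C) : Prop :=
  laplace_dual s /\ forall F, test_function F -> h F = s (laplace F).

(** The functional [s] is supported by [R_+] and given there by the function
    [sigma]. *)
Definition represented_by (s : (R -> C) -> C) (sigma : R -> C) : Prop :=
  forall w, laplace_space w ->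
    s w = cintegral Rplus (fun l => sigma l * (w l)^*).

Definition conj_convolution f g : R -> C :=
  fun t => cintegral `[0, t] (fun x => (f x)^* * g (t - x)).

Definition is_hankel_operator (h : (R -> C) -> C)
    (H : (R -> C) -> (R -> C)) : Prop :=
  bounded_operator H /\
  forall f1 f2, test_function f1 -> test_function f2 ->
    L2inner (H f1) f2 = h (conj_convolution f1 f2).

Definition ell2 (g : nat -> C) : Prop :=
  (\sum_(0 <= n <oo) ((modulus (g n)) ^+ 2)%:E < +oo)%E.

Definition is_hankel_matrix_operator (q : nat -> C)
    (Q : (nat -> C) -> (nat -> C)) : Prop :=
  forall g : nat -> C, ell2 g -> ell2 (Q g) /\
    forall n : nat,
      (fun N => modulus (Q g n - \sum_(0 <= m < N) q (n + m)%N * g m)) @ \oo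
        --> (0 : R).

(** The formula [n!^-1 e^t t^(-kappa) (d/dt)^n (e^(-t) t^(n+kappa))], meaningful
    for [t > 0] only. *)
Definition laguerre (kappa : R) (n : nat) (t : R) : R :=
  (n`!%:R)^-1 * expR t * t `^ (- kappa) *
  derive1n n (fun x : R => expR (- x) * x `^ (n%:R + kappa)) t.

Definition laguerre_sum (g : nat -> C) (N : nat) : R -> C :=
  fun t => \sum_(0 <= n < N) g n * ofreal (expR (- t / 2) * laguerre 0 n t).

(** The series defining [U0 g] converges in [L^2(R_+)], so [U0 g] is a choice
    of a representative of its sum. *)
Definition is_U0 (g : nat -> C) f : Prop :=
  L2 f /\
  (fun N => L2norm (fun t => f t - laguerre_sum g N t)) @ \oo --> (0 : R).

Definition U0 (g : nat -> C) : R -> C :=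
  xget (fun _ => 0) [set f : R -> C | is_U0 g f].

Definition U0inv f : nat -> C :=
  xget (fun _ => 0) [set g : nat -> C | ell2 g /\ L2eq (U0 g) f].

End HankelDefs.

(* Main.v *)
(** The Laplace transform [L] is a bounded symmetric operator on [L^2(R_+)] (Schur
    test) and turns convolutions into products, so the form of [H] is that of
    [L sigma L], a bounded operator.  The Laguerre functions [f_n] are orthonormal
    with [(L f_n)(l) = (l - 1/2)^n / (l + 1/2)^(n+1)]; hence, with
    [m = (l - 1/2) / (l + 1/2)] and [dm = (l + 1/2)^(-2) dl], the matrix element
    [(L sigma L f_m, f_n)] is the moment of order [n + m] of [eta].  The [f_n] are
    complete because [exp (- l t)] satisfies Parseval's identity for every [l > 0]
    and [L] is injective; as they are not test functions, they are approximated
    by means of smooth cutoffs. *)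

Require Import Defs.
From HB Require Import structures.
From mathcomp Require Import all_boot all_order all_algebra.
From mathcomp Require Import complex.
From mathcomp Require Import all_classical all_reals all_analysis.
From mathcomp Require Import measurable_realfun ring lra.

Set Implicit Arguments.
Unset Strict Implicit.
Unset Printing Implicit Defensive.

Import Order.TTheory GRing.Theory Num.Theory.
Import numFieldNormedType.Exports.

Local Open Scope classical_set_scope.
Local Open Scope ring_scope.

(** * Real [L^2] spaces: inner product, Cauchy-Schwarz inequality, completeness *)

Section SquareIntegrable.
Context d (T : measurableType d) (R : realType).
Variables (mu : {measure set T -> \bar R}) (D : set T).
Hypothesis mD : measurable D.
Implicit Types u v w : T -> R.

(** The kernel [exp (- t l)] is real, so the analysis is done for real functions and complex
    statements are split into real and imaginary parts; the form of [H] then consists of eight real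
    bilinear forms. [H] is an arbitrary bounded operator with the prescribed form on test functions,
    linear only up to null sets. The explicit operator [L sigma L] settles existence; for a given
    [H] the matrix elements are obtained from the form by passing to the limit in one argument at a
    time. [U0] and [U0inv] pick representatives, so nothing is known about them before existence is
    proved: completeness of [L^2] yields [U0 g], completeness of the Laguerre functions yields
    [U0inv F]. The matrix is then read off from Laguerre coefficients, which do not depend on the
    representative. As [sigma] is merely measurable, the substitution in the moment integral is
    carried out as an equality of two measures. Injectivity of [L] uses its values at the points
    [1 + k x]: series of exponentials in these points approximate step functions. *)

Definition sqint u :=
  measurable_fun D u /\ (\int[mu]_(x in D) ((u x) ^+ 2)%:E < +oo)%E.

(** A divergent integral gets a conventional real value here, hence the square-integrability
    hypotheses in the laws of linearity below. *)
Definition ip u v : R := \int[mu]_(x in D) (u x * v x).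

Lemma sqint_integrable_sqr u : sqint u ->
  mu.-integrable D (EFin \o (fun x => u x ^+ 2)).
Proof.
move=> [mu_ u2]; apply/integrableP; split.
  by apply/measurable_EFinP; exact: measurable_funX.
apply: le_lt_trans u2; apply: ge0_le_integral => //.
- apply: measurableT_comp => //.
  by apply/measurable_EFinP; exact: measurable_funX.
- by apply/measurable_EFinP; exact: measurable_funX.
- by move=> x _ /=; rewrite lee_fin ger0_norm// sqr_ge0.
Qed.

Lemma le_sqint u v : measurable_fun D u -> sqint v ->
  (forall x, D x -> `|u x| <= `|v x|) -> sqint u.
Proof.
move=> mu_ [mv v2] uv; split => //; apply: le_lt_trans v2.
apply: ge0_le_integral => //.
- by move=> x _; rewrite lee_fin sqr_ge0.
- by apply/measurable_EFinP; exact: measurable_funX.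
- by apply/measurable_EFinP; exact: measurable_funX.
- by move=> x Dx; rewrite lee_fin -(real_normK (num_real (u x)))
    -(real_normK (num_real (v x))) lerXn2r ?nnegrE// uv.
Qed.

Lemma sqint_integrableM u v : sqint u -> sqint v ->
  mu.-integrable D (EFin \o (fun x => u x * v x)).
Proof.
move=> su sv.
apply: (@le_integrable _ _ _ mu D mD _
  (EFin \o (fun x => u x ^+ 2 + v x ^+ 2))).
- by apply/measurable_EFinP; apply: measurable_funM; [case: su|case: sv].
- move=> x _ /=; rewrite lee_fin normrM [leRHS]ger0_norm ?addr_ge0 ?sqr_ge0//.
  rewrite -(real_normK (num_real (u x))) -(real_normK (num_real (v x))).
  by have := normr_ge0 (u x); have := normr_ge0 (v x); nra.
- rewrite (_ : EFin \o (fun x => u x ^+ 2 + v x ^+ 2) =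
    ((EFin \o (fun x => u x ^+ 2)%R) \+ (EFin \o (fun x => v x ^+ 2)%R))%E)//.
  by apply: integrableD => //; exact: sqint_integrable_sqr.
Qed.

Lemma integrable_sqint u : measurable_fun D u ->
  mu.-integrable D (EFin \o (fun x => u x ^+ 2)) -> sqint u.
Proof. by move=> mu_ /integrable_lty iu; split => //; exact: iu. Qed.

Lemma sqintZ (c : R) u : sqint u -> sqint (fun x => c * u x).
Proof.
move=> su; apply: integrable_sqint.
  by apply: measurable_funM => //; case: su.
rewrite (_ : _ \o _ =
    (fun x => (c ^+ 2)%:E * (EFin \o (fun x => u x ^+ 2)%R) x)%E).
  by apply: integrableZl => //; exact: sqint_integrable_sqr.
by apply/funext => x /=; rewrite -EFinM exprMn.
Qed.

Lemma sqintD u v : sqint u -> sqint v -> sqint (fun x => u x + v x).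
Proof.
move=> su sv; have iu := sqint_integrable_sqr su.
have iv := sqint_integrable_sqr sv.
apply: integrable_sqint.
  by apply: measurable_funD; [case: su|case: sv].
apply: (@le_integrable _ _ _ mu D mD _ (fun x => 2%:E *
    ((EFin \o (fun x => u x ^+ 2)%R) \+ (EFin \o (fun x => v x ^+ 2)%R)) x)%E).
- apply/measurable_EFinP; apply: measurable_funX.
  by apply: measurable_funD; [case: su|case: sv].
- move=> x _ /=; rewrite -?EFinD -?EFinM lee_fin !ger0_norm ?sqr_ge0//.
    by have := sqr_ge0 (u x - v x); nra.
  by rewrite mulr_ge0// addr_ge0 ?sqr_ge0.
- by apply: integrableZl => //; exact: integrableD.
Qed.

Lemma sqintB u v : sqint u -> sqint v -> sqint (fun x => u x - v x).
Proof.
move=> su sv; rewrite (_ : (fun _ => _) = (fun x => u x + -1 * v x)).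
  by apply: sqintD => //; exact: sqintZ.
by apply/funext => x; rewrite mulN1r.
Qed.

Lemma sqint0 : sqint (fun=> 0).
Proof.
split; first exact: measurable_cst.
rewrite (eq_integral (cst 0)%E); last by move=> x _; rewrite expr0n.
by rewrite integral0.
Qed.

Lemma sqint_sum (I : Type) (s : seq I) (F : I -> T -> R) :
  (forall i, sqint (F i)) -> sqint (fun x => \sum_(i <- s) F i x).
Proof.
move=> sF; elim: s => [|i s ih].
  by under eq_fun do rewrite big_nil; exact: sqint0.
by under eq_fun do rewrite big_cons; exact: sqintD.
Qed.

Lemma eq_sqint u v : {in D, u =1 v} -> sqint u -> sqint v.
Proof.
move=> uv su; apply: (@le_sqint _ u) => //.
  by case: su => + _; apply: eq_measurable_fun.
by move=> x Dx; rewrite uv ?inE.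
Qed.

Lemma eq_ip u v u' v' : {in D, u =1 u'} -> {in D, v =1 v'} ->
  ip u v = ip u' v'.
Proof. by move=> uu vv; apply: eq_Rintegral => x xD; rewrite uu ?vv. Qed.

Lemma ipC u v : ip u v = ip v u.
Proof. by apply: eq_Rintegral => x _; rewrite mulrC. Qed.

Lemma ipDl u v w : sqint u -> sqint v -> sqint w ->
  ip (fun x => u x + v x) w = ip u w + ip v w.
Proof.
move=> su sv sw; rewrite /ip -RintegralD//; try exact: sqint_integrableM.
by apply: eq_Rintegral => x _; rewrite mulrDl.
Qed.

Lemma ipBl u v w : sqint u -> sqint v -> sqint w ->
  ip (fun x => u x - v x) w = ip u w - ip v w.
Proof.
move=> su sv sw; rewrite /ip -RintegralB//; try exact: sqint_integrableM.
by apply: eq_Rintegral => x _; rewrite mulrBl.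
Qed.

Lemma ipZl c u w : sqint u -> sqint w ->
  ip (fun x => c * u x) w = c * ip u w.
Proof.
move=> su sw; rewrite /ip -RintegralZl//; try exact: sqint_integrableM.
by apply: eq_Rintegral => x _; rewrite mulrA.
Qed.

Lemma ipDr u v w : sqint u -> sqint v -> sqint w ->
  ip w (fun x => u x + v x) = ip w u + ip w v.
Proof. by move=> *; rewrite ipC ipDl// ipC (ipC v). Qed.

Lemma ipBr u v w : sqint u -> sqint v -> sqint w ->
  ip w (fun x => u x - v x) = ip w u - ip w v.
Proof. by move=> *; rewrite ipC ipBl// ipC (ipC v). Qed.

Lemma ipZr c u w : sqint u -> sqint w ->
  ip w (fun x => c * u x) = c * ip w u.
Proof. by move=> *; rewrite ipC ipZl// ipC. Qed.

Lemma ip0l w : ip (fun=> 0) w = 0.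
Proof.
rewrite /ip (@eq_Rintegral _ _ _ _ _ (cst 0)) => [|x _]; last by rewrite mul0r.
by rewrite /Rintegral integral0.
Qed.

Lemma ip_suml (I : Type) (s : seq I) (F : I -> T -> R) w :
  (forall i, sqint (F i)) -> sqint w ->
  ip (fun x => \sum_(i <- s) F i x) w = \sum_(i <- s) ip (F i) w.
Proof.
move=> sF sw; elim: s => [|i s ih].
  by under eq_fun do rewrite big_nil; rewrite big_nil ip0l.
under eq_fun do rewrite big_cons; rewrite big_cons ipDl// ?ih//.
exact: sqint_sum.
Qed.

Lemma ip_ge0 u : 0 <= ip u u.
Proof. by apply: Rintegral_ge0 => x _; rewrite -expr2 sqr_ge0. Qed.

Lemma ipxx u : ip u u = \int[mu]_(x in D) (u x ^+ 2).
Proof. by apply: eq_Rintegral => x _; rewrite expr2. Qed.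

Lemma EFin_ipxx u : sqint u ->
  (ip u u)%:E = (\int[mu]_(x in D) ((u x) ^+ 2)%:E)%E.
Proof.
move=> su; rewrite ipxx /Rintegral fineK//.
exact: (integrable_fin_num mD (sqint_integrable_sqr su)).
Qed.

Lemma sqint_normr u : sqint u -> sqint (Num.norm \o u).
Proof.
move=> su; apply: (@le_sqint _ u) => //.
  by apply: measurableT_comp => //; case: su.
by move=> x _ /=; rewrite normr_id.
Qed.

Lemma cauchy_schwarz u v : sqint u -> sqint v ->
  (ip u v) ^+ 2 <= ip u u * ip v v.
Proof.
move=> su sv.
have q (t : R) : 0 <= ip u u - 2 * t * ip u v + t ^+ 2 * ip v v.
  have := ip_ge0 (fun x => u x - t * v x).
  rewrite ipBl ?ipBr ?ipZl ?ipZr//; try exact: sqintZ.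
  rewrite (ipC v u); congr (0 <= _); ring.
  by apply: sqintB => //; exact: sqintZ.
have := ip_ge0 v; rewrite le_eqVlt => /predU1P[v0|v0].
  have [->|uv0] := eqVneq (ip u v) 0.
    by rewrite expr0n/= mulr_ge0// ip_ge0.
  (* When [ip v v = 0] the quadratic is affine in [t], and this [t] gives it the value [-1]. *)
  have := q ((ip u u + 1) / (2 * ip u v)); rewrite -v0 mulr0 addr0.
  rewrite (_ : 2 * _ * _ = ip u u + 1); last by field.
  by move=> h; exfalso; lra.
(* The minimum of the quadratic. *)
have := q (ip u v / ip v v).
rewrite (_ : _ + _ = ip u u - (ip u v) ^+ 2 / ip v v); last first.
  by field; rewrite gt_eqF.
by rewrite subr_ge0 ler_pdivrMr.
Qed.

Lemma ipD_le u v : sqint u -> sqint v ->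
  ip (fun x => u x + v x) (fun x => u x + v x) <= 2 * (ip u u + ip v v).
Proof.
move=> su sv; have := ip_ge0 (fun x => u x - v x).
rewrite ipBl ?ipBr ?ipDl ?ipDr//; try exact: sqintB; try exact: sqintD.
by rewrite (ipC v u); lra.
Qed.

Lemma ae_eq_ip u v w : sqint u -> sqint v -> sqint w ->
  {ae mu, forall x, D x -> u x = v x} -> ip u w = ip v w.
Proof.
move=> su sv sw uv; congr fine; apply: ae_eq_integral => //.
- by case/integrableP: (sqint_integrableM su sw).
- by case/integrableP: (sqint_integrableM sv sw).
- by apply: filterS uv => x /= uv Dx; rewrite uv.
Qed.

Lemma ae_eq_ipxx u v : sqint u -> sqint v ->
  {ae mu, forall x, D x -> u x = v x} -> ip u u = ip v v.
Proof.
by move=> su sv uv; rewrite (ae_eq_ip su sv su uv) ipC (ae_eq_ip su sv sv uv).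
Qed.

(* A subsequence [S (nn k)] whose increments [dS k] satisfy
   [sum_k 4^k * d k ^ 2 < +oo] almost everywhere converges pointwise there; its
   limit is the limit in the mean by Fatou's lemma. *)
Lemma riesz_fischer (S : nat -> T -> R) (r : nat -> R) :
  (forall n, sqint (S n)) -> r @ \oo --> (0 : R) ->
  (forall m n, ip (fun x => S n x - S m x) (fun x => S n x - S m x)
     <= r m + r n) ->
  exists2 u, sqint u & forall m,
    ip (fun x => u x - S m x) (fun x => u x - S m x) <= r m.
Proof.
move=> sS r0 Sr.
have r_ge0 m : 0 <= r m.
  have := Sr m m; rewrite -mulr2n -mulr_natr; have := ip_ge0 (fun x => S m x - S m x).
  by move=> h1 h2; lra.
(* The rate [8^-k] beats the weight [4^k]: the increments have squared norm at most [2 * 8^-k], so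
   the weighted sum [G] has integral at most the sum of the [2 * 2^-k]. *)
have /choice[nn nnP] : forall k, exists n, r n <= (8^-1) ^+ k.
  move=> k; have e0 : 0 < (8^-1 : R) ^+ k by rewrite exprn_gt0// invr_gt0.
  move/cvgrPdist_le : r0 => /(_ _ e0)[n _ /(_ n (leqnn n))].
  by rewrite sub0r normrN => h; exists n; rewrite (le_trans _ h)// ler_norm.
have rnn0 : r (nn k) @[k --> \oo] --> (0 : R).
  apply: (@squeeze_cvgr _ _ _ _ (cst 0) (fun k => (8^-1) ^+ k)).
  - by apply: nearW => k; rewrite r_ge0 nnP.
  - exact: cvg_cst.
  - by apply: cvg_expr; rewrite ger0_norm ?invr_ge0// invf_lt1// ltr1n.
pose dS k x := S (nn k.+1) x - S (nn k) x.
have sd k : sqint (dS k) by exact: sqintB.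
have dE k : ip (dS k) (dS k) <= 2 * (8^-1) ^+ k.
  rewrite (le_trans (Sr _ _))//.
  have := nnP k; have := nnP k.+1.
  have : 0 < (8^-1 : R) ^+ k by rewrite exprn_gt0// invr_gt0.
  by rewrite exprS; lra.
pose G x := (\sum_(0 <= k <oo) (4 ^+ k * (dS k x) ^+ 2)%:E)%E.
have mG_ k : measurable_fun D (fun x => (4 ^+ k * (dS k x) ^+ 2)%:E).
  apply/measurable_EFinP; apply: measurable_funM => //.
  by apply: measurable_funX; case: (sd k).
have G0_ k x : D x -> (0 <= (4 ^+ k * (dS k x) ^+ 2)%:E)%E.
  by move=> _; rewrite lee_fin mulr_ge0 ?sqr_ge0// exprn_ge0.
have mG : measurable_fun D G.
  by apply: ge0_emeasurable_sum => k *; [exact: G0_|exact: mG_].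
have iG : (\int[mu]_(x in D) G x < +oo)%E.
  rewrite /G integral_nneseries//.
  apply: (@le_lt_trans _ _ (\sum_(0 <= k <oo) (2 * (2^-1) ^+ k)%:E)%E).
    apply: lee_nneseries => [k _ _|k _].
      by apply: integral_ge0 => x Dx; exact: G0_.
    under eq_integral do rewrite EFinM.
    rewrite ge0_integralZl//; last 2 first.
    - by apply/measurable_EFinP; apply: measurable_funX; case: (sd k).
    - by move=> x _; rewrite lee_fin sqr_ge0.
    rewrite -EFin_ipxx// -EFinM lee_fin.
    rewrite (le_trans (ler_wpM2l _ (dE k)))// ?exprn_ge0//.
    rewrite mulrCA -exprMn (_ : 4 * 8^-1 = 2^-1)//; lra.
  rewrite (_ : limn _ = (2 / (1 - 2^-1))%:E) ?ltry//.
  apply/cvg_lim => //.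
  rewrite (_ : (fun n => _) = (fun n => (series (geometric 2 2^-1) n)%:E)).
    apply: cvg_EFin; first exact: nearW.
    by apply: cvg_geometric_series; rewrite ger0_norm// invf_lt1// ltr1n.
  by apply/funext => n; rewrite sumEFin.
have aeG : {ae mu, forall x, D x -> G x \is a fin_num}.
  apply: (integrable_ae mD); apply/integrableP; split => //.
  rewrite (eq_integral G)// => x; rewrite inE => Dx.
  by rewrite gee0_abs// nneseries_ge0// => *; exact: G0_.
(* The upper limit is measurable whether or not the sequence converges, and it is the limit wherever
   [G] is finite. *)
pose u x := fine (limn_esup (fun k => (S (nn k) x)%:E)).
have mu_ : measurable_fun D u.
  apply: measurableT_comp => //.
  apply: measurable_fun_limn_esup => n.
  by apply/measurable_EFinP; case: (sS (nn n)).
have uP x : D x -> G x \is a fin_num ->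
    S (nn k) x @[k --> \oo] --> u x.
  move=> Dx Gfin.
  have dk k : `|dS k x| <= (1 + fine (G x)) * (2^-1) ^+ k.
    have : ((4 ^+ k * (dS k x) ^+ 2)%:E <= G x)%E.
      rewrite /G (nneseriesD1 (n := k))//; last by move=> *; exact: G0_.
      by rewrite leeDl// nneseries_ge0// => *; exact: G0_.
    rewrite -(fineK Gfin) lee_fin => h.
    have G0 : 0 <= fine (G x).
      by rewrite fine_ge0// nneseries_ge0// => *; exact: G0_.
    rewrite -(@ler_pXn2r _ 2)// ?nnegrE ?mulr_ge0 ?addr_ge0 ?exprn_ge0//.
    rewrite real_normK ?num_real// exprMn -exprM mulnC exprM.
    rewrite (_ : 2^-1 ^+ 2 = 4^-1 :> R); last by lra.
    rewrite exprVn -ler_pdivrMr ?invr_gt0 ?exprn_gt0// invrK mulrC.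
    by rewrite (le_trans h)//; nra.
  have cd : cvgn (series (fun k => dS k x)).
    apply: normed_cvg; apply: (series_le_cvg _ _ dk) => //.
    - by move=> n; rewrite (le_trans _ (dk n)).
    - apply: (@is_cvg_geometric_series R (1 + fine (G x)) 2^-1).
      by rewrite ger0_norm// invf_lt1// ltr1n.
  have cS : cvgn (fun k => S (nn k) x).
    rewrite (_ : (fun k => _) = (fun k => S (nn 0%N) x + series (fun k => dS k x) k)).
      by apply: is_cvgD => //; exact: is_cvg_cst.
    apply/funext => k; rewrite /series/= /dS telescope_sumr//.
    by rewrite addrCA subrr addr0.
  have e : (S (nn k) x)%:E @[k --> \oo] --> (limn (fun k => S (nn k) x))%:E.
    by apply: cvg_EFin => //; exact: nearW.
  by rewrite /u (cvg_limn_einf_sup e).2.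
have key m : (\int[mu]_(x in D) ((u x - S m x) ^+ 2)%:E <= (r m)%:E)%E.
  apply: (@le_trans _ _ (\int[mu]_(x in D)
      limn_einf (fun k => ((S (nn k) x - S m x) ^+ 2)%:E))%E).
    apply: ae_ge0_le_integral => //.
    - by move=> x _; rewrite lee_fin sqr_ge0.
    - apply/measurable_EFinP; apply: measurable_funX; apply: measurable_funB => //.
      by case: (sS m).
    - move=> x _; rewrite limn_einf_lim; apply: lime_ge.
        exact: is_cvg_einfs.
      apply: nearW => n; apply: le_ereal_inf_tmp => _ [k /= _ <-].
      by rewrite lee_fin sqr_ge0.
    - apply: measurableT_comp => //; apply: measurable_fun_limn_esup => n.
      apply: measurableT_comp => //; apply/measurable_EFinP.
      apply: measurable_funX.
      by apply: measurable_funB; [case: (sS (nn n))|case: (sS m)].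
    - apply: filterS aeG => x /= Gx Dx.
      have e : ((S (nn k) x - S m x) ^+ 2)%:E @[k --> \oo] -->
          ((u x - S m x) ^+ 2)%:E.
        apply: cvg_EFin; first exact: nearW.
        rewrite /comp/= expr2; under eq_fun do rewrite expr2.
        have uS : S (nn k) x - S m x @[k --> \oo] --> u x - S m x.
          by apply: cvgB; [exact: (uP x Dx (Gx Dx))|exact: cvg_cst].
        exact: cvgM.
      by rewrite (cvg_limn_einf_sup e).1.
  apply: le_trans; first apply: fatou => //.
  - move=> n; apply/measurable_EFinP; apply: measurable_funX.
    by apply: measurable_funB; [case: (sS (nn n))|case: (sS m)].
  - by move=> n x _; rewrite lee_fin sqr_ge0.
  have rc : (r m + r (nn k))%:E @[k --> \oo] --> (r m)%:E.
    apply: cvg_EFin; first exact: nearW.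
    rewrite -[X in _ --> X]addr0 /comp/=; apply: cvgD; first exact: cvg_cst.
    exact: rnn0.
  rewrite -(cvg_limn_einf_sup rc).1 !limn_einf_lim.
  apply: lee_lim; [exact: is_cvg_einfs|exact: is_cvg_einfs|].
  apply: nearW => n; apply: le_ereal_inf_tmp => _ [k /= nk <-].
  apply: le_trans; first by apply: ereal_inf_lbound; exists k.
  rewrite -EFin_ipxx; last exact: sqintB.
  by rewrite lee_fin; exact: Sr.
have su0 m : sqint (fun x => u x - S m x).
  split; last by rewrite (le_lt_trans (key m))// ltry.
  by apply: measurable_funB => //; case: (sS m).
exists u.
  rewrite (_ : u = (fun x => (u x - S 0%N x) + S 0%N x)); first exact: sqintD.
  by apply/funext => x; rewrite subrK.
by move=> m; rewrite -lee_fin EFin_ipxx.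
Qed.

End SquareIntegrable.

(** * Smooth functions on the line and smooth cutoffs *)

Section SmoothFunctions.
Context {R : realType}.
Implicit Types (f g : R -> R) (a b c t : R) (p q : {poly R}).

(* A record, so that unification does not unfold it. *)
Record rsmooth f : Prop := RSmooth {
  rsmooth_derivable : forall (n : nat) t, derivable (derive1n n f) t 1 }.

Lemma is_derive_derive1 f (f' : R -> R) :
  (forall t, is_derive t 1 f (f' t)) -> f^`()%classic = f'.
Proof.
move=> ff'; apply/funext => t; rewrite derive1E.
by have := ff' t => d; rewrite derive_val.
Qed.

(** Coinduction: smooth functions form the largest class closed under differentiation. It suffices
    to exhibit a closed class, and no formula for an n-th derivative is needed. *)
Lemma rsmooth_coind (P : (R -> R) -> Prop) :
  (forall f, P f -> exists2 f' : R -> R, P f' & forall t, is_derive t 1 f (f' t)) ->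
  forall f, P f -> rsmooth f.
Proof.
move=> H f Pf; split => n; elim: n f Pf => [|n ih] f /H[f' Pf' ff'] t.
  by rewrite derive1n0; case: (ff' t).
by rewrite derive1Sn (is_derive_derive1 ff'); exact: ih.
Qed.

Lemma rsmooth_is_derive f t : rsmooth f -> is_derive t 1 f (f^`()%classic t).
Proof.
by move=> sf; rewrite derive1E; apply: derivableP; exact: (@rsmooth_derivable _ sf 0%N t).
Qed.

Lemma rsmooth_derive1 f : rsmooth f -> rsmooth f^`()%classic.
Proof.
by move=> sf; split=> n t; rewrite -derive1Sn; exact: rsmooth_derivable.
Qed.

Lemma rsmooth_continuous f : rsmooth f -> continuous f.
Proof.
move=> sf t; apply: differentiable_continuous.
by apply/derivable1_diffP; exact: (@rsmooth_derivable _ sf 0%N t).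
Qed.

Lemma rsmoothD f g : rsmooth f -> rsmooth g -> rsmooth (fun t => f t + g t).
Proof.
move=> sf sg; apply: (rsmooth_coind (P := fun h =>
  exists f g, [/\ rsmooth f, rsmooth g & h = (fun t => f t + g t)])).
  move=> _ [{}f [{}g [{}sf {}sg ->]]].
  exists (fun t => f^`()%classic t + g^`()%classic t).
    by exists f^`()%classic, g^`()%classic; split => //; exact: rsmooth_derive1.
  by move=> t; apply: is_deriveD; exact: rsmooth_is_derive.
by exists f, g.
Qed.

(** Leibniz' rule turns one product into a sum of two, so the class closed under differentiation is
    that of finite sums of products. *)
Inductive product_sum : (R -> R) -> Prop :=
| product_sum_mul f g : rsmooth f -> rsmooth g -> product_sum (fun t => f t * g t)
| product_sum_add f g : product_sum f -> product_sum g ->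
    product_sum (fun t => f t + g t).

Lemma rsmoothM f g : rsmooth f -> rsmooth g -> rsmooth (fun t => f t * g t).
Proof.
move=> sf sg; apply: (rsmooth_coind (P := product_sum)); last first.
  exact: product_sum_mul.
move=> {f g sf sg} h; elim => f g => [sf sg|_ [f' pf' ff'] _ [g' pg' gg']].
  exists (fun t => f t * g^`()%classic t + g t * f^`()%classic t).
    by apply: product_sum_add; apply: product_sum_mul => //;
      exact: rsmooth_derive1.
  by move=> t; apply: is_deriveM; exact: rsmooth_is_derive.
exists (fun t => f' t + g' t); first exact: product_sum_add.
by move=> t; apply: is_deriveD.
Qed.

Lemma rsmooth_horner p : rsmooth (horner p).
Proof.
apply: (rsmooth_coind (P := fun f => exists p, f = horner p)); last by exists p.
by move=> _ [q ->]; exists (horner q^`()); [exists q^`()|exact: is_derive_poly].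
Qed.

Lemma rsmooth_cst c : rsmooth (fun=> c).
Proof.
rewrite (_ : (fun=> c) = horner c%:P); first exact: rsmooth_horner.
by apply/funext => t; rewrite hornerC.
Qed.

Lemma rsmooth_affine f a b : rsmooth f -> rsmooth (fun t => f (a * t + b)).
Proof.
move=> sf; apply: (rsmooth_coind (P := fun h =>
  exists c f, rsmooth f /\ h = (fun t => c * f (a * t + b)))); last first.
  by exists 1, f; split => //; apply/funext => t; rewrite mul1r.
move=> _ [c [{}f [{}sf ->]]].
exists (fun t => (c * a) * f^`()%classic (a * t + b)).
  by exists (c * a), f^`()%classic; split => //; exact: rsmooth_derive1.
move=> t; have d1 : is_derive t 1 (fun t : R => a * t + b) a.
  by apply: is_derive_eq; rewrite addr0 scaler1.
have d2 := rsmooth_is_derive (a * t + b) sf.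
have d3 : is_derive t 1 (fun t => f (a * t + b)) (f^`()%classic (a * t + b) * a).
  exact: (@is_derive1_comp _ f (fun t => a * t + b) _ _ _ d2 d1).
by apply: (is_derive_eq (is_deriveZ c d3)); rewrite /GRing.scale/= mulrA mulrAC.
Qed.

Lemma rsmooth_expR a : rsmooth (fun t => expR (a * t)).
Proof.
suff se : rsmooth expR.
  rewrite (_ : (fun _ => _) = (fun t => expR (a * t + 0))).
    exact: rsmooth_affine.
  by apply/funext => t; rewrite addr0.
apply: (rsmooth_coind (P := fun f => f = expR)) => // _ ->.
by exists expR => // t; exact: is_derive_expR.
Qed.

Lemma expR_exprn_bound (n : nat) (y : R) : 0 < y -> y ^+ n <= n`!%:R * expR y.
Proof.
move=> y0; case: n => [|n].
  by rewrite fact0 mul1r expr0 -expR0 ler_expR ltW.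
have /(le_trans _) : 1 + y ^+ n.+1 / n.+1`!%:R <= expR y.
  by apply: expR_ge1Dxn; exact: ltW.
move=> /(_ (y ^+ n.+1 / n.+1`!%:R)); rewrite lerDr ler01 => /(_ isT).
by rewrite ler_pdivrMr ?ltr0n ?fact_gt0// mulrC.
Qed.

(** The power [m] is quantified inside the induction: for [p * 'X + c] the factor [y] is moved from
    the polynomial to the power, and the induction hypothesis is used at [m + 1]. *)
Lemma horner_expR_bound p : forall m : nat, exists C : R, forall y : R, 0 < y ->
  `|p.[y]| * y ^+ m <= C * expR y.
Proof.
elim/poly_ind: p => [|p c ih] m.
  by exists 0 => y _; rewrite horner0 normr0 !mul0r.
have [C CP] := ih m.+1; exists (C + `|c| * m`!%:R) => y y0.
rewrite hornerD hornerM hornerX hornerC mulrDl.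
have h := CP y y0; have h2 := expR_exprn_bound m y0.
rewrite (@le_trans _ _ ((`|p.[y]| * y + `|c|) * y ^+ m))//.
  apply: ler_wpM2r; first by rewrite exprn_ge0// ltW.
  rewrite (le_trans (ler_normD _ _))//.
  by rewrite lerD2r normrM (gtr0_norm y0).
rewrite mulrDl lerD//; first by rewrite -mulrA -exprS.
by rewrite -mulrA ler_wpM2l.
Qed.

(** The classical function [exp (- 1 / t)], flat at 0. The polynomial in [1 / t] makes the family
    closed under differentiation, which replaces [p] by [X^2 (p - p')]. *)
Definition flat p t : R := if 0 < t then p.[t^-1] * expR (- t^-1) else 0.

(** The exponential absorbs [p] and two more powers of [1 / t]. Order 2 is what makes the difference
    quotient at 0 tend to 0. *)
Lemma flat_bound p : exists C : R, forall t, `|flat p t| <= C * t ^+ 2.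
Proof.
have [C CP] := horner_expR_bound p 2.
have C0 : 0 <= C.
  have := CP 1 ltr01; rewrite expr1n mulr1 => /(le_trans (normr_ge0 _)).
  by rewrite pmulr_lge0// expR_gt0.
exists C => t; rewrite /flat; case: ifPn => [t0|_]; last first.
  by rewrite normr0 mulr_ge0// sqr_ge0.
have ti : 0 < t^-1 by rewrite invr_gt0.
rewrite normrM (gtr0_norm (expR_gt0 _)) expRN ler_pdivrMr ?expR_gt0//.
rewrite mulrAC -ler_pdivrMr ?exprn_gt0// -exprVn.
exact: CP.
Qed.

Lemma is_derive_flat p t : is_derive t 1 (flat p) (flat ('X^2 * (p - p^`())) t).
Proof.
have [t0|t0|->] := ltrgt0P t.
- have d1 : is_derive t 1 (fun x : R => x^-1) (- t ^- 2).
    have := @is_deriveV _ id t 1 1 (lt0r_neq0 t0) _.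
    by rewrite /GRing.scale/= mulr1; exact.
  have d2 := is_derive1_comp (is_derive_poly p t^-1) d1.
  have d3 : is_derive t 1 (fun x => - x^-1) (t ^- 2).
    by apply: is_derive_eq; rewrite opprK.
  have d4 := @is_derive1_comp _ expR (fun x => - x^-1) _ _ _
    (is_derive_expR (- t^-1)) d3.
  have d5 := is_deriveM d2 d4.
  have d6 : is_derive t 1 (fun x : R => p.[x^-1] * expR (- x^-1))
      (flat ('X^2 * (p - p^`())) t).
    apply: (is_derive_eq d5).
    rewrite /flat t0 hornerM hornerXn hornerD hornerN /GRing.scale/= exprVn.
    by ring.
  apply: near_eq_is_derive d6.
  near=> x; rewrite /flat ifT//; near: x; exact: lt_nbhsr.
- rewrite [X in is_derive _ _ _ X](_ : _ = 0); last first.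
    by rewrite /flat ltNge (ltW t0).
  have d0 : is_derive t 1 (cst (0 : R)) (0 : R) by exact: is_derive_cst.
  apply: near_eq_is_derive d0.
  near=> x; rewrite /flat ifF//; apply/negbTE; rewrite -leNgt ltW//.
  by near: x; exact: lt_nbhsl.
- rewrite /flat ltxx; have [C CP] := flat_bound p.
  have fl0 : flat p 0 = 0 by rewrite /flat ltxx.
  have C0 : 0 <= C by have := CP 1; rewrite expr1n mulr1; exact: le_trans.
  suff d : (fun h : R => h^-1 *: (flat p (h *: 1 + 0) - flat p 0)) @ 0^' --> (0 : R).
    apply: DeriveDef; first by apply/cvg_ex; exists 0; exact: d.
    by apply/cvg_lim.
  apply/norm_cvg0P; apply: (@squeeze_cvgr _ _ _ _ (cst 0) (fun h : R => C * `|h|)).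
  - near=> h; rewrite normr_ge0/= fl0 subr0 addr0 /GRing.scale/= mulr1.
    have h0 : h != 0 by near: h; exact: nbhs_dnbhs_neq.
    rewrite normrM normfV ler_pdivrMl ?normr_gt0// (le_trans (CP h))//.
    by rewrite -(real_normK (num_real h)) expr2 mulrCA.
  - exact: cvg_cst.
  - rewrite -[X in _ --> X](mulr0 C); apply: cvgM; first exact: cvg_cst.
    rewrite -[X in _ --> X](@normr0 _ R); apply: cvg_norm.
    exact: nbhs_dnbhs.
Unshelve. all: by end_near. Qed.

Lemma rsmooth_flat p : rsmooth (flat p).
Proof.
apply: (rsmooth_coind (P := fun f => exists p, f = flat p)); last by exists p.
move=> _ [q ->]; exists (flat ('X^2 * (q - q^`()))); last exact: is_derive_flat.
by exists ('X^2 * (q - q^`())).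
Qed.

Definition rtest f :=
  rsmooth f /\ exists x y : R, 0 < x /\ forall t, ~ (x <= t <= y) -> f t = 0.

(** Positive exactly for [1 / (k + 1) < t < k + 1]. No plateau of value 1 is built: values in
    [[0, 1]] and pointwise convergence to 1 on the half-line suffice for dominated convergence. *)
Definition cutoff (k : nat) t : R :=
  flat 1 (k.+1%:R * t - 1) * flat 1 (k.+1%:R ^+ 2 - k.+1%:R * t).

Lemma flat1_ge0 t : 0 <= flat 1 t.
Proof. by rewrite /flat; case: ifP => // _; rewrite hornerC mul1r expR_ge0. Qed.

Lemma flat1_le1 t : flat 1 t <= 1.
Proof.
rewrite /flat; case: ifP => // t0; rewrite hornerC mul1r -[leRHS]expR0 ler_expR.
by rewrite oppr_le0 invr_ge0 ltW.
Qed.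

Lemma cutoff_ge0 k t : 0 <= cutoff k t.
Proof. by rewrite mulr_ge0// flat1_ge0. Qed.

Lemma cutoff_le1 k t : cutoff k t <= 1.
Proof. by rewrite mulr_ile1// ?flat1_ge0// flat1_le1. Qed.

Lemma rsmooth_cutoff k : rsmooth (cutoff k).
Proof.
apply: rsmoothM; first exact: (rsmooth_affine _ _ (rsmooth_flat 1)).
rewrite (_ : (fun _ => _) =
    (fun t => flat 1 (- k.+1%:R * t + k.+1%:R ^+ 2))).
  exact: (rsmooth_affine _ _ (rsmooth_flat 1)).
by apply/funext => t; rewrite mulNr addrC.
Qed.

Lemma rtest_cutoff k f : rsmooth f -> rtest (fun t => cutoff k t * f t).
Proof.
move=> sf; split; first by apply: rsmoothM => //; exact: rsmooth_cutoff.
exists k.+1%:R^-1, k.+1%:R; split; first by rewrite invr_gt0.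
move=> t h; rewrite /cutoff /flat; case: ifPn => [t1|]; last by rewrite !mul0r.
case: ifPn => [t2|]; last by rewrite mulr0 mul0r.
exfalso; apply: h; apply/andP; split.
  by rewrite -[_^-1]mul1r ler_pdivrMr// mulrC ltW// -subr_gt0.
rewrite -(@ler_pM2l _ k.+1%:R)// -expr2 ltW// -subr_gt0//.
Qed.

Lemma cvg_flat1 (u : nat -> R) : u @ \oo --> +oo -> flat 1 (u n) @[n --> \oo] --> (1 : R).
Proof.
move=> uoo; apply: (@squeeze_cvgr _ _ _ _ (fun n => 1 - (u n)^-1) (cst 1)).
- near=> n; rewrite flat1_le1 andbT /flat ifT; last first.
    by near: n; move/cvgryPgt : uoo; exact.
  by rewrite hornerC mul1r (le_trans _ (expR_ge1Dx _)).
- rewrite -[X in _ --> X](subr0 1); apply: cvgB; first exact: cvg_cst.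
  by apply/gtr0_cvgV0 => //; near=> n; near: n; move/cvgryPgt : uoo; exact.
- exact: cvg_cst.
Unshelve. all: by end_near. Qed.

Lemma cvg_cutoff t : 0 < t -> cutoff k t @[k --> \oo] --> (1 : R).
Proof.
move=> t0; rewrite -[X in _ --> X](mulr1 1); apply: cvgM; apply: cvg_flat1.
  apply/cvgryPge => A; near=> k.
  have : (A + 1) / t <= k.+1%:R.
    rewrite (@le_trans _ _ k%:R) ?ler_nat//.
    by near: k; exact: nbhs_infty_ger.
  by rewrite ler_pdivrMr// => h; rewrite lerBrDr.
apply/cvgryPge => A; near=> k.
(* The argument of the second factor is [(k + 1) (k + 1 - t)]: its first factor is at least 1 and
   its second at least [|A|]. *)
have : Num.max 1 (`|A| + t) <= k.+1%:R.
  rewrite (@le_trans _ _ k%:R) ?ler_nat//.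
  by near: k; exact: nbhs_infty_ger.
rewrite ge_max => /andP[k1 kA]; have := normr_ge0 A; have := ler_norm A.
nra.
Unshelve. all: by end_near. Qed.

End SmoothFunctions.

(** * Exponential monomials and the Laplace transform of real functions *)

Section LaplaceTransform.
Context {R : realType}.
Local Notation mu := (@lebesgue_measure R).
Local Notation Rplus := (@Rplus R).
Implicit Types (u v : R -> R) (a b l t p : R).

Lemma measurable_Rplus : measurable (Rplus : set (measurableTypeR R)).
Proof. exact: measurable_itv. Qed.

(* Lebesgue measure lives on [measurableTypeR R], which is convertible but not
   syntactically equal to [R] with its canonical measurable structure. *)
Lemma measurable_RplusR : measurable Rplus.
Proof. exact: measurable_itv. Qed.

Hint Resolve measurable_Rplus measurable_RplusR : core.

Lemma RplusE t : Rplus t <-> 0 < t.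
Proof. by rewrite /Defs.Rplus/= in_itv/= andbT. Qed.

Lemma eq_integral_Rplus (g f : R -> \bar R) :
  (forall t, 0 < t -> f t = g t) ->
  (\int[mu]_(t in Rplus) f t = \int[mu]_(t in Rplus) g t)%E.
Proof. by move=> fg; apply: eq_integral => t; rewrite inE => /RplusE/fg. Qed.

Lemma eq_Rintegral_Rplus (g f : R -> R) : (forall t, 0 < t -> f t = g t) ->
  \int[mu]_(t in Rplus) f t = \int[mu]_(t in Rplus) g t.
Proof. by move=> fg; apply: eq_Rintegral => t; rewrite inE => /RplusE/fg. Qed.

(** One family contains the Laplace kernel ([k = 0]) and the terms of the Laguerre functions
    ([a = 1/2]). It is stable under products, so all their inner products come from a single
    integral. *)
Definition monexp (k : nat) a t : R := t ^+ k * expR (- (t * a)).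

Lemma rsmooth_monexp k a : rsmooth (monexp k a).
Proof.
rewrite (_ : monexp k a = (fun t => ('X^k : {poly R}).[t] * expR (- a * t))).
  by apply: rsmoothM; [exact: rsmooth_horner|exact: rsmooth_expR].
by apply/funext => t; rewrite /monexp hornerXn mulNr (mulrC a).
Qed.

Lemma cvg_monexp k a : 0 < a -> monexp k a t @[t --> +oo] --> (0 : R).
Proof.
move=> a0; apply/norm_cvg0P.
pose C := k.+1`!%:R / a ^+ k.+1.
apply: (@squeeze_cvgr _ _ _ _ (cst 0) (fun t => C * t^-1)).
- near=> t; have t0 : 0 < t by near: t; exact: nbhs_pinfty_gt.
  have t0W := ltW t0.
  rewrite normr_ge0/= /monexp ger0_norm ?mulr_ge0 ?expR_ge0 ?exprn_ge0//.
  have := @expR_exprn_bound R k.+1 (t * a) (mulr_gt0 t0 a0).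
  rewrite expRN ler_pdivrMr ?expR_gt0// => h.
  rewrite mulrAC ler_pdivlMr// -exprSr /C mulrAC ler_pdivlMr ?exprn_gt0//.
  by rewrite -exprMn.
- exact: cvg_cst.
- rewrite -[X in _ --> X](mulr0 C); apply: cvgM; first exact: cvg_cst.
  apply/gtr0_cvgV0; first by near=> t; near: t; exact: nbhs_pinfty_gt.
  exact: cvg_id.
Unshelve. all: by end_near. Qed.

(** Integration by parts: the primitive of index [k + 1] is [(k + 1) / a] times that of index [k],
    minus [t^(k+1) e^(-ta) / a]. It is normalised to vanish at infinity, so that [- F 0] is the
    integral over the half-line. *)
Lemma monexp_primitive k a : 0 < a -> exists F : R -> R,
  [/\ F 0 = - (k`!%:R / a ^+ k.+1), F t @[t --> +oo] --> (0 : R) &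
      forall t, is_derive t 1 F (monexp k a t)].
Proof.
move=> a0; have an0 : a != 0 by rewrite gt_eqF.
elim: k => [|k [F [F0 Foo dF]]].
  exists (fun t => - a^-1 * monexp 0 a t); split.
  - by rewrite /monexp mul0r oppr0 expR0 !expr0 !mulr1 expr1 fact0 mul1r.
  - rewrite -[X in _ --> X](mulr0 (- a^-1)).
    by apply: cvgM; [exact: cvg_cst|exact: cvg_monexp].
  - move=> t; have d1 : is_derive t 1 (fun t => - (t * a)) (- a).
      by apply: is_derive_eq; rewrite /GRing.scale/= mulr0 add0r mulr1.
    have d2 := @is_derive1_comp _ expR (fun t => - (t * a)) _ _ _
      (is_derive_expR _) d1.
    rewrite (_ : (fun t => _) = (fun t => - a^-1 * expR (- (t * a)))).
      apply: (is_derive_eq (is_deriveZ (- a^-1) d2)).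
      by rewrite /GRing.scale/= /monexp expr0 mul1r; field.
    by apply/funext => s; rewrite /monexp expr0 mul1r.
exists (fun t => k.+1%:R / a * F t - a^-1 * monexp k.+1 a t); split.
- rewrite F0 /monexp expr0n/= !mul0r mulr0 subr0 factS natrM (exprS a k.+1).
  by field; rewrite expf_neq0.
- have c1 : k.+1%:R / a * F t @[t --> +oo] --> k.+1%:R / a * 0.
    by apply: cvgM => //; exact: cvg_cst.
  have c2 : a^-1 * monexp k.+1 a t @[t --> +oo] --> a^-1 * 0.
    by apply: cvgM; [exact: cvg_cst|exact: cvg_monexp].
  rewrite [X in _ --> X](_ : _ = k.+1%:R / a * 0 - a^-1 * 0).
    exact: cvgB.
  by rewrite !mulr0 subr0.
- move=> t; have d1 : is_derive t 1 (fun t => - (t * a)) (- a).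
    by apply: is_derive_eq; rewrite /GRing.scale/= mulr0 add0r mulr1.
  have d2 := @is_derive1_comp _ expR (fun t => - (t * a)) _ _ _
    (is_derive_expR _) d1.
  have d3 : is_derive t 1 (fun t => t ^+ k.+1) (k.+1%:R * t ^+ k).
    rewrite (_ : (fun _ => _) = horner ('X^(k.+1))); last first.
      by apply/funext => s; rewrite hornerXn.
    apply: (is_derive_eq (is_derive_poly _ _)).
    by rewrite derivXn hornerMn hornerXn mulr_natl.
  have d4 := is_deriveM d3 d2.
  have d5 := is_deriveB (is_deriveZ (k.+1%:R / a) (dF t)) (is_deriveZ (a^-1) d4).
  apply: (is_derive_eq d5); rewrite /GRing.scale/= /monexp exprS; field.
  by [].
Qed.

Lemma integral_monexp k a : 0 < a ->
  (\int[mu]_(t in Rplus) (monexp k a t)%:E = (k`!%:R / a ^+ k.+1)%:E)%E.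
Proof.
move=> a0; have [F [F0 Foo dF]] := monexp_primitive k a0.
have cm : continuous (monexp k a).
  by apply: rsmooth_continuous; exact: rsmooth_monexp.
rewrite /Defs.Rplus integral_itv_obnd_cbnd; last first.
  apply/measurable_EFinP; apply: measurable_funS (continuous_measurable_fun cm) => //.
rewrite (ge0_continuous_FTC2y (F := F) (l := 0)) ?F0 ?sub0e ?oppeK//.
- by rewrite -EFinN opprK.
- by move=> t t0; rewrite mulr_ge0 ?expR_ge0// exprn_ge0.
- exact: continuous_subspaceT.
- rewrite -F0; apply: cvg_at_right_filter.
  apply: differentiable_continuous; apply/derivable1_diffP.
  by case: (dF 0).
- by move=> t _; rewrite derive1E; have := dF t => d; rewrite derive_val.
Qed.

End LaplaceTransform.

Section LaplaceOperator.
Context {R : realType}.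
Local Notation mu := (@lebesgue_measure R).
Local Notation Rplus := (@Rplus R).
Local Notation L2r := (sqint mu Rplus).
Local Notation "'[ u , v ]" := (ip mu Rplus u v).
Implicit Types (u v : R -> R) (a b l t p : R).

Hint Resolve measurable_Rplus measurable_RplusR : core.

Lemma measurable_monexp (D : set R) k a : measurable_fun D (monexp k a).
Proof.
apply: measurable_funTS; apply: continuous_measurable_fun.
by apply: rsmooth_continuous; exact: rsmooth_monexp.
Qed.

Lemma monexpM j k a b t :
  monexp j a t * monexp k b t = monexp (j + k) (a + b) t.
Proof.
by rewrite /monexp mulrACA -exprD -expRD; congr (_ * expR _); ring.
Qed.

Lemma sqint_monexp k a : 0 < a -> L2r (monexp k a).
Proof.
move=> a0; split; first exact: measurable_monexp.
under eq_integral do rewrite expr2 monexpM.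
by rewrite integral_monexp ?addr_gt0// ltry.
Qed.

Lemma ip_monexp j k a b : 0 < a + b ->
  '[monexp j a, monexp k b] = (j + k)`!%:R / (a + b) ^+ (j + k).+1.
Proof.
move=> ab; rewrite /ip /Rintegral.
by under eq_integral do rewrite monexpM; rewrite integral_monexp.
Qed.

Definition lap u l : R := \int[mu]_(t in Rplus) (expR (- (t * l)) * u t).

Lemma lapE u l : lap u l = '[u, monexp 0 l].
Proof.
by apply: eq_Rintegral => t _; rewrite /monexp expr0 mul1r mulrC.
Qed.

Lemma integrable_lap u l : L2r u -> 0 < l ->
  mu.-integrable Rplus (EFin \o (fun t => expR (- (t * l)) * u t)).
Proof.
move=> su l0; have sl := sqint_monexp 0 l0.
have := sqint_integrableM (mu := mu) measurable_Rplus sl su; apply: eq_integrable => // t _.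
by rewrite /= /monexp expr0 mul1r.
Qed.

Lemma eq_lap u v l : {in Rplus, u =1 v} -> lap u l = lap v l.
Proof. by move=> uv; apply: eq_Rintegral => t tR; rewrite uv. Qed.

Lemma lapD u v l : L2r u -> L2r v -> 0 < l ->
  lap (fun t => u t + v t) l = lap u l + lap v l.
Proof. by move=> su sv l0; rewrite !lapE ipDl//; exact: sqint_monexp. Qed.

Lemma lapB u v l : L2r u -> L2r v -> 0 < l ->
  lap (fun t => u t - v t) l = lap u l - lap v l.
Proof. by move=> su sv l0; rewrite !lapE ipBl//; exact: sqint_monexp. Qed.

Lemma lapZ c u l : L2r u -> 0 < l -> lap (fun t => c * u t) l = c * lap u l.
Proof. by move=> su l0; rewrite !lapE ipZl//; exact: sqint_monexp. Qed.

Lemma EFin_lap u l : L2r u -> 0 < l ->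
  (lap u l)%:E = (\int[mu]_(t in Rplus) (expR (- (t * l)) * u t)%:E)%E.
Proof.
move=> su l0; rewrite /lap /Rintegral fineK//.
exact: (integrable_fin_num _ (integrable_lap su l0)).
Qed.

Lemma measurable_kernel : measurable_fun setT (fun x : R * R => expR (- (x.2 * x.1))).
Proof.
apply: measurableT_comp => //; apply: measurableT_comp => //.
by apply: measurable_funM; [exact: measurable_snd|exact: measurable_fst].
Qed.

Lemma measurable_lap u (D : set R) : measurable_fun Rplus u -> measurable_fun D (lap u).
Proof.
move=> mu_; apply: measurable_funTS.
pose f (x : R * R) := (expR (- (x.2 * x.1)) * (u \_ Rplus) x.2)%:E.
have mf : measurable_fun setT f.
  apply/measurable_EFinP; apply: measurable_funM; first exact: measurable_kernel.
  apply: (measurableT_comp (f := u \_ Rplus)) => //.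
  exact: (measurable_restrictT u measurable_RplusR).1.
(* By definition the integral is that of the positive part minus that of the negative part, and
   Tonelli makes each measurable in [l]; thus [lap u] is measurable also at the [l] where the
   integral diverges. *)
rewrite (_ : lap u = (fun l => fine (\int[mu]_t (f^\+)%E (l, t) -
    \int[mu]_t (f^\-)%E (l, t))%E)).
  apply: measurableT_comp => //; apply: emeasurable_funB.
  - by apply: (measurable_fun_fubini_tonelli_F (m2 := mu) f^\+%E) => //; exact: measurable_funepos.
  - by apply: (measurable_fun_fubini_tonelli_F (m2 := mu) f^\-%E) => //; exact: measurable_funeneg.
apply/funext => l; rewrite /lap Rintegral_mkcond /Rintegral integralE.
congr (fine (_ - _)%E); apply: eq_integral => t _.
  by rewrite !funeposE /f/= !patchE; case: ifP => _; rewrite ?mulr0.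
by rewrite !funenegE /f/= !patchE; case: ifP => _; rewrite ?mulr0.
Qed.

End LaplaceOperator.

(** * Fubini and Tonelli theorems on a measurable rectangle *)

Section FubiniOnRectangles.
Context d1 d2 (T1 : measurableType d1) (T2 : measurableType d2) (R : realType).
Variables (m1 : {sigma_finite_measure set T1 -> \bar R}).
Variables (m2 : {sigma_finite_measure set T2 -> \bar R}).
Variables (D1 : set T1) (D2 : set T2) (f : T1 * T2 -> \bar R).
Hypotheses (mD1 : measurable D1) (mD2 : measurable D2).
Hypothesis mf : measurable_fun (D1 `*` D2) f.
Local Open Scope ereal_scope.

Let g : T1 * T2 -> \bar R := f \_ (D1 `*` D2).

Let mg : measurable_fun setT g.
Proof. by apply: (measurable_restrictT f _).1 => //; exact: measurableX. Qed.

Let gE x y : g (x, y) = if x \in D1 then if y \in D2 then f (x, y) else 0 else 0.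
Proof.
rewrite /g patchE; have [xD|xD] := boolP (x \in D1); last first.
  by rewrite ifF//; apply/negbTE; rewrite notin_setE => -[/= /mem_set h _]; rewrite h in xD.
have [yD|yD] := boolP (y \in D2).
  by rewrite ifT// inE; split; exact: set_mem.
by rewrite ifF//; apply/negbTE; rewrite notin_setE => -[_ /= /mem_set h]; rewrite h in yD.
Qed.

(** [h] stands for the identity or for [abse]: the integral and the condition of absolute
    integrability are transported alike, as [h 0 = 0] is compatible with extension by zero. *)
Let integral12E (h : \bar R -> \bar R) : h 0 = 0 ->
  \int[m1]_(x in D1) \int[m2]_(y in D2) h (f (x, y)) =
  \int[m1]_x \int[m2]_y h (g (x, y)).
Proof.
move=> h0; rewrite integral_mkcond; apply: eq_integral => x _; rewrite patchE.
have [xD|xD] := boolP (x \in D1); last first.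
  by rewrite integral0_eq// => y _; rewrite gE (negbTE xD).
rewrite integral_mkcond; apply: eq_integral => y _; rewrite patchE gE xD.
by case: ifP.
Qed.

Let integral21E (h : \bar R -> \bar R) : h 0 = 0 ->
  \int[m2]_(y in D2) \int[m1]_(x in D1) h (f (x, y)) =
  \int[m2]_y \int[m1]_x h (g (x, y)).
Proof.
move=> h0; rewrite integral_mkcond; apply: eq_integral => y _; rewrite patchE.
have [yD|yD] := boolP (y \in D2); last first.
  by rewrite integral0_eq// => x _; rewrite gE (negbTE yD); case: ifP.
rewrite integral_mkcond; apply: eq_integral => x _; rewrite patchE gE yD.
by case: ifP.
Qed.

Lemma fubini_tonelli_on :
  (forall x y, D1 x -> D2 y -> 0 <= f (x, y)) ->
  \int[m1]_(x in D1) \int[m2]_(y in D2) f (x, y) =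
  \int[m2]_(y in D2) \int[m1]_(x in D1) f (x, y).
Proof.
move=> f0; rewrite (integral12E (h := id))// (integral21E (h := id))//.
apply: (fubini_tonelli g) => // -[x y]; rewrite gE.
by case: ifPn => // xD; case: ifPn => // yD; apply: f0; exact: set_mem.
Qed.

Lemma fubini_on :
  \int[m1]_(x in D1) \int[m2]_(y in D2) `|f (x, y)| < +oo ->
  \int[m1]_(x in D1) \int[m2]_(y in D2) f (x, y) =
  \int[m2]_(y in D2) \int[m1]_(x in D1) f (x, y).
Proof.
rewrite (integral12E (h := abse)) ?abse0// => fi.
rewrite (integral12E (h := id))// (integral21E (h := id))//.
by apply: Fubini; exact/integrable12ltyP.
Qed.

Lemma measurable_fubini_tonelli_on :
  (forall x y, D1 x -> D2 y -> 0 <= f (x, y)) ->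
  measurable_fun D1 (fun x => \int[m2]_(y in D2) f (x, y)).
Proof.
move=> f0; apply/(measurable_restrictT _ mD1).
rewrite (_ : _ \_ _ = fun x => \int[m2]_y g (x, y)).
  apply: (measurable_fun_fubini_tonelli_F g) => // -[x y]; rewrite gE.
  by case: ifPn => // xD; case: ifPn => // yD; apply: f0; exact: set_mem.
apply/funext => x; rewrite patchE.
have [xD|xD] := boolP (x \in D1); last first.
  by rewrite integral0_eq// => y _; rewrite gE (negbTE xD).
rewrite integral_mkcond; apply: eq_integral => y _; rewrite patchE gE xD.
by case: ifP.
Qed.

Lemma measurable_fubini_tonelli_on_r :
  (forall x y, D1 x -> D2 y -> 0 <= f (x, y)) ->
  measurable_fun D2 (fun y => \int[m1]_(x in D1) f (x, y)).
Proof.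
move=> f0; apply/(measurable_restrictT _ mD2).
rewrite (_ : _ \_ _ = fun y => \int[m1]_x g (x, y)).
  apply: (measurable_fun_fubini_tonelli_G g) => // -[x y]; rewrite gE.
  by case: ifPn => // xD; case: ifPn => // yD; apply: f0; exact: set_mem.
apply/funext => y; rewrite patchE.
have [yD|yD] := boolP (y \in D2); last first.
  by rewrite integral0_eq// => x _; rewrite gE (negbTE yD); case: ifP.
rewrite integral_mkcond; apply: eq_integral => x _; rewrite patchE gE yD.
by case: ifP.
Qed.

End FubiniOnRectangles.

(** * Symmetry of the Laplace transform and its bound on [L^2] *)

Section LaplaceBound.
Context {R : realType}.
Local Notation mu := (@lebesgue_measure R).
Local Notation Rplus := (@Rplus R).
Local Notation L2r := (sqint mu Rplus).
Local Notation "'[ u , v ]" := (ip mu Rplus u v).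
Implicit Types (u v : R -> R) (a b l t p : R).

Hint Resolve measurable_Rplus measurable_RplusR : core.

Lemma measurable_fst_RplusX u : measurable_fun Rplus u ->
  measurable_fun (Rplus `*` Rplus) (fun x : R * R => u x.1).
Proof.
move=> mu_; apply: (measurable_comp (F := Rplus)); [exact: measurable_RplusR| |exact: mu_|].
  by move=> _ [x [? ?] <-].
exact: (measurable_funTS measurable_fst).
Qed.

Lemma measurable_snd_RplusX u : measurable_fun Rplus u ->
  measurable_fun (Rplus `*` Rplus) (fun x : R * R => u x.2).
Proof.
move=> mu_; apply: (measurable_comp (F := Rplus)); [exact: measurable_RplusR| |exact: mu_|].
  by move=> _ [x [? ?] <-].
exact: (measurable_funTS measurable_snd).
Qed.

(** Fubini's theorem for the symmetric kernel. Square integrability of the transform of [|u|] makes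
    the double integral against [|v|] converge absolutely; the Schur bound supplies it in
    [ip_lapC]. *)
Lemma lap_symmetric u v : L2r u -> L2r v -> L2r (lap (Num.norm \o u)) ->
  '[lap u, v] = '[u, lap v].
Proof.
move=> su sv sLu; rewrite /ip.
pose f (x : R * R) := (expR (- (x.2 * x.1)) * u x.2 * v x.1)%:E.
have mf : measurable_fun (Rplus `*` Rplus) f.
  apply/measurable_EFinP; apply: measurable_funM; first apply: measurable_funM.
  - by apply: measurable_funTS; exact: measurable_kernel.
  - by apply: measurable_snd_RplusX; case: su.
  - by apply: measurable_fst_RplusX; case: sv.
have intf l : Rplus l -> (\int[mu]_(t in Rplus) f (l, t))%E = (lap u l * v l)%:E.
  move=> /RplusE l0; under eq_integral do rewrite /f/= EFinM.
  rewrite integralZr//; last exact: integrable_lap.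
  by rewrite EFinM EFin_lap.
have intfabs l : Rplus l -> (\int[mu]_(t in Rplus) `|f (l, t)|)%E =
    (lap (Num.norm \o u) l * `|v l|)%:E.
  move=> /RplusE l0.
  under eq_integral do rewrite /f/= normrM normrM (ger0_norm (expR_ge0 _)) EFinM.
  rewrite integralZr//; last by apply: integrable_lap => //; exact: sqint_normr.
  by rewrite EFinM EFin_lap//; exact: sqint_normr.
have intf2 t : Rplus t -> (\int[mu]_(l in Rplus) f (l, t))%E = (u t * lap v t)%:E.
  move=> /RplusE t0.
  under eq_integral do rewrite /f/= mulrAC mulrC EFinM (mulrC t).
  rewrite integralZl//; last exact: integrable_lap.
  by rewrite EFinM EFin_lap.
rewrite /Rintegral; congr fine.
transitivity (\int[mu]_(l in Rplus) \int[mu]_(t in Rplus) f (l, t))%E.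
  by apply: eq_integral_Rplus => l /RplusE/intf ->.
rewrite (fubini_on (m1 := mu) (m2 := mu) measurable_Rplus measurable_Rplus mf); last first.
  rewrite (eq_integral_Rplus (g := fun l => (lap (Num.norm \o u) l * `|v l|)%:E)).
    apply: (integrable_lty measurable_Rplus).
    exact: (sqint_integrableM (mu := mu) measurable_Rplus sLu
      (sqint_normr measurable_Rplus sv)).
  by move=> l /RplusE/intfabs ->.
by apply: eq_integral_Rplus => t /RplusE/intf2 ->.
Qed.

(** The exact value is [sqrt (pi / l)], but a multiple of [1 / sqrt l] is all that the Schur test
    asks. From [exp (- x) <= 1 / (1 + x)] the integrand is bounded by [1 / (sqrt t (1 + l t))],
    which has the primitive [(2 / sqrt l) atan (sqrt (l t))]. *)
Lemma sqrtV_weight_integral l : 0 < l ->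
  (\int[mu]_(t in Rplus) (expR (- (t * l)) / Num.sqrt t)%:E <=
   (pi / Num.sqrt l)%:E)%E.
Proof.
move=> l0; have sl0 : 0 < Num.sqrt l by rewrite sqrtr_gt0.
pose f t := (Num.sqrt t * (1 + (Num.sqrt l * Num.sqrt t) ^+ 2))^-1.
pose F t := 2 / Num.sqrt l * atan (Num.sqrt l * Num.sqrt t).
have f0 t : 0 < t -> 0 <= f t.
  by move=> t0; rewrite invr_ge0 mulr_ge0 ?sqrtr_ge0// addr_ge0 ?sqr_ge0.
have cf t : 0 < t -> {for t, continuous f}.
  move=> t0; apply: cvgV; first by rewrite gt_eqF// mulr_gt0 ?sqrtr_gt0// ltr_pwDl ?sqr_ge0.
  have cs : {for t, continuous (@Num.sqrt R)} by exact: sqrt_continuous.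
  apply: cvgM => //; apply: cvgD; first exact: cvg_cst.
  rewrite expr2; under eq_fun do rewrite expr2.
  by apply: cvgM; apply: cvgM => //; exact: cvg_cst.
have dF t : 0 < t -> is_derive t 1 F (f t).
  move=> t0; have st0 : 0 < Num.sqrt t by rewrite sqrtr_gt0.
  have d1 := is_deriveZ (Num.sqrt l) (is_derive1_sqrt t0).
  have d2 := @is_derive1_comp _ (@atan R) (fun t => Num.sqrt l * Num.sqrt t)
    _ _ _ (is_derive1_atan _) d1.
  have d3 := is_deriveZ (2 / Num.sqrt l) d2.
  apply: (is_derive_eq d3); rewrite /f /GRing.scale/=; field.
  by rewrite !gt_eqF// ltr_pwDl ?sqr_ge0.
have Fy : F t @[t --> +oo] --> pi / Num.sqrt l.
  rewrite (_ : pi / _ = 2 / Num.sqrt l * (pi / 2)); last by field; rewrite gt_eqF.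
  apply: cvgM; first exact: cvg_cst.
  apply: (cvg_comp _ _ _ (@cvgy_atan R)).
  apply/cvgryPge => A; near=> t.
  have tA : (`|A| / Num.sqrt l) ^+ 2 <= t by near: t; exact: nbhs_pinfty_ge.
  rewrite (le_trans (ler_norm A))// -ler_pdivrMl// mulrC.
  have := tA; rewrite -(@ler_sqrt _ _ t); last by rewrite (le_trans _ tA)// sqr_ge0.
  by rewrite sqrtr_sqr ger0_norm// divr_ge0// sqrtr_ge0.
have F_ge0 t : 0 <= F t.
  apply: mulr_ge0; first by rewrite divr_ge0 ?sqrtr_ge0.
  rewrite -(@atan0 R); apply: le_atan.
  by apply: mulr_ge0; exact: sqrtr_ge0.
(* The bound is singular at 0: the fundamental theorem of calculus is applied away from 0, and the
   half-line is reached by monotone convergence. *)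
pose I (n : nat) : set R := `[n.+1%:R^-1, +oo[%classic.
have key n : (\int[mu]_(t in I n) (f t)%:E <=
    (pi / Num.sqrt l)%:E)%E.
  have n0 : 0 < n.+1%:R^-1 :> R by rewrite invr_gt0.
  rewrite (ge0_continuous_FTC2y (F := F) (l := pi / Num.sqrt l)).
  - by rewrite -EFinB lee_fin lerBlDr lerDl.
  - by move=> t nt; apply: f0; exact: lt_le_trans nt.
  - apply: continuous_in_subspaceT => t; rewrite inE/= in_itv/= andbT => nt.
    by apply: cf; exact: lt_le_trans nt.
  - exact: Fy.
  - by move=> t nt; have [] := dF t (lt_trans n0 nt).
  - apply: cvg_at_right_filter; apply: differentiable_continuous.
    by apply/derivable1_diffP; have [] := dF _ n0.
  - move=> t; rewrite in_itv/= andbT => nt; rewrite derive1E.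
    by have := dF t (lt_trans n0 nt) => d; rewrite derive_val.
have mf : measurable_fun Rplus f.
  apply: open_continuous_measurable_fun; first exact: interval_open.
  by move=> t; rewrite inE => /RplusE/cf.
have RE : Rplus = \bigcup_n I n.
  apply/seteqP; split=> [t /RplusE t0|t [n _] /=].
    exists (Num.truncn t^-1) => //; rewrite /I/= in_itv/= andbT.
    by rewrite invf_ple ?posrE// ltW// truncnS_gt.
  by rewrite /I/= in_itv/= andbT => nt; apply/RplusE; rewrite (lt_le_trans _ nt).
apply: (@le_trans _ _ (\int[mu]_(t in Rplus) (f t)%:E)%E).
  apply: ge0_le_integral => //.
  - apply/measurable_EFinP; apply: measurable_funM.
      rewrite (_ : (fun t => _) = monexp 0 l); first exact: measurable_monexp.
      by apply/funext => t; rewrite /monexp expr0 mul1r.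
    apply: open_continuous_measurable_fun; first exact: interval_open.
    move=> t; rewrite inE => /RplusE t0; apply: cvgV; last exact: sqrt_continuous.
    by rewrite gt_eqF// sqrtr_gt0.
  - by apply/measurable_EFinP.
  - move=> t /RplusE t0; rewrite lee_fin /f invfM mulrC ler_pM2l ?invr_gt0 ?sqrtr_gt0//.
    rewrite expRN lef_pV2 ?posrE ?expR_gt0 ?ltr_pwDl ?sqr_ge0//.
    by rewrite exprMn !sqr_sqrtr ?(ltW l0) ?(ltW t0)// (mulrC l) expR_ge1Dx.
rewrite RE.
have cvgI : (\int[mu]_(t in I n) (f t)%:E)%E @[n --> \oo] -->
    (\int[mu]_(t in \bigcup_n I n) (f t)%:E)%E.
  apply: (@ge0_nondecreasing_set_cvg_integral _ (measurableTypeR R) R I (EFin \o f) mu).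
  - apply/nondecreasing_seqP => n; rewrite subsetEset => t.
    rewrite /I/= !in_itv/= !andbT; apply: le_trans.
    by rewrite lef_pV2 ?posrE// ler_nat.
  - by move=> n; exact: measurable_itv.
  - move=> n; apply/measurable_EFinP; apply: (measurable_funS measurable_RplusR _ mf) => t /= nt.
    by rewrite RE; exists n.
  - move=> n t; rewrite /I/= in_itv/= andbT => nt.
    by rewrite lee_fin f0// (lt_le_trans _ nt).
rewrite -(cvg_lim _ cvgI)//; apply: lime_le; last exact: nearW.
by apply/cvg_ex; eexists; exact: cvgI.
Unshelve. all: by end_near. Qed.

End LaplaceBound.

Section LaplaceBounded.
Context {R : realType}.
Local Notation mu := (@lebesgue_measure R).
Local Notation Rplus := (@Rplus R).
Local Notation L2r := (sqint mu Rplus).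
Local Notation "'[ u , v ]" := (ip mu Rplus u v).
Implicit Types (u v : R -> R) (a b l t p : R).

Hint Resolve measurable_Rplus measurable_RplusR : core.

Lemma measurable_sqrt (D : set R) : measurable_fun D (@Num.sqrt R).
Proof.
apply: measurable_funTS; apply: continuous_measurable_fun.
exact: sqrt_continuous.
Qed.

Lemma measurable_sqrt_comp (D : set R) u : measurable_fun D u ->
  measurable_fun D (fun t => Num.sqrt (u t)).
Proof. by apply: measurableT_comp; exact: measurable_sqrt. Qed.

Lemma measurable_sqrtV : measurable_fun Rplus (fun t : R => (Num.sqrt t)^-1).
Proof.
apply: open_continuous_measurable_fun; first exact: interval_open.
move=> t; rewrite inE => /RplusE t0; apply: cvgV; last exact: sqrt_continuous.
by rewrite gt_eqF// sqrtr_gt0.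
Qed.

Lemma measurable_expRN l (D : set R) : measurable_fun D (fun t : R => expR (- (t * l))).
Proof.
rewrite (_ : (fun t => _) = monexp 0 l); first exact: measurable_monexp.
by apply/funext => t; rewrite /monexp expr0 mul1r.
Qed.

(** Both factors are compared with affine functions: [sqrt t <= 1 + t] and [exp (t l) >= 1 + t l]. A
    bound uniform in [t] keeps the weighted function of the Schur test square integrable. *)
Lemma expRN_sqrt_le l t : 0 < l -> 0 < t ->
  expR (- (t * l)) * Num.sqrt t <= 1 + l^-1.
Proof.
move=> l0 t0; have st : Num.sqrt t <= 1 + t.
  have := sqr_ge0 (Num.sqrt t - 1); rewrite sqrrB1 sqr_sqrtr ?(ltW t0)//.
  by have := sqrtr_ge0 t; lra.
rewrite expRN mulrC ler_pdivrMr ?expR_gt0// (le_trans st)//.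
have e := expR_ge1Dx (t * l).
have : (1 + l^-1) * (1 + t * l) <= (1 + l^-1) * expR (t * l).
  by rewrite ler_wpM2l// addr_ge0// invr_ge0 ltW.
apply: le_trans.
rewrite mulrDl mul1r mulrDr mulr1 mulrCA mulVf ?gt_eqF// mulr1.
have : 0 < l^-1 by rewrite invr_gt0.
by have : 0 < t * l by [rewrite mulr_gt0]; lra.
Qed.

Lemma sqint_lap_weight u l : L2r u -> 0 < l ->
  L2r (fun t => Num.sqrt (expR (- (t * l)) * Num.sqrt t) * u t).
Proof.
move=> su l0.
apply: (le_sqint (mu := mu) measurable_Rplus _ (sqintZ measurable_Rplus (Num.sqrt (1 + l^-1)) su)).
  apply: measurable_funM; last by case: su.
  apply: measurable_sqrt_comp.
  by apply: measurable_funM; [exact: measurable_expRN|exact: measurable_sqrt].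
move=> t /RplusE t0; rewrite !normrM ler_wpM2r// !ger0_norm ?sqrtr_ge0//.
rewrite ler_wsqrtr//.
exact: expRN_sqrt_le.
Qed.

(* Schur test with the weight [t^(-1/2)], against which the kernel
   [exp (- t l)] reproduces [l^(-1/2)] up to the factor [pi]. *)
Lemma lap_sqr_le u l : L2r u -> 0 < l ->
  (((lap u l) ^+ 2)%:E <= (pi / Num.sqrt l)%:E *
    \int[mu]_(t in Rplus) (expR (- (t * l)) * Num.sqrt t * u t ^+ 2)%:E)%E.
Proof.
move=> su l0.
(* The kernel is the product of the square roots of [e^(-tl) / sqrt t] and of [e^(-tl) sqrt t]; [u]
   is attached to the second one before Cauchy-Schwarz is applied. *)
pose f t := Num.sqrt (expR (- (t * l)) / Num.sqrt t).
pose g t := Num.sqrt (expR (- (t * l)) * Num.sqrt t) * u t.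
have f2 t : 0 < t -> f t ^+ 2 = expR (- (t * l)) / Num.sqrt t.
  by move=> t0; rewrite sqr_sqrtr// divr_ge0 ?expR_ge0 ?sqrtr_ge0.
have g2 t : g t ^+ 2 = expR (- (t * l)) * Num.sqrt t * u t ^+ 2.
  by rewrite exprMn sqr_sqrtr// mulr_ge0 ?expR_ge0 ?sqrtr_ge0.
have If : (\int[mu]_(t in Rplus) (f t ^+ 2)%:E <= (pi / Num.sqrt l)%:E)%E.
  rewrite (eq_integral_Rplus (g := fun t => (expR (- (t * l)) / Num.sqrt t)%:E)).
    exact: sqrtV_weight_integral.
  by move=> t t0; rewrite f2.
have sf : L2r f.
  split; last by rewrite (le_lt_trans If)// ltry.
  apply: measurable_sqrt_comp.
  by apply: measurable_funM; [exact: measurable_expRN|exact: measurable_sqrtV].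
have sg : L2r g by exact: sqint_lap_weight.
have := cauchy_schwarz (mu := mu) measurable_Rplus sf sg.
rewrite [X in X ^+ 2](_ : _ = lap u l); last first.
  apply: eq_Rintegral_Rplus => t t0; rewrite /f /g mulrA -sqrtrM; last first.
    by rewrite divr_ge0 ?expR_ge0 ?sqrtr_ge0.
  rewrite mulrACA mulVf ?gt_eqF ?sqrtr_gt0// mulr1 -expr2 sqrtr_sqr ger0_norm//.
rewrite -lee_fin => /le_trans; apply; rewrite EFinM.
rewrite (EFin_ipxx measurable_Rplus sf) (EFin_ipxx measurable_Rplus sg).
rewrite (eq_integral_Rplus (f := fun t => (g t ^+ 2)%:E) (fun t _ => congr1 EFin (g2 t))).
apply: lee_wpmul2r => //; apply: integral_ge0 => t _.
by rewrite lee_fin mulr_ge0 ?sqr_ge0// mulr_ge0 ?expR_ge0 ?sqrtr_ge0.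
Qed.

(** Second half of the Schur test: the pointwise bound is integrated over [l], the order of
    integration is exchanged, and by symmetry of the kernel the same weight integral, now in [l],
    gives the second factor [pi] and cancels [sqrt t]. *)
Lemma sqint_lap_le u : L2r u ->
  (\int[mu]_(l in Rplus) ((lap u l) ^+ 2)%:E <=
   (pi ^+ 2)%:E * \int[mu]_(t in Rplus) ((u t) ^+ 2)%:E)%E.
Proof.
move=> su; have [mu_ _] := su.
pose f (x : R * R) := (pi / Num.sqrt x.1 *
  (expR (- (x.2 * x.1)) * Num.sqrt x.2 * u x.2 ^+ 2))%:E.
have f0 x : (0 <= f x)%E.
  rewrite lee_fin mulr_ge0 ?divr_ge0 ?pi_ge0 ?sqrtr_ge0//.
  by rewrite mulr_ge0 ?sqr_ge0// mulr_ge0 ?expR_ge0 ?sqrtr_ge0.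
have mf : measurable_fun (Rplus `*` Rplus) f.
  apply/measurable_EFinP; apply: measurable_funM.
    apply: (measurable_fst_RplusX (u := fun t => pi / Num.sqrt t)).
    by apply: measurable_funM => //; exact: measurable_sqrtV.
  apply: measurable_funM; first apply: measurable_funM.
  - by apply: measurable_funTS; exact: measurable_kernel.
  - by apply: measurable_snd_RplusX; exact: measurable_sqrt.
  - by apply: measurable_funX; exact: measurable_snd_RplusX.
apply: (@le_trans _ _ (\int[mu]_(l in Rplus) \int[mu]_(t in Rplus) f (l, t))%E).
  apply: ge0_le_integral => //.
  - by move=> l _; rewrite lee_fin sqr_ge0.
  - by apply/measurable_EFinP; apply: measurable_funX; exact: measurable_lap.
  - exact: (measurable_fubini_tonelli_on mu measurable_Rplus measurable_Rplus mf).
  move=> l /RplusE l0; rewrite (le_trans (lap_sqr_le su l0))//.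
  rewrite -ge0_integralZl//.
  - apply/measurable_EFinP; apply: measurable_funM; last exact: measurable_funX.
    by apply: measurable_funM; [exact: measurable_expRN|exact: measurable_sqrt].
  - move=> t _; rewrite lee_fin.
    exact: (mulr_ge0 (mulr_ge0 (expR_ge0 _) (sqrtr_ge0 _)) (sqr_ge0 _)).
  - by rewrite lee_fin divr_ge0 ?pi_ge0 ?sqrtr_ge0.
rewrite (fubini_tonelli_on mu mu measurable_Rplus measurable_Rplus mf)//.
rewrite -ge0_integralZl//; last 3 first.
- by apply/measurable_EFinP; exact: measurable_funX.
- by move=> t _; rewrite lee_fin sqr_ge0.
- by rewrite lee_fin sqr_ge0.
apply: ge0_le_integral => //.
- by move=> t _; exact: integral_ge0.
- exact: (measurable_fubini_tonelli_on_r mu measurable_Rplus measurable_Rplus mf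
    (fun x y _ _ => f0 (x, y))).
- by apply/measurable_EFinP; apply: measurable_funM => //; exact: measurable_funX.
move=> t /RplusE t0.
rewrite (eq_integral_Rplus (g := fun l => ((pi * Num.sqrt t * u t ^+ 2)%:E *
   (expR (- (l * t)) / Num.sqrt l)%:E)%E)); last first.
  by move=> l l0; rewrite /f/= -EFinM (mulrC t l); congr EFin; ring.
rewrite ge0_integralZl//; last 2 first.
- apply/measurable_EFinP; apply: measurable_funM; first exact: measurable_expRN.
  exact: measurable_sqrtV.
- rewrite lee_fin.
  exact: (mulr_ge0 (mulr_ge0 (pi_ge0 _) (sqrtr_ge0 _)) (sqr_ge0 _)).
apply: (@le_trans _ _ ((pi * Num.sqrt t * u t ^+ 2)%:E * (pi / Num.sqrt t)%:E)%E).
  apply: lee_wpmul2l; last exact: sqrtV_weight_integral.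
  by rewrite lee_fin mulr_ge0 ?sqr_ge0// mulr_ge0 ?pi_ge0 ?sqrtr_ge0.
have e (p s w : R) : s != 0 -> p * s * w * (p / s) = p ^+ 2 * w.
  by move=> s0; field.
by rewrite -!EFinM lee_fin e// gt_eqF// sqrtr_gt0.
Qed.

Lemma sqint_lap u : L2r u -> L2r (lap u).
Proof.
move=> su; split; first by apply: measurable_lap; case: su.
rewrite (le_lt_trans (sqint_lap_le su))// -(EFin_ipxx measurable_Rplus su).
by rewrite -EFinM ltry.
Qed.

Lemma ip_lap_le u : L2r u -> '[lap u, lap u] <= pi ^+ 2 * '[u, u].
Proof.
move=> su; rewrite -lee_fin EFinM (EFin_ipxx measurable_Rplus su).
by rewrite (EFin_ipxx measurable_Rplus (sqint_lap su)); exact: sqint_lap_le.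
Qed.

Lemma ip_lapC u v : L2r u -> L2r v -> '[lap u, v] = '[u, lap v].
Proof.
by move=> su sv; apply: lap_symmetric => //; apply: sqint_lap; exact: sqint_normr.
Qed.

End LaplaceBounded.

(** * Laguerre functions: Laplace transforms, orthonormality, Rodrigues' formula *)

Section LaguerreFunctions.
Context {R : realType}.
Local Notation mu := (@lebesgue_measure R).
Local Notation Rplus := (@Rplus R).
Local Notation L2r := (sqint mu Rplus).
Local Notation "'[ u , v ]" := (ip mu Rplus u v).
Implicit Types (u v : R -> R) (a b l t p : R).

Hint Resolve measurable_Rplus measurable_RplusR : core.

Definition lagcoef (n k : nat) : R := (-1) ^+ k * 'C(n, k)%:R / k`!%:R.

(** The expanded form of [e^(-t/2) L_n^0(t)]. It is smooth on the whole line and linear in the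
    functions [monexp]; the agreement with Rodrigues' formula for [t > 0] is [laguerre0E]. *)
Definition lagfun (n : nat) t : R := \sum_(k < n.+1) lagcoef n k * monexp k 2^-1 t.

Lemma rsmooth_sum (n : nat) (F : nat -> R -> R) :
  (forall k, rsmooth (F k)) -> rsmooth (fun t => \sum_(k < n) F k t).
Proof.
move=> sF; elim: n => [|n ih].
  by under eq_fun do rewrite big_ord0; exact: rsmooth_cst.
by under eq_fun do rewrite big_ord_recr /=; exact: rsmoothD.
Qed.

Lemma rsmooth_lagfun n : rsmooth (lagfun n).
Proof.
apply: (@rsmooth_sum n.+1 (fun k t => lagcoef n k * monexp k 2^-1 t)) => k.
by apply: rsmoothM; [exact: rsmooth_cst|exact: rsmooth_monexp].
Qed.

Lemma sqint_lagfun n : L2r (lagfun n).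
Proof.
apply: (sqint_sum (mu := mu) measurable_Rplus (index_enum 'I_n.+1)
  (F := fun k t => lagcoef n k * monexp k 2^-1 t)) => k.
by apply: sqintZ => //; apply: sqint_monexp; rewrite invr_gt0.
Qed.

Lemma ip_lagfun_suml n w : L2r w ->
  '[lagfun n, w] = \sum_(k < n.+1) lagcoef n k * '[monexp k 2^-1, w].
Proof.
move=> sw; have sm (k : nat) : L2r (monexp k 2^-1).
  by apply: sqint_monexp; rewrite invr_gt0.
rewrite (ip_suml (mu := mu) measurable_Rplus (index_enum 'I_n.+1)
  (F := fun (k : 'I_n.+1) t => lagcoef n k * monexp k 2^-1 t)) => [|k|//].
  by apply: eq_bigr => k _; rewrite ipZl.
exact: sqintZ.
Qed.

(** With [b = 1 / (l + 1/2)] the transform is the sum of ['C(n, k) (-b)^k b], that is [b (1 - b)^n]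
    by the binomial formula, and [1 - b] is the quotient of [l - 1/2] by [l + 1/2]. *)
Lemma lap_lagfun n l : 0 < l ->
  lap (lagfun n) l = (l - 2^-1) ^+ n / (l + 2^-1) ^+ n.+1.
Proof.
move=> l0; have l2 : l + 2^-1 != 0 by rewrite gt_eqF// addr_gt0// invr_gt0.
have h2 : 0 < 2^-1 + l by rewrite addr_gt0// invr_gt0.
rewrite lapE ip_lagfun_suml; last exact: sqint_monexp.
rewrite (_ : l - 2^-1 = (l + 2^-1) * (1 - (l + 2^-1)^-1)); last first.
  by rewrite mulrBr mulr1 divff//; lra.
rewrite [RHS](_ : _ = (l + 2^-1)^-1 * (1 - (l + 2^-1)^-1) ^+ n); last first.
  rewrite exprMn exprS; have := expf_neq0 n l2.
  move: l2; set p := l + _ => p0; set b := (1 - _) ^+ n => a0.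
  by field; rewrite p0 a0.
rewrite exprDn mulr_sumr; apply: eq_bigr => k _.
rewrite ip_monexp// addn0 /lagcoef expr1n mul1r (exprNn (l + 2^-1)^-1 k) exprVn -mulr_natr.
rewrite (addrC 2^-1) exprS.
have fk : (k`!%:R : R) != 0 by rewrite pnatr_eq0 -lt0n fact_gt0.
move: l2; set p := l + 2^-1 => p0; have := expf_neq0 k p0.
by set b := p ^+ k => b0; field; rewrite p0 b0 fk.
Qed.

Lemma signed_binomial_sumS n (f : nat -> R) :
  \sum_(j < n.+2) (-1) ^+ j * 'C(n.+1, j)%:R * f j =
  \sum_(j < n.+1) (-1) ^+ j * 'C(n, j)%:R * f j -
  \sum_(j < n.+1) (-1) ^+ j * 'C(n, j)%:R * f j.+1.
Proof.
rewrite big_ord_recl [X in _ = X - _]big_ord_recl /= !bin0 -addrA; congr (_ + _).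
under eq_bigr do rewrite /bump /= add1n binS natrD mulrDr mulrDl.
rewrite big_split/= big_ord_recr/= bin_small// mulr0 mul0r addr0 -sumrN.
congr (_ + _); apply: eq_bigr => j _.
by rewrite exprS mulN1r !mulNr.
Qed.

(** Up to the sign [(-1)^n] this is the [n]-th finite difference of [x |-> 'C(x, k)]. By Pascal's
    rule each difference lowers [k] by one. *)
Lemma signed_binomial_sum n x k :
  \sum_(j < n.+1) (-1) ^+ j * 'C(n, j)%:R * 'C(x + j, k)%:R =
  if (n <= k)%N then (-1) ^+ n * 'C(x, k - n)%:R else 0 :> R.
Proof.
elim: n x k => [|n ih] x k.
  by rewrite big_ord1 /= addn0 subn0 bin0 expr0 mulr1.
rewrite (signed_binomial_sumS n (fun j => 'C(x + j, k)%:R)) -sumrB.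
case: k => [|k].
  rewrite big1// => j _; rewrite !bin0; ring.
transitivity (- \sum_(j < n.+1) (-1) ^+ j * 'C(n, j)%:R * 'C(x + j, k)%:R : R).
  by rewrite -sumrN; apply: eq_bigr => j _; rewrite addnS binS natrD; ring.
by rewrite ih ltnS subSS; case: ifP => _; rewrite ?oppr0// exprS mulN1r mulNr.
Qed.

Lemma ip_lagfun n m : '[lagfun n, lagfun m] = (n == m)%:R.
Proof.
wlog mn : n m / (m <= n)%N.
  move=> H; have [/H //|/ltnW/H] := leqP m n.
  by rewrite ipC eq_sym.
(* The factor ['C(k, n)] vanishes for [k < n]: [lagfun n] is orthogonal to all terms of lower
   degree, and for [n = m] only the top term of the expansion contributes. *)
have ip_n (k : nat) : '[monexp k 2^-1, lagfun n] = k`!%:R * (-1) ^+ n * 'C(k, n)%:R.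
  rewrite ipC ip_lagfun_suml; last by apply: sqint_monexp; rewrite invr_gt0.
  transitivity (k`!%:R * \sum_(j < n.+1) (-1) ^+ j * 'C(n, j)%:R * 'C(k + j, k)%:R : R).
    rewrite mulr_sumr; apply: eq_bigr => j _.
    rewrite ip_monexp ?addr_gt0 ?invr_gt0// (_ : 2^-1 + 2^-1 = 1 :> R); last by lra.
    rewrite expr1n divr1 /lagcoef addnC -(bin_fact (leq_addr j k)) addKn !natrM.
    by field; rewrite pnatr_eq0 -lt0n fact_gt0.
  rewrite signed_binomial_sum; case: leqP => [nk|kn]; last by rewrite bin_small// !mulr0.
  by rewrite bin_sub// mulrA.
rewrite ipC ip_lagfun_suml; last exact: sqint_lagfun.
under eq_bigr do rewrite ip_n.
have [nm|nm] := eqVneq n m; last first.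
  rewrite big1// => k _; rewrite bin_small ?mulr0//.
  by rewrite (leq_trans (ltn_ord k))// ltn_neqAle eq_sym nm mn.
rewrite -nm big_ord_recr/= big1 ?add0r; last first.
  by move=> k _; rewrite [in X in _ * X]bin_small ?mulr0//=.
rewrite /lagcoef !binn !mulr1 mulrA divfK ?pnatr_eq0 -?lt0n ?fact_gt0//.
by rewrite -exprD addnn -mul2n exprM sqrrN expr1n expr1n.
Qed.

(** [p |-> p' - p] is the derivative conjugated by [e^(-x)]. In the binomial expansion of its [j]-th
    power, [X^k] arises from [X^n] only through the term with [n - k] derivatives. *)
Lemma coef_lag_iter (n j k : nat) :
  (iter j (fun p : {poly R} => p^`() - p) 'X^n)`_k =
  if (k <= n)%N then (-1) ^+ (j + (n - k)) * 'C(j, n - k)%:R * n`!%:R / k`!%:R else 0.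
Proof.
have fn0 m : (m`!%:R : R) != 0 by rewrite pnatr_eq0 -lt0n fact_gt0.
elim: j k => [|j ih] k /=.
  rewrite coefXn; have [->|kn] := eqVneq k n.
    by rewrite leqnn subnn bin0 expr0 !mul1r divff.
  case: ifP => // kn'; rewrite bin_small ?mulr0 ?mul0r//.
  by rewrite subn_gt0 ltn_neqAle kn.
rewrite coefB coef_deriv !ih.
have [kn|kn] := ltnP k n.
  rewrite (ltnW kn) -(subnSK kn) binS factS !natrM natrD !addnS !exprS.
  rewrite -mulr_natr; field.
  by rewrite fn0 nat1r pnatr_eq0.
have [->|nk] := eqVneq k n.
  rewrite leqnn subnn !bin0 mul0rn sub0r !addn0 exprS; ring.
by rewrite leqNgt ltn_neqAle eq_sym nk kn mul0rn subr0.
Qed.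

Lemma laguerre0E n t : 0 < t ->
  expR (- t / 2) * laguerre 0 n t = lagfun n t.
Proof.
move=> t0.
pose T (p : {poly R}) := p^`() - p.
(* [powR] is the monomial only for nonnegative arguments. The identity is kept on the open set
   [x > 0], where it holds near each point and can be differentiated. *)
have D j : forall x, 0 < x ->
    derive1n j (fun x : R => expR (- x) * x `^ (n%:R + 0)) x =
    expR (- x) * (iter j T 'X^n).[x].
  elim: j => [|j ih] x x0.
    by rewrite derive1n0 /= hornerXn addr0 powR_mulrn// ltW.
  rewrite derive1nS derive1E.
  have d1 : is_derive x 1 (fun x : R => - x) (-1) by exact: is_deriveNid.
  have d2 := @is_derive1_comp _ expR (fun x : R => - x) _ _ _ (is_derive_expR _) d1.
  have d3 := is_deriveM d2 (is_derive_poly (iter j T 'X^n) x).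
  have d4 : is_derive x 1
      (derive1n j (fun x : R => expR (- x) * x `^ (n%:R + 0)))
      (expR (- x) * (iter j.+1 T 'X^n).[x]).
    apply: (near_eq_is_derive (f := fun x : R => expR (- x) * (iter j T 'X^n).[x])).
      near=> y; rewrite ih//; near: y; exact: lt_nbhsr.
    apply: (is_derive_eq d3); rewrite /GRing.scale/= /T hornerD hornerN.
    ring.
  by rewrite derive_val.
rewrite /laguerre oppr0 powRr0 mulr1 D//.
rewrite (_ : iter n T 'X^n = \poly_(k < n.+1) (n`!%:R * lagcoef n k)); last first.
  apply/polyP => k; rewrite coef_lag_iter coef_poly ltnS; case: leqP => // kn.
  rewrite bin_sub// /lagcoef.
  rewrite (_ : (-1) ^+ (n + (n - k)) = (-1) ^+ k :> R); last first.
    rewrite -signr_odd oddD oddB// -[in RHS]signr_odd; congr (_ ^+ _).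
    by case: (odd n); case: (odd k).
  ring.
rewrite horner_poly /lagfun.
have -> : expR (- t / 2) = expR (- (t * 2^-1)) by rewrite mulNr.
rewrite -[_^-1 * _ * _]mulrA (mulrA (expR t)) expRxMexpNx_1 mul1r mulr_sumr mulr_sumr.
apply: eq_bigr => k _; rewrite /monexp; field.
by rewrite pnatr_eq0 -lt0n fact_gt0.
Unshelve. all: by end_near. Qed.

End LaguerreFunctions.

(** * Dominated convergence and injectivity of the Laplace transform *)

Section RealDominatedConvergence.
Context d (T : measurableType d) (R : realType).
Variables (mu : {measure set T -> \bar R}) (D : set T).
Hypothesis mD : measurable D.

Lemma Rdominated_convergence (f_ : nat -> T -> R) (f g : T -> R) :
  (forall n, measurable_fun D (f_ n)) -> measurable_fun D f ->
  {ae mu, forall x, D x -> f_ n x @[n --> \oo] --> f x} ->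
  mu.-integrable D (EFin \o g) ->
  (forall n x, D x -> `|f_ n x| <= g x) ->
  \int[mu]_(x in D) f_ n x @[n --> \oo] --> \int[mu]_(x in D) f x.
Proof.
move=> mf_ mf f_f ig f_g.
have [||||| i _ c] := @dominated_convergence _ _ _ mu D mD
  (fun n x => (f_ n x)%:E) (EFin \o f) (EFin \o g).
- by move=> n; apply/measurable_EFinP.
- exact/measurable_EFinP.
- apply: filterS f_f => x h Dx; apply: cvg_EFin; first exact: nearW.
  exact: h.
- exact: ig.
- by apply: aeW => x n Dx; rewrite lee_fin f_g.
rewrite /Rintegral; apply: fine_cvg; rewrite fineK//.
exact: (integrable_fin_num mD i).
Qed.

End RealDominatedConvergence.

Section LaplaceInjective.
Context {R : realType}.
Local Notation mu := (@lebesgue_measure R).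
Local Notation Rplus := (@Rplus R).
Local Notation L2r := (sqint mu Rplus).
Local Notation "'[ u , v ]" := (ip mu Rplus u v).
Implicit Types (u v : R -> R) (a b l t p : R).

Hint Resolve measurable_Rplus measurable_RplusR : core.

Lemma cvg_exp_coeff a : series (exp_coeff a) n @[n --> \oo] --> expR a.
Proof. exact: is_cvg_series_exp_coeff. Qed.

Lemma series_exp_coeff_le a n : `|series (exp_coeff (- a)) n| <= expR `|a|.
Proof.
apply: (@le_trans _ _ (series (exp_coeff `|a|) n)).
  rewrite /series/= (le_trans (ler_norm_sum _ _ _))//.
  by apply: ler_sum => k _; rewrite /exp_coeff/= normrM normrX normrN
    (ger0_norm (_ : 0 <= _^-1)) ?invr_ge0.
apply: nondecreasing_cvgn_le; last exact: is_cvg_series_exp_coeff.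
apply/nondecreasing_seqP => m; rewrite /series/= big_nat_recr//= lerDl.
by rewrite /exp_coeff/= divr_ge0// exprn_ge0.
Qed.

(* [\sum_k (-1)^k / k! * e^(k x (T - s)) = exp (- e^(x (T - s)))] tends, as [x]
   goes to infinity, to the indicator of [T < s]. *)
Lemma doetsch u (x T : R) : L2r u -> 0 < x ->
  (forall l, 0 < l -> lap u l = 0) ->
  \int[mu]_(s in Rplus) (expR (- s) * u s * expR (- expR (x * (T - s)))) = 0.
Proof.
move=> su x0 Lu.
have iv : mu.-integrable Rplus (EFin \o (fun s => expR (- s) * u s)).
  have := integrable_lap su (@ltr01 R).
  by apply: eq_integrable => // s _; rewrite /= mulr1.
pose f_ K s := expR (- s) * u s * series (exp_coeff (- expR (x * (T - s)))) K.
have mv : measurable_fun Rplus (fun s => expR (- s) * u s).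
  by apply/measurable_EFinP; exact: (measurable_int mu iv).
have mE (k : nat) : measurable_fun Rplus (fun s : R => exp_coeff (- expR (x * (T - s))) k).
  apply: measurable_funM => //; apply: measurable_funX; apply: measurableT_comp => //.
  apply: measurableT_comp => //; apply: measurable_funM => //.
  exact: measurable_funB.
have mf_ K : measurable_fun Rplus (f_ K).
  apply: measurable_funM => //.
  by rewrite /series/=; apply: measurable_sum.
(* The [k]-th term integrates to a multiple of [lap u (1 + k x)]; the factor [expR (- s)] keeps the
   point positive for [k = 0]. *)
have f0 K : \int[mu]_(s in Rplus) f_ K s = 0.
  transitivity ('[u, fun s => \sum_(0 <= k < K)
      ((-1) ^+ k / k`!%:R * expR (k%:R * x * T)) * monexp 0 (1 + k%:R * x) s]).
    apply: eq_Rintegral_Rplus => s s0; rewrite /f_ -mulrA mulrCA; congr (_ * _).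
    rewrite /series/= mulr_sumr; apply: eq_bigr => k _; rewrite /exp_coeff/=.
    have e : expR (- s) * expR (x * (T - s)) ^+ k =
        expR (k%:R * x * T) * monexp 0 (1 + k%:R * x) s.
      rewrite -expRM_natl /monexp expr0 mul1r -!expRD; congr expR; ring.
    by rewrite -[RHS]mulrA -e (exprNn (expR _)); ring.
  rewrite ipC (ip_suml (mu := mu) measurable_Rplus (index_iota 0 K)
    (F := fun (k : nat) s => (-1) ^+ k / k`!%:R * expR (k%:R * x * T) *
      monexp 0 (1 + k%:R * x) s)) //; last first.
    by move=> k; apply: sqintZ => //; apply: sqint_monexp; rewrite ltr_pwDl// mulr_ge0 ?(ltW x0).
  rewrite big1// => k _; have k0 : 0 < 1 + k%:R * x.
    by rewrite ltr_pwDl// mulr_ge0 ?(ltW x0).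
  rewrite ipZl//; last exact: sqint_monexp.
  by rewrite ipC -lapE Lu// mulr0.
have cf : \int[mu]_(s in Rplus) f_ K s @[K --> \oo] -->
    \int[mu]_(s in Rplus) (expR (- s) * u s * expR (- expR (x * (T - s)))).
  apply: (Rdominated_convergence (mu := mu) measurable_Rplus
    (g := fun s => `|expR (- s) * u s| * expR (expR (x * T)))) => //.
  - apply: measurable_funM => //; apply: measurableT_comp => //.
    apply: measurableT_comp => //; apply: measurableT_comp => //.
    by apply: measurable_funM => //; exact: measurable_funB.
  - apply: aeW => s _; apply: cvgM; [exact: cvg_cst|exact: cvg_exp_coeff].
  - have := integrable_norm iv => /(integrableZl measurable_Rplus (expR (expR (x * T)))).
    by apply: eq_integrable => // s _; rewrite /= muleC -EFinM.
  - move=> K s /RplusE s0; rewrite normrM ler_wpM2l//.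
    rewrite (le_trans (series_exp_coeff_le _ _))// ler_expR ger0_norm ?expR_ge0//.
    by rewrite ler_expR ler_wpM2l// ?(ltW x0)// gerBl (ltW s0).
by rewrite -(cvg_lim _ cf)//; under eq_fun do rewrite f0; exact: lim_cst.
Qed.

Lemma cvg_mulSn_pinfty (c : R) : 0 < c -> (n.+1%:R * c : R) @[n --> \oo] --> +oo.
Proof.
move=> c0; apply/cvgryPge => A; near=> n; rewrite -ler_pdivrMr//.
by rewrite (@le_trans _ _ n%:R) ?ler_nat//; near: n; exact: nbhs_infty_ger.
Unshelve. all: by end_near. Qed.

Lemma expRN_expR_le1 (a : R) : expR (- expR a) <= 1.
Proof. by rewrite -[leRHS]expR0 ler_expR oppr_le0 expR_ge0. Qed.

(** Letting [x] go to infinity in [doetsch] shows that the integrals of [e^(-s) u(s)] up to every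
    [T] vanish; by Lebesgue's differentiation theorem the integrand vanishes almost everywhere. *)
Lemma lap_inj u : L2r u -> (forall l, 0 < l -> lap u l = 0) ->
  {ae mu, forall t, Rplus t -> u t = 0}.
Proof.
move=> su Lu.
pose v s := expR (- s) * u s.
have iv : mu.-integrable Rplus (EFin \o v).
  have := integrable_lap su (@ltr01 R).
  by apply: eq_integrable => // s _; rewrite /= mulr1.
have ivT : mu.-integrable setT (EFin \o (v \_ Rplus)).
  by rewrite -restrict_EFin; apply/(integrable_mkcond _ measurable_Rplus).
have mv : measurable_fun Rplus v.
  by apply/measurable_EFinP; exact: (measurable_int mu iv).
have mw T : measurable_fun Rplus (fun s => v s * \1_(`]-oo, T]%classic) s).
  by apply: measurable_funM => //; apply: measurable_indic; exact: measurable_itv.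
have key T : \int[mu]_(s in Rplus) (v s * \1_(`]-oo, T]%classic) s) = 0.
  have : \int[mu]_(s in Rplus) (v s * (1 - expR (- expR (n.+1%:R * (T - s)))))
    @[n --> \oo] --> \int[mu]_(s in Rplus) (v s * \1_(`]-oo, T]%classic) s).
    apply: (Rdominated_convergence (mu := mu) measurable_Rplus
      (g := fun s => `|v s|)) => //.
    - move=> n; apply: measurable_funM => //; apply: measurable_funB => //.
      apply: measurableT_comp => //; apply: measurableT_comp => //.
      apply: measurableT_comp => //; apply: measurable_funM => //.
      exact: measurable_funB.
    - exact: mw.
    (* At [s = T] the factor is [1 - e^(-1)] for every [n], not the value of the indicator; this
       null set is discarded. *)
    - have aeT : {ae mu, forall s, s <> T}.
        exists [set T]; split; first exact: measurable_set1.
          exact: lebesgue_measure_set1.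
        by move=> s /= /contrapT.
      apply: (@filterS _ _ (ae_filter_ringOfSetsType mu) _ _ _ aeT).
      move=> s sT _.
      apply: cvgM; first exact: cvg_cst.
      have ns n : 0 < n.+1%:R :> R by [].
      have [Ts|Ts|Ts] := ltgtP T s; last by exfalso; exact: sT.
      + rewrite indicE memNset; last first.
          by rewrite /= in_itv/=; apply/negP; rewrite -ltNge.
        rewrite -[X in _ --> X](subrr 1); apply: cvgB; first exact: cvg_cst.
        rewrite -[X in _ --> X](expR0) -[in X in _ --> X]oppr0.
        apply: continuous_cvg; first exact: continuous_expR.
        apply: cvgN; under eq_fun do rewrite -(opprB s T) mulrN.
        apply: (cvg_comp _ _ _ (@cvgr_expR R)).
        by apply: cvg_mulSn_pinfty; rewrite subr_gt0.
      + rewrite indicE mem_set; last by rewrite /= in_itv/= ltW.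
        rewrite -[X in _ --> X](subr0 1); apply: cvgB; first exact: cvg_cst.
        have h := @cvg_mulSn_pinfty (T - s) _.
        apply: (cvg_comp _ _ _ (@cvgr_expR R)); apply/cvgryPge => A.
        move: h; rewrite subr_gt0 => /(_ Ts)/cvgryPge/(_ A).
        by apply: filterS => n /le_trans; apply; rewrite (le_trans _ (expR_ge1Dx _))// lerDr.
    - exact: (integrable_norm iv).
    - move=> n s _; rewrite normrM ler_piMr// ger0_norm.
        by rewrite gerBl expR_ge0.
      by rewrite subr_ge0 expRN_expR_le1.
  have -> : (fun n : nat => \int[mu]_(s in Rplus)
     (v s * (1 - expR (- expR (n.+1%:R * (T - s)))))) = (fun=> 0).
    apply/funext => n; have d := doetsch T su (ltr0Sn R n) Lu.
    have L1 : \int[mu]_(s in Rplus) v s = 0.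
      by rewrite -(Lu 1 ltr01); apply: eq_Rintegral_Rplus => s _; rewrite /v mulr1.
    rewrite -[RHS](subrr 0) -{1}L1 -d -RintegralB//.
      by apply: eq_Rintegral_Rplus => s _; rewrite mulrBr mulr1.
    apply: (le_integrable measurable_Rplus _ _ iv).
      apply/measurable_EFinP; apply: measurable_funM => //.
      apply: measurableT_comp => //; apply: measurableT_comp => //.
      apply: measurableT_comp => //; apply: measurable_funM => //.
      exact: measurable_funB.
    move=> s _ /=; rewrite lee_fin normrM ler_piMr//.
    by rewrite ger0_norm ?expR_ge0// expRN_expR_le1.
  by move=> /cvg_lim <-//; exact: lim_cst.
have F0 x : \int[mu]_(t in `]-oo, x]) (v \_ Rplus) t = 0.
  rewrite -[RHS](key x) Rintegral_mkcond [RHS]Rintegral_mkcond.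
  apply: eq_Rintegral => s _; rewrite !patchE indicE; case: ifPn => sx; case: ifPn => // _.
  - by rewrite mulr1.
  - by rewrite mulr0.
have := @FTC1Ny R (v \_ Rplus) _ _.
case.
- by move=> y; apply: integrableS ivT.
- by apply: open_integrable_locally => //; exact: openT.
move=> N NP; exists N; case: NP => mN N0 NP; split => //.
apply: subset_trans NP => t /= h1 h2; apply: h1 => tR.
have [_] := h2.
rewrite (_ : (fun x => _) = cst 0); last by apply/funext => x; rewrite F0.
rewrite derive1_cst patchE mem_set// => /esym/eqP.
by rewrite mulf_eq0 gt_eqF ?expR_gt0// => /eqP.
Qed.

End LaplaceInjective.

(** * Laguerre series: convergence, coefficients, Bessel's inequality *)

Section LaguerreExpansion.
Context {R : realType}.
Local Notation mu := (@lebesgue_measure R).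
Local Notation Rplus := (@Rplus R).
Local Notation L2r := (sqint mu Rplus).
Local Notation "'[ u , v ]" := (ip mu Rplus u v).
Implicit Types (u v w : R -> R) (c : nat -> R) (l : R).

Hint Resolve measurable_Rplus measurable_RplusR : core.

Let mR : measurable (Rplus : set (measurableTypeR R)) := measurable_Rplus.

Definition lagsum c (N : nat) : R -> R := fun t => \sum_(n < N) c n * lagfun n t.

Definition sqdist u v : R := '[fun t => u t - v t, fun t => u t - v t].

Lemma sqdist_ge0 u v : 0 <= sqdist u v.
Proof. exact: ip_ge0. Qed.

Lemma ipB_sqr_le u v w : L2r u -> L2r v -> L2r w ->
  ('[u, w] - '[v, w]) ^+ 2 <= sqdist u v * '[w, w].
Proof.
move=> su sv sw; rewrite -(ipBl mR su sv sw).
by apply: (cauchy_schwarz mR _ sw); exact: sqintB.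
Qed.

Lemma cvg_ip (un : nat -> R -> R) u w : (forall n, L2r (un n)) -> L2r u -> L2r w ->
  sqdist u (un n) @[n --> \oo] --> (0 : R) ->
  '[un n, w] @[n --> \oo] --> '[u, w].
Proof.
move=> sun su sw d0; apply/subr_cvg0.
have d1 : Num.sqrt (sqdist u (un n) * '[w, w]) @[n --> \oo] --> (0 : R).
  rewrite -[X in _ --> X]sqrtr0; apply: continuous_cvg; first exact: sqrt_continuous.
  by rewrite -[X in _ --> X](mul0r '[w, w]); apply: cvgM => //; exact: cvg_cst.
apply/norm_cvg0P; apply: (@squeeze_cvgr _ _ _ _ (cst 0) _ _ _ _ _ d1).
  apply: nearW => n; rewrite normr_ge0/= -sqrtr_sqr ler_wsqrtr// -sqrrN opprB.
  exact: ipB_sqr_le.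
exact: cvg_cst.
Qed.

Lemma sqint_lagsum c N : L2r (lagsum c N).
Proof.
apply: (sqint_sum (mu := mu) measurable_Rplus (index_enum 'I_N)
  (F := fun n t => c n * lagfun n t)) => n.
by apply: sqintZ => //; exact: sqint_lagfun.
Qed.

Lemma ip_lagsuml c N w : L2r w ->
  '[lagsum c N, w] = \sum_(n < N) c n * '[lagfun n, w].
Proof.
move=> sw.
rewrite (ip_suml (mu := mu) measurable_Rplus (index_enum 'I_N)
  (F := fun (n : 'I_N) t => c n * lagfun n t)) => [|n|//].
  by apply: eq_bigr => n _; rewrite ipZl//; exact: sqint_lagfun.
by apply: sqintZ => //; exact: sqint_lagfun.
Qed.

Lemma ip_lagsum_lagfun c N m :
  '[lagsum c N, lagfun m] = if (m < N)%N then c m else 0.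
Proof.
rewrite ip_lagsuml; last exact: sqint_lagfun.
under eq_bigr do rewrite ip_lagfun mulr_natr mulrb.
rewrite -big_mkcond/=; case: ifPn => [mN|Nm].
  by rewrite (big_pred1 (Ordinal mN)) => // n; rewrite -val_eqE.
rewrite big_pred0// => n; apply/negbTE; apply: contra Nm => /eqP <-.
exact: ltn_ord.
Qed.

Lemma ip_lagsum c M N : (M <= N)%N ->
  '[lagsum c M, lagsum c N] = \sum_(n < M) c n ^+ 2.
Proof.
move=> MN; rewrite ip_lagsuml; last exact: sqint_lagsum.
apply: eq_bigr => n _; rewrite ipC ip_lagsum_lagfun expr2 ifT//.
exact: leq_trans (ltn_ord n) MN.
Qed.

(** By orthonormality only the squares of the coefficients between [M] and [N] remain; the absolute
    value makes the formula symmetric in [M] and [N]. *)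
Lemma sqdist_lagsum c M N :
  sqdist (lagsum c M) (lagsum c N) =
  `|\sum_(n < M) c n ^+ 2 - \sum_(n < N) c n ^+ 2|.
Proof.
wlog MN : M N / (M <= N)%N.
  move=> H; have [/H //|/ltnW/H h] := leqP M N.
  by rewrite distrC -h; apply: eq_Rintegral => t _; ring.
have sM := sqint_lagsum c M; have sN := sqint_lagsum c N.
rewrite /sqdist ipBl ?ipBr//; last exact: sqintB.
rewrite (ipC mu Rplus (lagsum c N) (lagsum c M)) !ip_lagsum//.
rewrite ler0_norm ?subr_le0; first by ring.
rewrite -(big_mkord xpredT (fun n => c n ^+ 2)) -(big_mkord xpredT (fun n => c n ^+ 2)).
by rewrite (big_cat_nat (leq0n M) MN)/= lerDl sumr_ge0// => n _; exact: sqr_ge0.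
Qed.

Lemma lagsum_cvg c : cvgn (fun N => \sum_(n < N) c n ^+ 2) ->
  exists2 u, L2r u & sqdist u (lagsum c N) @[N --> \oo] --> (0 : R).
Proof.
move=> /cvg_ex[/= L sL].
(* The distance of the sum of squares from its limit: the triangle inequality through [L] gives the
   bound [r m + r n] on which [riesz_fischer] relies. *)
pose r N := `|\sum_(n < N) c n ^+ 2 - L|.
have r0 : r N @[N --> \oo] --> (0 : R) by apply/norm_cvg0P/subr_cvg0.
have [m n|u su uP] := riesz_fischer mR (fun N => sqint_lagsum c N) r0.
  rewrite -/(sqdist (lagsum c n) (lagsum c m)) sqdist_lagsum.
  by rewrite [leRHS]addrC (le_trans (ler_distD L _ _))// lerD2l distrC.
exists u => //; apply: (@squeeze_cvgr _ _ _ _ (cst 0) _ _ _ _ _ r0).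
  by apply: nearW => N; rewrite sqdist_ge0 uP.
exact: cvg_cst.
Qed.

Lemma lagsum_coef c u m : L2r u ->
  sqdist u (lagsum c N) @[N --> \oo] --> (0 : R) -> c m = '[u, lagfun m].
Proof.
move=> su d0; have := cvg_ip (sqint_lagsum c) su (sqint_lagfun m) d0.
move=> /(cvg_lim (@Rhausdorff R)) <-; apply/esym/cvg_lim => //.
apply: cvg_near_cst; near=> N; rewrite ip_lagsum_lagfun ifT//.
by near: N; exact: nbhs_infty_gt.
Unshelve. all: by end_near. Qed.

(** Pythagoras' theorem. Its positivity is Bessel's inequality, and its convergence to 0 is
    equivalent to Parseval's identity. *)
Lemma sqdist_lagsum_coef u N : L2r u ->
  sqdist u (lagsum (fun n => '[u, lagfun n]) N) =
  '[u, u] - \sum_(n < N) '[u, lagfun n] ^+ 2.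
Proof.
move=> su; pose c n := '[u, lagfun n]; have sS := sqint_lagsum c N.
rewrite /sqdist ipBl ?ipBr//; last exact: sqintB.
rewrite (ipC mu Rplus u (lagsum c N)) ip_lagsum// ip_lagsuml//.
rewrite (_ : \sum_(n < N) c n * _ = \sum_(n < N) c n ^+ 2); last first.
  by apply: eq_bigr => n _; rewrite expr2 /c ipC.
ring.
Qed.

Lemma cvg_lag_bessel u : L2r u ->
  cvgn (fun N => \sum_(n < N) '[u, lagfun n] ^+ 2).
Proof.
move=> su; apply: nondecreasing_is_cvgn.
  by apply/nondecreasing_seqP => N; rewrite big_ord_recr/= lerDl sqr_ge0.
exists '[u, u] => _ [N _ <-].
by rewrite -subr_ge0 -sqdist_lagsum_coef// sqdist_ge0.
Qed.

(* [exp (- l t)] is the sum of its Laguerre series, since Parseval's identity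
   [1 / (2 l) = \sum_n (l - 1/2)^(2 n) / (l + 1/2)^(2 n + 2)] holds. *)
Lemma lagfun_orthogonal_lap u l : L2r u -> 0 < l ->
  (forall n, '[u, lagfun n] = 0) -> lap u l = 0.
Proof.
move=> su l0 u0; have se := sqint_monexp 0 l0.
pose c n := '[monexp 0 l, lagfun n].
have cE n : c n = (l - 2^-1) ^+ n / (l + 2^-1) ^+ n.+1.
  by rewrite /c ipC -lapE lap_lagfun.
pose q := ((l - 2^-1) / (l + 2^-1)) ^+ 2.
have l2 : 0 < l + 2^-1 by rewrite addr_gt0// invr_gt0.
have q1 : `|q| < 1.
  rewrite /q ger0_norm ?sqr_ge0// exprMn exprVn ltr_pdivrMr ?exprn_gt0// mul1r; nra.
have d0 : sqdist (monexp 0 l) (lagsum c N) @[N --> \oo] --> (0 : R).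
  rewrite (_ : (fun N => _) =
      (fun N => 1 / (l + l) ^+ 1 - \sum_(n < N) c n ^+ 2)); last first.
    apply/funext => N; rewrite sqdist_lagsum_coef//.
    by rewrite ip_monexp ?addr_gt0// addn0 fact0.
  have := @cvg_geometric_series R ((l + 2^-1) ^- 2) q q1.
  rewrite (_ : _ / (1 - q) = 1 / (l + l) ^+ 1) => [h|]; last first.
    rewrite /q; have : l + 2^-1 != 0 by rewrite gt_eqF.
    by move=> p0; field; apply/and3P; split; rewrite gt_eqF//; nra.
  rewrite -[X in _ --> X](subrr (1 / (l + l) ^+ 1)); apply: cvgB.
    exact: cvg_cst.
  rewrite (_ : (fun N => _) = series (geometric ((l + 2^-1) ^- 2) q))//.
  apply/funext => N; rewrite /series/= big_mkord; apply: eq_bigr => n _.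
  rewrite -/(c n) cE /= /q (exprAC (_ / _) 2 n) -(exprVn _ 2) -exprMn; congr (_ ^+ 2).
  by rewrite expr_div_n exprS invfM mulrCA.
have h := cvg_ip (sqint_lagsum c) se su d0.
rewrite lapE ipC; apply/esym; rewrite -(cvg_lim _ h)//.
rewrite (_ : (fun n => _) = fun=> 0) ?lim_cst//.
apply/funext => N; rewrite ip_lagsuml// big1// => n _.
by rewrite ipC u0 mulr0.
Qed.

End LaguerreExpansion.

(** * Convolution of test functions and its Laplace transform *)

Section Convolution.
Context {R : realType}.
Local Notation mu := (@lebesgue_measure R).
Local Notation Rplus := (@Rplus R).
Local Notation L2r := (sqint mu Rplus).
Implicit Types (f g h : R -> R) (a b c t x y l : R).

Hint Resolve measurable_Rplus measurable_RplusR : core.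

Lemma Rintegral_support (D : set R) h : (forall t, ~ D t -> h t = 0) ->
  \int[mu]_(t in D) h t = \int[mu]_t h t.
Proof.
move=> hD; rewrite Rintegral_mkcond; congr Rintegral; apply/funext => t.
by rewrite patchE; case: ifPn => // tD; rewrite hD// => /mem_set tD'; rewrite tD' in tD.
Qed.

Lemma continuous_itv_integrable h x y : continuous h ->
  mu.-integrable `[x, y] (EFin \o h).
Proof.
move=> ch; apply: continuous_compact_integrable; first exact: segment_compact.
exact: continuous_subspaceT.
Qed.

Lemma integrable_support (D : set (measurableTypeR R)) h : measurable D ->
  (forall t, ~ D t -> h t = 0) -> mu.-integrable D (EFin \o h) ->
  mu.-integrable setT (EFin \o h).
Proof.
move=> mD hD /(integrable_mkcond _ mD); apply: eq_integrable => // t _.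
rewrite patchE /=; case: ifPn => // tD; rewrite hD//.
by move=> /mem_set tD'; rewrite tD' in tD.
Qed.

Lemma continuous_expRN l : continuous (fun t => expR (- (t * l))).
Proof.
rewrite (_ : (fun _ => _) = monexp 0 l).
  by apply: rsmooth_continuous; exact: rsmooth_monexp.
by apply/funext => t; rewrite /monexp expr0 mul1r.
Qed.

Lemma derive1_shift t x : (fun t => t - x)^`()%classic t = 1.
Proof.
have d : is_derive t 1 (fun t => t - x) 1 by apply: is_derive_eq; rewrite subr0.
by rewrite derive1E derive_val.
Qed.

Lemma Rintegral_shift h x a b : continuous h ->
  (forall t, ~ (a <= t <= b) -> h t = 0) ->
  \int[mu]_t h (t - x) = \int[mu]_t h t.
Proof.
move=> ch h0; have [ab|ba] := leP a b; last first.
  have hE t : h t = 0.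
    by apply: h0 => /andP[ta tb]; have := le_trans ta tb; rewrite leNgt ba.
  by apply: eq_Rintegral => t _; rewrite !hE.
rewrite -(Rintegral_support (D := `[a + x, b + x]%classic)); last first.
  move=> t /= tab; apply: h0 => /andP[ta tb]; apply: tab.
  by rewrite in_itv/= -lerBrDr ta -lerBlDr tb.
rewrite -[RHS](Rintegral_support (D := `[a, b]%classic)); last first.
  by move=> t /= tab; apply: h0 => abt; apply: tab; rewrite in_itv.
congr fine.
have F'E : (fun t : R => t - x)^`()%classic = cst (1 : R).
  by apply/funext => s; rewrite derive1_shift.
have := @integration_by_substitution_increasing R (fun t => t - x) h (a + x) (b + x).
rewrite !addrK => ->.
- apply: eq_integral => t _ /=; congr EFin.
  by rewrite mulrfctE /= derive1_shift mulr1.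
- by rewrite lerD2r.
- by move=> s t _ _ st; rewrite ltrD2r.
- by move=> t _; rewrite F'E; exact: cst_continuous.
- by rewrite F'E; exact: is_cvg_cst.
- by rewrite F'E; exact: is_cvg_cst.
- split.
  + by move=> t _.
  + apply: cvg_at_right_filter; apply: cvgB; [exact: cvg_id|exact: cvg_cst].
  + apply: cvg_at_left_filter; apply: cvgB; [exact: cvg_id|exact: cvg_cst].
- exact: continuous_subspaceT.
Qed.

Lemma rtest_continuous f : rtest f -> continuous f.
Proof. by move=> [sf _]; exact: rsmooth_continuous. Qed.

Lemma rtest_derive1 f : rtest f -> rtest f^`()%classic.
Proof.
move=> [sf [x [y [x0 fxy]]]]; split; first exact: rsmooth_derive1.
exists x, y; split => // t txy; rewrite derive1E.
rewrite (near_eq_derive (g := cst 0)) ?derive_cst//.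
have [tx|xt] := ltP t x.
  near=> s; apply: fxy => /andP[xs _]; move: xs; apply/negP; rewrite -ltNge.
  by near: s; exact: lt_nbhsl.
have yt : y < t.
  by rewrite ltNge; apply/negP => ty; apply: txy; rewrite xt ty.
near=> s; apply: fxy => /andP[_ sy]; move: sy; apply/negP; rewrite -ltNge.
by near: s; exact: lt_nbhsr.
Unshelve. all: by end_near. Qed.

Lemma rtest_bounded f : rtest f -> exists2 M : R, 0 <= M & forall t, `|f t| <= M.
Proof.
move=> tf; have cf := rtest_continuous tf.
have [sf [x [y [x0 fxy]]]] := tf.
have [xy|yx] := leP x y; last first.
  exists 0 => // t; rewrite fxy ?normr0// => /andP[ta tb].
  by have := le_trans ta tb; rewrite leNgt yx.
have cn : {within `[x, y], continuous (Num.norm \o f)}.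
  by apply: continuous_subspaceT => t; apply: cvg_norm; exact: cf.
have [c _ cP] := EVT_max xy cn; exists `|f c| => // t.
have [txy|txy] := boolP (t \in `[x, y]); first exact: cP.
by rewrite fxy ?normr0// => h; rewrite in_itv/= h in txy.
Qed.

Lemma sqint_rtest f : rtest f -> L2r f.
Proof.
move=> tf; have [M M0 fM] := rtest_bounded tf.
have cf := rtest_continuous tf; have [_ [x [y [x0 fxy]]]] := tf.
(* The majorant is [M e^y e^(-t)], which is at least [M] as long as [t <= y]. *)
apply: (le_sqint (mu := mu) measurable_Rplus _
  (sqintZ measurable_Rplus (M * expR y) (sqint_monexp 0 ltr01))).
  by apply: measurable_funTS; exact: continuous_measurable_fun.
move=> t _; have [/andP[xt ty]|txy] := pselect (x <= t <= y); last first.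
  by rewrite fxy// normr0.
rewrite (le_trans (fM t))// /monexp expr0 mul1r mulr1 -mulrA -expRD.
rewrite ger0_norm ?mulr_ge0 ?expR_ge0// ler_peMr// -expR0 ler_expR.
by rewrite subr_ge0.
Qed.

Definition rconv f g t : R := \int[mu]_(x in `[0, t]) (f x * g (t - x)).

(** Both supports lie in the open half-line, so the integrand vanishes outside [[0, t]]. Without the
    moving limit of integration, differentiation under the integral sign applies. *)
Lemma rconvE f g t : rtest f -> rtest g ->
  rconv f g t = \int[mu]_x (f x * g (t - x)).
Proof.
move=> [_ [a [b [a0 fab]]]] [_ [c [d [c0 gcd]]]].
apply: Rintegral_support => x /= xt.
have [xa|ax] := ltP x a.
  by rewrite fab ?mul0r// => /andP[]; rewrite leNgt xa.
rewrite [g _]gcd ?mulr0// => /andP[cx _]; apply: xt; rewrite in_itv/=.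
rewrite (le_trans (ltW a0) ax)/= -subr_ge0; exact: le_trans (ltW c0) cx.
Qed.

Lemma rconv_itvE f g t a b : rtest g ->
  (forall t, ~ (a <= t <= b) -> f t = 0) ->
  \int[mu]_x (f x * g (t - x)) = \int[mu]_(x in `[a, b]) (f x * g (t - x)).
Proof.
move=> tg fab; apply/esym; apply: Rintegral_support => x /= xab.
by rewrite fab ?mul0r// => h; apply: xab; rewrite in_itv.
Qed.

Lemma continuous_comp_sub g t : continuous g -> continuous (fun x => g (t - x)).
Proof.
move=> cg x; apply: (@continuous_comp _ _ _ (fun x => t - x) g); last exact: cg.
by apply: cvgB; [exact: cvg_cst|exact: cvg_id].
Qed.

(** The derivative falls on [g] alone: for fixed [f] the convolutions with test functions are a
    class closed under differentiation, as [rsmooth_coind] demands. *)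
Lemma is_derive_rconv f g t : rtest f -> rtest g ->
  is_derive t 1 (fun t => \int[mu]_x (f x * g (t - x)))
    (\int[mu]_x (f x * g^`()%classic (t - x))).
Proof.
move=> tf tg; have tg' := rtest_derive1 tg.
have [_ [a [b [a0 fab]]]] := tf.
have [M M0 fM] := rtest_bounded tf; have [N N0 gN] := rtest_bounded tg'.
pose F t x := f x * g (t - x).
have dF (s x : R) : is_derive s (1 : R) (fun s : R => F s x) (f x * g^`()%classic (s - x)).
  have d1 : is_derive s 1 (fun s => s - x) 1.
    by apply: is_derive_eq; rewrite subr0.
  have d2 := rsmooth_is_derive (s - x) tg.1.
  have d3 := @is_derive1_comp _ g (fun s => s - x) _ _ _ d2 d1.
  by apply: (is_derive_eq (is_deriveZ (f x) d3)); rewrite mulr1.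
have iF s : mu.-integrable `[a, b] (EFin \o F s).
  apply: continuous_itv_integrable => x; apply: cvgM.
    exact: rtest_continuous.
  by apply: continuous_comp_sub; exact: rtest_continuous.
have iG : mu.-integrable `[a, b] (EFin \o cst (M * N)).
  by apply: continuous_itv_integrable; exact: cst_continuous.
have tI : `]t - 1, t + 1[%classic t.
  by rewrite /= in_itv/= ltrDl ltr01 gtrDl ltrN10.
have bnd s x : `|partial1of2 F s x| <= M * N.
  rewrite partial1of2E; have := dF s x => d; rewrite derive_val normrM.
  by rewrite ler_pM.
have df := derivable_under_integral (mu := mu) (f := F) (B := `[a, b]%classic)
  (measurable_itv _) tI (fun s _ => iF s) (fun s x _ _ => @ex_derive _ _ _ _ _ _ _ (dF s x))
  (fun=> mulr_ge0 M0 N0) iG (fun s x _ _ => bnd s x).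
have de := differentiation_under_integral (mu := mu) (f := F) (B := `[a, b]%classic)
  (measurable_itv _) tI (fun s _ => iF s) (fun s x _ _ => @ex_derive _ _ _ _ _ _ _ (dF s x))
  (fun=> mulr_ge0 M0 N0) iG (fun s x _ _ => bnd s x).
rewrite (_ : (fun t => _) = (fun s => \int[mu]_(x in `[a, b]) F s x)); last first.
  by apply/funext => s; rewrite (rconv_itvE _ tg fab).
rewrite (rconv_itvE _ tg' fab).
apply: DeriveDef; first exact: df.
rewrite -derive1E de; apply: eq_Rintegral => x _.
by rewrite partial1of2E; have := dF t x => d; rewrite derive_val.
Qed.

Lemma rtest_rconv f g : rtest f -> rtest g -> rtest (rconv f g).
Proof.
move=> tf tg; rewrite (_ : rconv f g = (fun t => \int[mu]_x (f x * g (t - x)))); last first.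
  by apply/funext => t; rewrite rconvE.
split.
  apply: (rsmooth_coind (P := fun h => exists2 g, rtest g &
    h = (fun t => \int[mu]_x (f x * g (t - x))))); last by exists g.
  move=> _ [k tk ->]; exists (fun t => \int[mu]_x (f x * k^`()%classic (t - x))).
    by exists k^`()%classic => //; exact: rtest_derive1.
  by move=> t; exact: is_derive_rconv.
have [_ [a [b [a0 fab]]]] := tf; have [_ [c [d [c0 gcd]]]] := tg.
exists (a + c), (b + d); split; first by rewrite addr_gt0.
move=> t tabcd; rewrite (_ : (fun=> _) = cst 0) ?Rintegral_cst ?mul0r//.
apply/funext => x /=.
have [/andP[ax xb]|xab] := pselect (a <= x <= b); last by rewrite fab ?mul0r.
rewrite [g _]gcd ?mulr0// => /andP[cx xd]; apply: tabcd.
by apply/andP; split; lra.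
Qed.

(** Fubini's theorem on the rectangle formed by an interval [D1] containing the support of the
    convolution and an interval [D2] containing that of [f]. The integrand is bounded there,
    whatever the sign of [l]. The integral over [t] is then translated by [x]. *)
Lemma lap_rconv f g l : rtest f -> rtest g ->
  lap (rconv f g) l = lap f l * lap g l.
Proof.
move=> tf tg; have [_ [a [b [a0 fab]]]] := tf; have [_ [c [d [c0 gcd]]]] := tg.
have [M M0 fM] := rtest_bounded tf; have [N N0 gN] := rtest_bounded tg.
have cf := rtest_continuous tf; have cg := rtest_continuous tg.
have lapT h : rtest h -> lap h l = \int[mu]_t (expR (- (t * l)) * h t).
  move=> [_ [x [y [x0 hxy]]]]; apply: Rintegral_support => t tR.
  rewrite hxy ?mulr0// => /andP[xt _]; apply: tR; apply/RplusE.
  exact: lt_le_trans xt.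
rewrite (lapT _ (rtest_rconv tf tg)).
pose D1 : set R := `[a + c, b + d]%classic; pose D2 : set R := `[a, b]%classic.
have mD1 : measurable (D1 : set (measurableTypeR R)) by exact: measurable_itv.
have mD2 : measurable (D2 : set (measurableTypeR R)) by exact: measurable_itv.
have D1P (t x : R) : a <= x -> x <= b -> c <= t - x -> t - x <= d -> D1 t.
  by move=> ? ? ? ?; rewrite /D1/= in_itv/=; apply/andP; split; lra.
pose F (z : R * R) : R := expR (- (z.1 * l)) * (f z.2 * g (z.1 - z.2)).
have mF : measurable_fun (D1 `*` D2) (EFin \o F).
  apply: measurable_funTS; apply/measurable_EFinP; apply: measurable_funM.
    apply: measurableT_comp => //; apply: measurableT_comp => //.
    by apply: measurable_funM.
  apply: measurable_funM.
    by apply: (measurableT_comp (f := f)) => //; exact: continuous_measurable_fun.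
  apply: (measurableT_comp (f := g)); first exact: continuous_measurable_fun.
  by apply: measurable_funB.
have iF2 t : mu.-integrable D2 (EFin \o (fun x => F (t, x))).
  apply: continuous_itv_integrable => x.
  apply: (@cvgM _ _ _ _ (fun=> expR (- (t * l))) (fun x => f x * g (t - x))).
    exact: cvg_cst.
  by apply: cvgM; [exact: cf|exact: continuous_comp_sub].
have iF1 x : mu.-integrable D1 (EFin \o (fun t => F (t, x))).
  apply: continuous_itv_integrable => t.
  apply: (@cvgM _ _ _ _ (fun t => expR (- (t * l))) (fun t => f x * g (t - x))).
    exact: continuous_expRN.
  apply: cvgM; first exact: cvg_cst.
  apply: (@continuous_comp _ _ _ (fun t => t - x) g); last exact: cg.
  by apply: cvgB; [exact: cvg_id|exact: cvg_cst].
have F1 x : D2 x -> \int[mu]_(t in D1) F (t, x) = lap g l * (expR (- (x * l)) * f x).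
  rewrite /D2/= in_itv/= => /andP[ax xb].
  rewrite Rintegral_support /F/=; last first.
    by move=> t /= tD; rewrite [g _]gcd ?mulr0// => /andP[ct td]; exact: tD (D1P t x ax xb ct td).
  pose k s := f x * expR (- (x * l)) * (expR (- (s * l)) * g s).
  rewrite [LHS](_ : _ = \int[mu]_t k (t - x)); last first.
    apply: eq_Rintegral => t _; rewrite /k mulrA [X in X * _ = _]mulrC.
    rewrite [RHS]mulrA; congr (_ * _); rewrite -[RHS]mulrA -expRD.
    by congr (_ * expR _); ring.
  rewrite (Rintegral_shift (h := k) x (a := c) (b := d)).
  - rewrite /k RintegralZl//; first by rewrite lapT// mulrC (mulrC (f x)).
    apply: (integrable_support (D := `[c, d]%classic)); first exact: measurable_itv.
      move=> t tcd; rewrite gcd ?mulr0// => h; apply: tcd.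
    apply: continuous_itv_integrable => t; apply: cvgM; last exact: cg.
    exact: continuous_expRN.
  - move=> t; apply: cvgM; first exact: cvg_cst.
    by apply: cvgM; [exact: continuous_expRN|exact: cg].
  - by move=> t /gcd gt; rewrite /k gt !mulr0.
have rconv0 t : ~ D1 t -> \int[mu]_(x in D2) F (t, x) = 0.
  move=> tD; rewrite (@eq_Rintegral _ _ _ mu D2 (cst 0)) => [|x].
    by rewrite Rintegral_cst ?mul0r//.
  rewrite inE /D2/= in_itv/= => /andP[ax xb]; rewrite /F/= [g _]gcd ?mulr0//.
  by move=> /andP[ct td]; exact: tD (D1P t x ax xb ct td).
have FE t : expR (- (t * l)) * rconv f g t = \int[mu]_(x in D2) F (t, x).
  rewrite rconvE// (rconv_itvE _ tg fab) -RintegralZl//.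
  apply: continuous_itv_integrable => x.
  by apply: cvgM; [exact: cf|exact: continuous_comp_sub].
transitivity (\int[mu]_(t in D1) \int[mu]_(x in D2) F (t, x)).
  rewrite -(Rintegral_support (D := D1)).
    by apply: eq_Rintegral => t _; rewrite FE.
  by move=> t tD; rewrite FE rconv0.
transitivity (\int[mu]_(x in D2) \int[mu]_(t in D1) F (t, x)).
  congr fine.
  transitivity (\int[mu]_(t in D1) \int[mu]_(x in D2) (F (t, x))%:E)%E.
    apply: eq_integral => t _; rewrite /Rintegral fineK//.
    exact: (integrable_fin_num mD2 (iF2 t)).
  rewrite (fubini_on (m1 := mu) (m2 := mu) mD1 mD2 mF).
    apply: eq_integral => x _; rewrite /Rintegral fineK//.
    exact: (integrable_fin_num mD1 (iF1 x)).
  (* On [D1] one has [0 < t <= b + d], whence the bound on the exponential. *)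
  pose K := expR (`|l| * (b + d)) * (M * N).
  have FK t x : D1 t -> `|F (t, x)| <= K.
    rewrite /D1/= in_itv/= => /andP[act tbd]; rewrite /F/= !normrM.
    apply: ler_pM; rewrite ?mulr_ge0//.
      rewrite ger0_norm ?expR_ge0// ler_expR (le_trans (ler_norm _))//.
      rewrite normrN normrM mulrC ler_wpM2l// ger0_norm//.
      by rewrite (le_trans _ act)// ltW// addr_gt0.
    by apply: ler_pM.
  have K0 : 0 <= K by rewrite mulr_ge0 ?expR_ge0// mulr_ge0.
  have I2 t : D1 t -> (\int[mu]_(x in D2) `|(F (t, x))%:E| <= K%:E * mu D2)%E.
    move=> tD; apply: integral_le_bound => //.
      exact: (measurable_int mu (iF2 t)).
    by apply: aeW => x _; rewrite lee_fin FK.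
  have mu_itv (x y : R) : mu `[x, y]%classic \is a fin_num.
    by rewrite lebesgue_measure_itv/=; case: ifP.
  apply: (@le_lt_trans _ _ (\int[mu]_(t in D1) cst (K%:E * mu D2) t)%E).
    apply: ge0_le_integral => //.
    - by move=> t _; exact: integral_ge0.
    - apply: (measurable_fubini_tonelli_on mu mD1 mD2
        (f := fun z => `|(F z)%:E|%E)) => //.
      exact: measurableT_comp mF.
  rewrite integral_cst// ltey_eq fin_numM ?fin_numM//; exact: mu_itv.
rewrite (@eq_Rintegral _ _ _ mu D2 (fun x => lap g l * (expR (- (x * l)) * f x))); last first.
  by move=> x; rewrite inE => /F1.
rewrite RintegralZl//; last first.
  apply: continuous_itv_integrable => t; apply: cvgM; last exact: cf.
  exact: continuous_expRN.
rewrite mulrC (lapT f)//; congr (_ * _); apply: Rintegral_support => x xD.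
by rewrite fab ?mulr0// => h; apply: xD; rewrite /D2/= in_itv.
Qed.

End Convolution.

(** * Measures with a density *)

Section Density.
Context d (T : measurableType d) (R : realType).
Variables (mu : {measure set T -> \bar R}) (D : set T) (w : T -> R).
Hypotheses (mD : measurable D) (mw : measurable_fun D w).
Hypothesis w0 : forall x, D x -> 0 <= w x.

(** The proofs are arguments of the set function so that the measure structure can be attached to
    [density mD mw w0]. *)
Definition density (mD_ : measurable D) (mw_ : measurable_fun D w)
    (w0_ : forall x, D x -> 0 <= w x) (V : set T) : \bar R :=
  (\int[mu]_(x in V `&` D) (w x)%:E)%E.

Local Notation dens := (density mD mw w0).

Let density0 : dens set0 = 0%E.
Proof. by rewrite /density set0I integral_set0. Qed.

Let density_ge0 V : (0 <= dens V)%E.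
Proof. by apply: integral_ge0 => x [_ Dx]; rewrite lee_fin w0. Qed.

Let density_sigma_additive : semi_sigma_additive dens.
Proof.
move=> F mF tF mUF; rewrite /density setI_bigcupl ge0_integral_bigcup.
- apply: is_cvg_ereal_nneg_natsum_cond => n _ _.
  by apply: integral_ge0 => x [_ Dx]; rewrite lee_fin w0.
- by move=> k; exact: measurableI.
- apply/measurable_EFinP; apply: measurable_funS mw => //.
  by move=> x [k _ []].
- by move=> x [k _ [_ Dx]]; rewrite lee_fin w0.
- exact: trivIset_setIr.
Qed.

HB.instance Definition _ := isMeasure.Build _ _ _ dens
  density0 density_ge0 density_sigma_additive.

Import HBNNSimple.

Let integral_density_nnsfun (h : {nnsfun T >-> R}) :
  (\int[dens]_x (h x)%:E = \int[mu]_(x in D) ((h x)%:E * (w x)%:E))%E.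
Proof.
have mh y : measurable_fun D (fun x => (y * \1_(h @^-1` [set y]) x)%:E).
  by apply/measurable_EFinP; apply: measurable_funM => //; exact: measurable_indic.
rewrite integralT_nnsfun sintegralE fsbig_finite//=.
transitivity (\int[mu]_(x in D) (\sum_(y <- finmap.enum_fset (fset_set (range h)))
    ((y * \1_(h @^-1` [set y]) x)%:E * (w x)%:E)))%E; last first.
  apply: eq_integral => x _; rewrite fimfunE fsbig_finite//= -EFinM mulr_suml.
  by rewrite -sumEFin; apply: eq_bigr => y _; rewrite EFinM.
rewrite ge0_integral_sum//; last 2 first.
- by move=> y; apply: emeasurable_funM => //; exact/measurable_EFinP.
- by move=> y x Dx; rewrite mule_ge0 ?nnfun_muleindic_ge0// lee_fin w0.
apply: eq_big_seq => y; rewrite in_fset_set// inE => -[x0 _ yE].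
under eq_integral do rewrite EFinM -muleA.
rewrite ge0_integralZl//; last 3 first.
- apply: emeasurable_funM; last exact/measurable_EFinP.
  by apply/measurable_EFinP; exact: measurable_indic.
- by move=> x Dx; rewrite mule_ge0 ?lee_fin ?w0.
- by rewrite lee_fin -yE fun_ge0.
congr (_ * _)%E; rewrite /= /density setIC integral_mkcondr.
apply: eq_integral => x _; rewrite patchE indicE.
by case: ifP => _; rewrite ?mul1e ?mul0e.
Qed.

Lemma ge0_integral_density (f : T -> \bar R) :
  measurable_fun setT f -> (forall x, (0 <= f x)%E) ->
  (\int[dens]_x f x = \int[mu]_(x in D) (f x * (w x)%:E))%E.
Proof.
move=> mf f0; pose h := nnsfun_approx measurableT mf.
have hf x : (h n x)%:E @[n --> \oo] --> f x by exact: cvg_nnsfun_approx.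
have ndh x m n : (m <= n)%N -> h m x <= h n x.
  by move=> mn; exact/lefP/nd_nnsfun_approx.
have mh n (E : set T) : measurable_fun E (fun x => (h n x)%:E).
  by apply/measurable_EFinP; apply: measurable_funTS; exact: measurable_funP.
transitivity (limn (fun n => \int[dens]_x (h n x)%:E))%E.
  rewrite -monotone_convergence//.
  - by apply: eq_integral => x _; apply/esym/cvg_lim => //; exact: hf.
  - by move=> n x _; rewrite lee_fin fun_ge0.
  - by move=> x _ m n mn; rewrite lee_fin ndh.
under eq_fun do rewrite integral_density_nnsfun.
rewrite -monotone_convergence//.
- apply: eq_integral => x; rewrite inE => Dx; apply/cvg_lim => //.
  by apply: cvgeZr => //; exact: hf.
- by move=> n; apply: emeasurable_funM => //; exact/measurable_EFinP.
- by move=> n x Dx; rewrite mule_ge0 ?lee_fin ?w0 ?fun_ge0.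
- by move=> x Dx m n mn; rewrite lee_wpmul2r ?lee_fin ?w0 ?ndh.
Qed.

End Density.

(** * The change of variables from the half-line to the interval [(-1, 1)] *)

Section MoebiusChangeOfVariables.
Context {R : realType}.
Local Notation mu := (@lebesgue_measure R).
Local Notation Rplus := (@Rplus R).
Implicit Types (f e : R -> R) (a b l m : R).

Hint Resolve measurable_Rplus measurable_RplusR : core.

Let I : set R := `]-1, 1[%classic.

Let mI : measurable (I : set (measurableTypeR R)).
Proof. exact: measurable_itv. Qed.

Definition moebius l : R := (l - 2^-1) / (l + 2^-1).
Definition moebius_inv m : R := (1 + m) / (2 * (1 - m)).
Definition moebius_weight l : R := (l + 2^-1) ^- 2.

Lemma moebius_invK m : m != 1 -> moebius (moebius_inv m) = m.
Proof.
move=> m1; rewrite /moebius /moebius_inv.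
have h : 1 - m != 0 by rewrite subr_eq0 eq_sym.
by field; rewrite h /=; apply/eqP => h2; lra.
Qed.

Lemma moebius_inv_gt0 m : -1 < m < 1 -> 0 < moebius_inv m.
Proof. by move=> /andP[m1 m2]; rewrite divr_gt0//; lra. Qed.

Lemma moebius_inv_le m b : m < 1 -> 0 <= b -> (moebius_inv m <= b) = (m <= moebius b).
Proof.
move=> m1 b0; rewrite /moebius_inv /moebius ler_pdivrMr ?ler_pdivlMr; [|lra|lra].
by apply/idP/idP => ?; nra.
Qed.

Lemma moebius_inv_gt m b : m < 1 -> 0 <= b -> (b < moebius_inv m) = (moebius b < m).
Proof. by move=> m1 b0; rewrite !ltNge moebius_inv_le. Qed.

Lemma moebius_itv b : 0 <= b -> -1 <= moebius b < 1.
Proof.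
move=> b0; rewrite /moebius ler_pdivlMr ?ltr_pdivrMr; [|lra|lra].
by apply/andP; split; lra.
Qed.

Lemma moebius_lt a b : 0 <= a -> a < b -> moebius a < moebius b.
Proof.
move=> a0 ab; rewrite /moebius ltr_pdivrMr; last by lra.
rewrite mulrAC ltr_pdivlMr; last by lra.
by nra.
Qed.

Lemma is_derive_moebius l : 0 <= l -> is_derive l 1 moebius (moebius_weight l).
Proof.
move=> l0; have l2 : l + 2^-1 != 0 by rewrite gt_eqF// ltr_wpDl.
have d1 : is_derive l 1 (fun l : R => l + 2^-1) 1.
  by apply: is_derive_eq; rewrite scaler0 addr0.
have d2 : is_derive l 1 (fun l : R => l - 2^-1) 1.
  by apply: is_derive_eq; rewrite scaler0 subr0.
have d3 := is_deriveM d2 (@is_deriveV _ (fun l : R => l + 2^-1) l _ _ l2 d1).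
apply: (is_derive_eq d3); rewrite /moebius_weight /GRing.scale/=.
rewrite (_ : l - 2^-1 = l + 2^-1 - 1); last by lra.
by move: l2; set p := l + 2^-1 => p0; field.
Qed.

Lemma continuous_moebius_weight l : 0 <= l -> {for l, continuous moebius_weight}.
Proof.
move=> l0; have l2 : l + 2^-1 != 0 by rewrite gt_eqF// ltr_wpDl.
have c : {for l, continuous (fun l : R => l + 2^-1)}.
  by apply: cvgD; [exact: cvg_id|exact: cvg_cst].
apply: cvgV; first by rewrite expf_neq0.
rewrite expr2; under eq_fun do rewrite expr2.
exact: cvgM.
Qed.

Lemma moebius_weight_ge0 l : 0 <= moebius_weight l.
Proof. by rewrite invr_ge0 sqr_ge0. Qed.

Lemma measurable_moebius_weight : measurable_fun Rplus moebius_weight.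
Proof.
apply: open_continuous_measurable_fun; first exact: interval_open.
by move=> l; rewrite inE => /RplusE/ltW; exact: continuous_moebius_weight.
Qed.

Lemma measurable_moebius : measurable_fun Rplus moebius.
Proof.
apply: open_continuous_measurable_fun; first exact: interval_open.
move=> l; rewrite inE => /RplusE/ltW/is_derive_moebius d.
by apply: differentiable_continuous; apply/derivable1_diffP; case: d.
Qed.

(** The extension by zero is measurable on the whole line, as a pushforward requires; the measure
    pushed forward lives on [I]. *)
Let ginv : measurableTypeR R -> measurableTypeR R := moebius_inv \_ I.

Let measurable_ginv : measurable_fun [set: measurableTypeR R] ginv.
Proof.
apply/(measurable_restrictT _ mI).
apply: open_continuous_measurable_fun; first exact: interval_open.
move=> m; rewrite inE /I/= in_itv/= => /andP[_ m1].
apply: cvgM; first by apply: cvgD; [exact: cvg_cst|exact: cvg_id].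
apply: cvgV; first by rewrite mulf_neq0// subr_eq0 gt_eqF.
apply: cvgM; first exact: cvg_cst.
by apply: cvgB; [exact: cvg_cst|exact: cvg_id].
Qed.

Let one0 (m : R) : I m -> 0 <= (cst 1 : R -> R) m.
Proof. by []. Qed.

(** Lebesgue measure restricted to [I], written with density 1 so that [ge0_integral_density] serves
    for both sides of the substitution. *)
Let dens1 : {measure set (measurableTypeR R) -> \bar R} :=
  density mu mI (measurable_cst (1 : R)) one0.

Let dens1E (X : set (measurableTypeR R)) : measurable X ->
  dens1 X = mu (X `&` I).
Proof.
move=> mX; transitivity (\int[mu]_(x in X `&` I) cst 1%E x)%E; first by [].
by rewrite integral_cst ?mul1e//; exact: measurableI.
Qed.

Let measurable_preimage_ginv (X : set (measurableTypeR R)) :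
  measurable X -> measurable (ginv @^-1` X).
Proof. by move=> mX; rewrite -[X in measurable X]setTI; exact: measurable_ginv. Qed.

Let densw : {measure set (measurableTypeR R) -> \bar R} :=
  density mu measurable_Rplus measurable_moebius_weight
    (fun l _ => moebius_weight_ge0 l).

Let push : {measure set (measurableTypeR R) -> \bar R} :=
  measure_function_pushforward__canonical__measure_function_Measure
    dens1 measurable_ginv.

Let densw_ocitv a b : 0 <= a -> a < b ->
  densw `]a, b]%classic = (moebius b - moebius a)%:E.
Proof.
move=> a0 ab; rewrite /densw/= /density.
rewrite (_ : _ `&` _ = `]a, b]%classic); last first.
  apply/seteqP; split=> [l []//|l /= abl]; split => //; apply/RplusE.
  by move: abl; rewrite in_itv/= => /andP[al _]; exact: le_lt_trans al.
have cw : {within `[a, b], continuous moebius_weight}.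
  apply: continuous_in_subspaceT => l; rewrite inE/= in_itv/= => /andP[al _].
  by apply: continuous_moebius_weight; exact: le_trans al.
have dm l : a <= l -> is_derive l 1 moebius (moebius_weight l).
  by move=> al; apply: is_derive_moebius; exact: le_trans al.
have cm l : a <= l -> {for l, continuous moebius}.
  move=> /dm d; apply: differentiable_continuous; apply/derivable1_diffP.
  by case: d.
rewrite integral_itv_obnd_cbnd; last first.
  apply/measurable_EFinP; apply: (measurable_funS measurable_RplusR) measurable_moebius_weight.
  by move=> l /=; rewrite in_itv/= => /andP[al _]; apply/RplusE; exact: le_lt_trans al.
rewrite (continuous_FTC2 (F := moebius) ab cw).
- by rewrite -EFinB.
- split.
  + by move=> l; rewrite in_itv/= => /andP[al _]; case: (dm _ (ltW al)).
  + by apply: cvg_at_right_filter; exact: cm.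
  + by apply: cvg_at_left_filter; apply: cm; exact: ltW.
- move=> l; rewrite in_itv/= => /andP[al _]; rewrite derive1E.
  by have := dm l (ltW al) => d; rewrite derive_val.
Qed.

Let push_ocitv a b : 0 <= a -> a < b ->
  push `]a, b]%classic = (moebius b - moebius a)%:E.
Proof.
move=> a0 ab; rewrite /push/= /pushforward dens1E; last first.
  by apply: measurable_preimage_ginv; exact: measurable_itv.
have b0 : 0 <= b by rewrite (le_trans a0)// ltW.
have /andP[a1 a2] := moebius_itv a0; have /andP[b1 b2] := moebius_itv b0.
rewrite (_ : _ `&` _ = `]moebius a, moebius b]%classic); last first.
  apply/seteqP; split=> m.
    rewrite /ginv/= => -[] + Im; rewrite patchE mem_set// !in_itv/=.
    have /andP[m1 m2] : -1 < m < 1 by move: Im; rewrite /I/= in_itv.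
    by rewrite moebius_inv_le// moebius_inv_gt.
  rewrite /= in_itv/= => /andP[am mb].
  have Im : I m by rewrite /I/= in_itv/= (le_lt_trans a1 am) (le_lt_trans mb b2).
  split => //; rewrite /ginv/= patchE mem_set// in_itv/=.
  have m2 : m < 1 := le_lt_trans mb b2.
  by rewrite moebius_inv_le// moebius_inv_gt// am.
rewrite lebesgue_measure_itv/= lte_fin.
by rewrite moebius_lt// -EFinB.
Qed.

Let push_Rplus (X : set R) : push X = push (X `&` Rplus).
Proof.
rewrite /push/= /pushforward /dens1/= /density; congr integral.
apply/seteqP; split=> m [Xm Im]; split=> //; last by case: Xm.
split => //; apply/RplusE; rewrite /ginv patchE mem_set//.
by apply: moebius_inv_gt0; move: Im; rewrite /I/= in_itv.
Qed.

Let densw_Rplus (X : set R) : densw X = densw (X `&` Rplus).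
Proof. by rewrite /densw/= /density -setIA setIid. Qed.

(** For [0 <= a < b] both measures give []a, b]] the mass [moebius b - moebius a]: one by the
    fundamental theorem of calculus, the other as the length of the preimage. Both ignore the
    complement of [Rplus], and uniqueness of measures extends the equality from half-open
    intervals. *)
Let push_densw (A : set (measurableTypeR R)) : measurable A -> push A = densw A.
Proof.
move=> mA.
apply: (@measure_unique _ R (measurableTypeR R) (@ocitv R)
  (fun k => `](- k%:R), k%:R]%classic) _ _ _ _ push densw) => //.
- exact: ocitvI.
- by move=> k; exists (- k%:R, k%:R).
- apply/seteqP; split=> // x _; exists (Num.truncn `|x|).+1 => //=.
  rewrite in_itv/=; have h := truncnS_gt `|x|.
  by rewrite ltrNl (le_lt_trans (ler_norm _)) ?normrN// (le_trans (ler_norm _))// ltW.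
- move=> X /ocitvP[->|[[a b] /= ab ->]]; first by rewrite !measure0.
  rewrite push_Rplus densw_Rplus.
  rewrite (_ : _ `&` _ = `]Num.max a 0, b]%classic); last first.
    apply/seteqP; split=> [x [/= + /RplusE x0]|x /=].
      by rewrite !in_itv/= gt_max x0 => /andP[-> ->].
    by rewrite !in_itv/= gt_max => /andP[/andP[-> x0] ->]; split => //; apply/RplusE.
  have [ba|ab'] := leP b (Num.max a 0); last first.
    by rewrite push_ocitv ?densw_ocitv// le_max lexx orbT.
  by rewrite set_itv_ge ?measure0// bnd_simp -leNgt.
- move=> k; rewrite /push/= /pushforward dens1E; last first.
    by apply: measurable_preimage_ginv; exact: measurable_itv.
  apply: (@le_lt_trans _ _ (mu I)).
    apply: le_measure; rewrite ?inE//.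
    by apply: measurableI => //; apply: measurable_preimage_ginv; exact: measurable_itv.
  by rewrite /I lebesgue_measure_itv/=; case: ifP => // _; rewrite ltry.
Qed.

Lemma ge0_moebius_change (F : R -> \bar R) :
  measurable_fun setT F -> (forall l, (0 <= F l)%E) ->
  (\int[mu]_(l in Rplus) (F l * (moebius_weight l)%:E) =
   \int[mu]_(m in I) F (moebius_inv m))%E.
Proof.
move=> mF F0.
rewrite -(ge0_integral_density mu measurable_Rplus measurable_moebius_weight
    (fun l _ => moebius_weight_ge0 l) mF F0).
transitivity (\int[push]_l F l)%E.
  by apply: eq_measure_integral => A mA _; rewrite push_densw.
rewrite ge0_integral_pushforward// preimage_setT.
have mFg : measurable_fun setT (F \o ginv) by exact: measurableT_comp.
rewrite (ge0_integral_density mu mI (measurable_cst (1 : R)) one0 mFg (fun m => F0 (ginv m))).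
by apply: eq_integral => m Im; rewrite mule1 /ginv/= patchE Im.
Qed.

(** The hypothesis determines [e] exactly on [(-1, 1)], where [e m] is the value of [f] at
    [moebius_inv m]. The positive and negative parts are transformed separately; the weight is
    nonnegative and passes through the maximum with 0. *)
Lemma moebius_change f e n : measurable_fun Rplus f ->
  (forall l, 0 < l -> e (moebius l) = f l) ->
  \int[mu]_(m in `]-1, 1[) (e m * m ^+ n) =
  \int[mu]_(l in Rplus) (f l * moebius l ^+ n * moebius_weight l).
Proof.
move=> mf ef.
pose G l := f l * moebius l ^+ n.
have mG : measurable_fun setT (EFin \o (G \_ Rplus)).
  apply/measurable_EFinP; apply/(measurable_restrictT _ measurable_RplusR).
  by apply: measurable_funM => //; apply: measurable_funX; exact: measurable_moebius.
have Ginv m : I m -> (G \_ Rplus) (moebius_inv m) = e m * m ^+ n.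
  rewrite /I/= in_itv/= => m11; have p0 := moebius_inv_gt0 m11.
  rewrite patchE mem_set; last exact/RplusE.
  by rewrite /G -ef// moebius_invK// lt_eqF//; case/andP: m11.
rewrite /Rintegral integralE [in RHS]integralE; congr (fine (_ - _)%E).
  transitivity (\int[mu]_(m in I) (EFin \o (G \_ Rplus))^\+ (moebius_inv m))%E.
    by apply: eq_integral => m; rewrite inE => /Ginv h; rewrite !funeposE /= h.
  rewrite -ge0_moebius_change//; last exact: measurable_funepos.
  apply: eq_integral => l Rl; rewrite !funeposE /= patchE Rl /G.
  rewrite -EFin_max -EFin_max -EFinM; congr EFin.
  by rewrite maxr_pMl ?moebius_weight_ge0// mul0r.
transitivity (\int[mu]_(m in I) (EFin \o (G \_ Rplus))^\- (moebius_inv m))%E.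
  by apply: eq_integral => m; rewrite inE => /Ginv h; rewrite !funenegE /= h.
rewrite -ge0_moebius_change//; last exact: measurable_funeneg.
apply: eq_integral => l Rl; rewrite !funenegE /= patchE Rl /G.
rewrite -EFin_max -EFin_max -EFinM; congr EFin.
by rewrite maxr_pMl ?moebius_weight_ge0// mul0r mulNr.
Qed.

End MoebiusChangeOfVariables.

(** * Complex-valued functions through their real and imaginary parts *)

Section ComplexL2.
Context {R : realType}.
Local Notation C := R[i].
Local Notation mu := (@lebesgue_measure R).
Local Notation Rplus := (@Rplus R).
Local Notation L2r := (sqint mu Rplus).
Local Notation "'[ u , v ]" := (ip mu Rplus u v).
Implicit Types (u v w : R -> R) (f g F : R -> C) (z c : C).

Hint Resolve measurable_Rplus measurable_RplusR : core.
Let mR : measurable (Rplus : set (measurableTypeR R)) := measurable_Rplus.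

Lemma ReD z c : complex.Re (z + c) = complex.Re z + complex.Re c.
Proof. by case: z => a b; case: c. Qed.

Lemma ImD z c : complex.Im (z + c) = complex.Im z + complex.Im c.
Proof. by case: z => a b; case: c. Qed.

Lemma ReB z c : complex.Re (z - c) = complex.Re z - complex.Re c.
Proof. by case: z => a b; case: c. Qed.

Lemma ImB z c : complex.Im (z - c) = complex.Im z - complex.Im c.
Proof. by case: z => a b; case: c. Qed.

Lemma ReM z c : complex.Re (z * c) =
  complex.Re z * complex.Re c - complex.Im z * complex.Im c.
Proof. by case: z => a b; case: c. Qed.

Lemma ImM z c : complex.Im (z * c) =
  complex.Re z * complex.Im c + complex.Im z * complex.Re c.
Proof. by case: z => a b; case: c. Qed.

Lemma Re_conj z : complex.Re z^* = complex.Re z.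
Proof. by case: z. Qed.

Lemma Im_conj z : complex.Im z^* = - complex.Im z.
Proof. by case: z. Qed.

Definition ReImE := (ReD, ImD, ReB, ImB, ReM, ImM, Re_conj, Im_conj).

Lemma Re_sum (I : Type) (s : seq I) (E : I -> C) :
  complex.Re (\sum_(i <- s) E i) = \sum_(i <- s) complex.Re (E i).
Proof. by elim: s => [|i s ih]; rewrite ?big_nil// !big_cons ReD ih. Qed.

Lemma Im_sum (I : Type) (s : seq I) (E : I -> C) :
  complex.Im (\sum_(i <- s) E i) = \sum_(i <- s) complex.Im (E i).
Proof. by elim: s => [|i s ih]; rewrite ?big_nil// !big_cons ImD ih. Qed.

Lemma complex_ext z c : complex.Re z = complex.Re c ->
  complex.Im z = complex.Im c -> z = c.
Proof. by case: z => a b; case: c => a' b' /= -> ->. Qed.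

Lemma modulus_sqr z : modulus z ^+ 2 = complex.Re z ^+ 2 + complex.Im z ^+ 2.
Proof. by case: z => a b; rewrite /modulus/= sqr_sqrtr// addr_ge0 ?sqr_ge0. Qed.

Lemma modulus_ge0 z : 0 <= modulus z.
Proof. by case: z => a b; exact: sqrtr_ge0. Qed.

Lemma Re_le_modulus z : `|complex.Re z| <= modulus z.
Proof.
rewrite -(@ler_pXn2r _ 2)// ?nnegrE ?modulus_ge0// modulus_sqr real_normK ?num_real//.
by rewrite lerDl sqr_ge0.
Qed.

Lemma Im_le_modulus z : `|complex.Im z| <= modulus z.
Proof.
rewrite -(@ler_pXn2r _ 2)// ?nnegrE ?modulus_ge0// modulus_sqr real_normK ?num_real//.
by rewrite lerDr sqr_ge0.
Qed.

Lemma modulus_le z : modulus z <= `|complex.Re z| + `|complex.Im z|.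
Proof.
rewrite -(@ler_pXn2r _ 2)// ?nnegrE ?modulus_ge0 ?addr_ge0// modulus_sqr.
rewrite -(real_normK (num_real (complex.Re z))) -(real_normK (num_real (complex.Im z))).
by have := normr_ge0 (complex.Re z); have := normr_ge0 (complex.Im z); nra.
Qed.

Lemma cvg_modulus0 (z : nat -> C) :
  complex.Re (z n) @[n --> \oo] --> (0 : R) ->
  complex.Im (z n) @[n --> \oo] --> (0 : R) ->
  modulus (z n) @[n --> \oo] --> (0 : R).
Proof.
move=> z1 z2.
have z12 : `|complex.Re (z n)| + `|complex.Im (z n)| @[n --> \oo] --> (0 : R).
  by rewrite -[X in _ --> X](addr0 0); apply: cvgD; apply/norm_cvg0P.
apply: (@squeeze_cvgr _ _ _ _ (cst 0) _ _ _ _ _ z12); last exact: cvg_cst.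
by apply: nearW => n; rewrite modulus_ge0 modulus_le.
Qed.

Lemma L2P f : L2 f <-> L2r (re f) /\ L2r (im f).
Proof.
have E : (\int[mu]_(t in Rplus) (modulus (f t) ^+ 2)%:E =
    \int[mu]_(t in Rplus) ((re f t ^+ 2)%:E + (im f t ^+ 2)%:E))%E.
  by apply: eq_integral => t _; rewrite modulus_sqr.
split=> [[[m1 m2]]|[s1 s2]]; last first.
  split; first by split; [case: s1|case: s2].
  rewrite E ge0_integralD//.
  - by rewrite lte_add_pinfty//; [case: s1|case: s2].
  - by move=> t _; rewrite lee_fin sqr_ge0.
  - by apply/measurable_EFinP; apply: measurable_funX; case: s1.
  - by move=> t _; rewrite lee_fin sqr_ge0.
  - by apply/measurable_EFinP; apply: measurable_funX; case: s2.
rewrite E => fin; split; split => //; apply: le_lt_trans fin;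
  (apply: ge0_le_integral => //;
   [by move=> t _; rewrite lee_fin sqr_ge0
   |by apply/measurable_EFinP; exact: measurable_funX
   |by apply: emeasurable_funD; apply/measurable_EFinP; exact: measurable_funX
   |by move=> t _; rewrite -EFinD lee_fin ?lerDl ?lerDr sqr_ge0]).
Qed.

Lemma L2norm_sqr f : L2 f -> L2norm f ^+ 2 = '[re f, re f] + '[im f, im f].
Proof.
move=> /L2P[s1 s2]; rewrite sqr_sqrtr; last by apply: Rintegral_ge0 => t _; exact: sqr_ge0.
rewrite !ipxx -RintegralD//; try exact: sqint_integrable_sqr.
by apply: eq_Rintegral => t _; rewrite modulus_sqr.
Qed.

Lemma L2norm_ge0 f : 0 <= L2norm f.
Proof. exact: sqrtr_ge0. Qed.

Lemma L2inner_Re f g : L2 f -> L2 g ->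
  complex.Re (L2inner f g) = '[re f, re g] + '[im f, im g].
Proof.
move=> /L2P[f1 f2] /L2P[g1 g2]; rewrite /L2inner/cintegral/= /ip -RintegralD//;
  try exact: sqint_integrableM.
by apply: eq_Rintegral => t _; rewrite /re ReM Re_conj Im_conj mulrN opprK.
Qed.

Lemma L2inner_Im f g : L2 f -> L2 g ->
  complex.Im (L2inner f g) = '[im f, re g] - '[re f, im g].
Proof.
move=> /L2P[f1 f2] /L2P[g1 g2]; rewrite /L2inner/cintegral/= /ip -RintegralB//;
  try exact: sqint_integrableM.
by apply: eq_Rintegral => t _; rewrite /im ImM Re_conj Im_conj mulrN addrC.
Qed.

Lemma laplaceE F l : laplace F l = Complex (lap (re F) l) (lap (im F) l).
Proof.
by congr Complex; apply: eq_Rintegral => t _;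
  rewrite /re /im ?ReM ?ImM /= mul0r ?subr0 ?addr0.
Qed.

Lemma test_functionP f : test_function f <-> rtest (re f) /\ rtest (im f).
Proof.
split=> [[sf [x [y [x0 fxy]]]]|].
  split; split; [by split=> n t; case: (sf n t)| |by split=> n t; case: (sf n t)|];
    by exists x, y; split => // t /fxy; rewrite /re /im => ->.
move=> [[s1 [x1 [y1 [x10 f1]]]] [s2 [x2 [y2 [x20 f2]]]]]; split.
  by move=> n t; split; exact: rsmooth_derivable.
(* An interval containing both supports. *)
exists (Num.min x1 x2), (Num.max y1 y2); split; first by rewrite lt_min x10.
move=> t h; apply: complex_ext.
  apply: f1 => /andP[xt ty]; apply: h.
  by rewrite ge_min xt le_max ty.
apply: f2 => /andP[xt ty]; apply: h.
by rewrite ge_min xt le_max ty !orbT.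
Qed.

Lemma L2_test f : test_function f -> L2 f.
Proof. by move=> /test_functionP[t1 t2]; apply/L2P; split; exact: sqint_rtest. Qed.

Lemma continuous_itv_conv u v t : continuous u -> continuous v ->
  mu.-integrable `[0, t] (EFin \o (fun x => u x * v (t - x))).
Proof.
move=> cu cv; apply: continuous_itv_integrable => x; apply: cvgM; first exact: cu.
exact: continuous_comp_sub.
Qed.

Lemma re_conj_convolution f g : test_function f -> test_function g ->
  re (conj_convolution f g) =
  (fun t => rconv (re f) (re g) t + rconv (im f) (im g) t).
Proof.
move=> /test_functionP[/rtest_continuous f1 /rtest_continuous f2].
move=> /test_functionP[/rtest_continuous g1 /rtest_continuous g2].
apply/funext => t; rewrite /re/= /rconv -RintegralD//; last 2 first.
- exact: (continuous_itv_conv t f1 g1).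
- exact: (continuous_itv_conv t f2 g2).
by apply: eq_Rintegral => x _; rewrite /re ReM Re_conj Im_conj mulNr opprK.
Qed.

Lemma im_conj_convolution f g : test_function f -> test_function g ->
  im (conj_convolution f g) =
  (fun t => rconv (re f) (im g) t - rconv (im f) (re g) t).
Proof.
move=> /test_functionP[/rtest_continuous f1 /rtest_continuous f2].
move=> /test_functionP[/rtest_continuous g1 /rtest_continuous g2].
apply/funext => t; rewrite /im/= /rconv -RintegralB//; last 2 first.
- exact: (continuous_itv_conv t f1 g2).
- exact: (continuous_itv_conv t f2 g1).
by apply: eq_Rintegral => x _; rewrite /im ImM Re_conj Im_conj mulNr.
Qed.

Lemma rtestD u v : rtest u -> rtest v -> rtest (fun t => u t + v t).
Proof.
move=> [s1 [x1 [y1 [x10 f1]]]] [s2 [x2 [y2 [x20 f2]]]].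
split; first exact: rsmoothD.
exists (Num.min x1 x2), (Num.max y1 y2); split; first by rewrite lt_min x10.
move=> t h; rewrite f1 ?f2 ?addr0// => /andP[xt ty]; apply: h.
  by rewrite ge_min xt le_max ty !orbT.
by rewrite ge_min xt le_max ty.
Qed.

Lemma rtestN u : rtest u -> rtest (fun t => - u t).
Proof.
move=> [s1 [x1 [y1 [x10 f1]]]]; split.
  rewrite (_ : (fun _ => _) = (fun t => -1 * u t)).
    by apply: rsmoothM => //; exact: rsmooth_cst.
  by apply/funext => t; rewrite mulN1r.
by exists x1, y1; split => // t /f1 ->; rewrite oppr0.
Qed.

Lemma test_conj_convolution f g : test_function f -> test_function g ->
  test_function (conj_convolution f g).
Proof.
move=> tf tg; apply/test_functionP.
rewrite re_conj_convolution// im_conj_convolution//.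
move: tf tg => /test_functionP[f1 f2] /test_functionP[g1 g2]; split.
  by apply: rtestD; exact: rtest_rconv.
by apply: (rtestD _ (rtestN _)); exact: rtest_rconv.
Qed.

Lemma laplace_conj_convolution f g l : test_function f -> test_function g ->
  0 < l -> laplace (conj_convolution f g) l = (laplace f l)^* * laplace g l.
Proof.
move=> tf tg l0; rewrite !laplaceE re_conj_convolution// im_conj_convolution//.
move: tf tg => /test_functionP[f1 f2] /test_functionP[g1 g2].
rewrite lapD ?lapB//; try by apply: sqint_rtest; exact: rtest_rconv.
rewrite !lap_rconv//; apply: complex_ext; rewrite !ReImE/=; ring.
Qed.

End ComplexL2.

(** * The operator [L sigma L] and the form of the Hankel operator *)

Section SigmaOperator.
Context {R : realType}.
Local Notation C := R[i].
Local Notation mu := (@lebesgue_measure R).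
Local Notation Rplus := (@Rplus R).
Local Notation L2r := (sqint mu Rplus).
Local Notation "'[ u , v ]" := (ip mu Rplus u v).
Implicit Types (s u v w : R -> R) (f g F sigma : R -> C) (z c : C).

Hint Resolve measurable_Rplus measurable_RplusR : core.
Let mR : measurable (Rplus : set (measurableTypeR R)) := measurable_Rplus.

Definition ae_bounded (M : R) s :=
  measurable_fun Rplus s /\ {ae mu, forall t, Rplus t -> `|s t| <= M}.

Lemma ae_bounded_sqint_le M s u : ae_bounded M s -> L2r u ->
  (\int[mu]_(t in Rplus) ((s t * u t) ^+ 2)%:E <= (M ^+ 2 * '[u, u])%:E)%E.
Proof.
move=> [ms sM] su; have su' : L2r (fun t => M * u t) by exact: sqintZ.
have -> : M ^+ 2 * '[u, u] = '[fun t => M * u t, fun t => M * u t].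
  by rewrite ipZl// ipZr// mulrA expr2.
rewrite EFin_ipxx//; apply: ae_ge0_le_integral => //.
- by move=> t _; rewrite lee_fin sqr_ge0.
- apply/measurable_EFinP; apply: measurable_funX; apply: measurable_funM => //.
  by case: su.
- by move=> t _; rewrite lee_fin sqr_ge0.
- by apply/measurable_EFinP; apply: measurable_funX; case: su'.
- apply: (@filterS _ _ (ae_filter_ringOfSetsType mu) _ _ _ sM) => t h Rt.
  rewrite lee_fin !exprMn ler_wpM2r ?sqr_ge0//.
  by rewrite -(real_normK (num_real (s t))) lerXn2r ?nnegrE// ?h// (le_trans _ (h Rt)).
Qed.

Lemma sqint_ae_boundedM M s u : ae_bounded M s -> L2r u ->
  L2r (fun t => s t * u t).
Proof.
move=> bs su; split.
  by apply: measurable_funM; [case: bs|case: su].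
by rewrite (le_lt_trans (ae_bounded_sqint_le bs su))// ltry.
Qed.

Lemma ip_ae_boundedM_le M s u : ae_bounded M s -> L2r u ->
  '[fun t => s t * u t, fun t => s t * u t] <= M ^+ 2 * '[u, u].
Proof.
move=> bs su; rewrite -lee_fin EFin_ipxx//; first exact: ae_bounded_sqint_le.
exact: sqint_ae_boundedM bs su.
Qed.

Definition lapmul s u : R -> R := fun l => s l * lap u l.

Lemma sqint_lapmul M s u : ae_bounded M s -> L2r u -> L2r (lapmul s u).
Proof. by move=> bs su; apply: sqint_ae_boundedM bs _; exact: sqint_lap. Qed.

Lemma ip_lap_lapmul_le M s u : ae_bounded M s -> L2r u ->
  '[lap (lapmul s u), lap (lapmul s u)] <= (pi ^+ 2 * M) ^+ 2 * '[u, u].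
Proof.
move=> bs su; apply: le_trans (ip_lap_le (sqint_lapmul bs su)) _.
have -> : (pi ^+ 2 * M) ^+ 2 * '[u, u] = pi ^+ 2 * (M ^+ 2 * (pi ^+ 2 * '[u, u])).
  by ring.
rewrite ler_wpM2l ?sqr_ge0//.
apply: le_trans (ip_ae_boundedM_le bs (sqint_lap su)) _.
by rewrite ler_wpM2l ?sqr_ge0// ip_lap_le.
Qed.

Lemma lap_lin (a b : R) u v w l : L2r u -> L2r v -> L2r w -> 0 < l ->
  lap (fun t => a * u t + b * v t + w t) l = a * lap u l + b * lap v l + lap w l.
Proof.
move=> su sv sw l0; have [au bv] := (sqintZ mR a su, sqintZ mR b sv).
by rewrite (lapD (sqintD mR au bv))// (lapD au)// !lapZ.
Qed.

Lemma lap_lapmul_lin M s (a b : R) u v w l :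
  ae_bounded M s -> L2r u -> L2r v -> L2r w -> 0 < l ->
  lap (lapmul s (fun t => a * u t + b * v t + w t)) l =
  a * lap (lapmul s u) l + b * lap (lapmul s v) l + lap (lapmul s w) l.
Proof.
move=> bs su sv sw l0; rewrite -lap_lin//; try exact: sqint_lapmul bs _.
apply: eq_lap => x; rewrite inE => /RplusE x0.
rewrite /lapmul lap_lin//; ring.
Qed.

Lemma sqdist_le u v : L2r u -> L2r v -> sqdist u v <= 2 * ('[u, u] + '[v, v]).
Proof.
move=> su sv; have := ip_ge0 mu Rplus (fun t => u t + v t); rewrite /sqdist.
rewrite ipBl ?ipBr ?ipDl ?ipDr//; try exact: sqintB; try exact: sqintD.
by rewrite (ipC mu Rplus v u); lra.
Qed.

Lemma RintegralBD_ip u1 u2 u3 u4 v w :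
  L2r u1 -> L2r u2 -> L2r u3 -> L2r u4 -> L2r v -> L2r w ->
  \int[mu]_(t in Rplus) ((u1 t - u2 t) * v t + (u3 t + u4 t) * w t) =
  '[u1, v] - '[u2, v] + ('[u3, w] + '[u4, w]).
Proof.
move=> s1 s2 s3 s4 sv sw; have [s12 s34] := (sqintB mR s1 s2, sqintD mR s3 s4).
rewrite RintegralD//; last 2 first.
- exact: (sqint_integrableM mR s12 sv).
- exact: (sqint_integrableM mR s34 sw).
by rewrite -(ipBl mR s1 s2 sv) -(ipDl mR s3 s4 sw).
Qed.

(** [L sigma L f], with the product by [sigma] expanded into real and imaginary parts. *)
Definition sigma_operator sigma f : R -> C := fun t => Complex
  (lap (lapmul (re sigma) (re f)) t - lap (lapmul (im sigma) (im f)) t)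
  (lap (lapmul (im sigma) (re f)) t + lap (lapmul (re sigma) (im f)) t).

Definition sigma_form s u v := '[lapmul s u, lap v].

Lemma Linfty_ae_bounded sigma : Linfty sigma ->
  exists M, ae_bounded M (re sigma) /\ ae_bounded M (im sigma).
Proof.
move=> [[m1 m2] [M sM]]; exists M; split; split => //;
  apply: (@filterS _ _ (ae_filter_ringOfSetsType mu) _ _ _ sM) => t h /h;
  by apply: le_trans; rewrite ?Re_le_modulus ?Im_le_modulus.
Qed.

Lemma bounded_sigma_operator sigma : Linfty sigma ->
  bounded_operator (sigma_operator sigma).
Proof.
move=> /Linfty_ae_bounded[M [b1 b2]].
have Lf f : L2 f -> L2 (sigma_operator sigma f).
  move=> /L2P[f1 f2]; apply/L2P; split.
    apply: sqintB => //; apply: sqint_lap; [exact: sqint_lapmul b1 _|exact: sqint_lapmul b2 _].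
  apply: sqintD => //; apply: sqint_lap; [exact: sqint_lapmul b2 _|exact: sqint_lapmul b1 _].
split => //.
  move=> c f g /L2P[f1 f2] /L2P[g1 g2]; apply: aeW => t /RplusE t0.
  have reE : re (fun t => c * f t + g t) =
      (fun t => complex.Re c * re f t + (- complex.Im c) * im f t + re g t).
    by apply/funext => x; rewrite /re ReD ReM mulNr.
  have imE : im (fun t => c * f t + g t) =
      (fun t => complex.Im c * re f t + complex.Re c * im f t + im g t).
    by apply/funext => x; rewrite /im ImD ImM addrC [X in _ + X]addrC addrC.
  have E1 a b w (sw : L2r w) := lap_lapmul_lin a b b1 f1 f2 sw t0.
  have E2 a b w (sw : L2r w) := lap_lapmul_lin a b b2 f1 f2 sw t0.
  rewrite /sigma_operator reE imE.
  rewrite (E1 _ _ _ g1) (E2 _ _ _ g1) (E1 _ _ _ g2) (E2 _ _ _ g2).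
  do 8!move: (lap _ t) => ?.
  by case: c {reE imE} => c1 c2; apply: complex_ext => /=; ring.
(* Each of the four real terms has norm at most [pi^2 |M|] times that of a component of [f]; the two
   sums of two terms cost a factor 2 on the squares, and each component of [f] occurs twice. [M] is
   not known to be nonnegative, hence the absolute value. *)
exists (2 * (pi ^+ 2 * `|M|)) => f Hf; have [f1 f2] := (L2P f).1 Hf.
rewrite -(@ler_pXn2r _ 2)// ?nnegrE ?L2norm_ge0 ?mulr_ge0 ?pi_ge0 ?L2norm_ge0//.
rewrite exprMn !L2norm_sqr//; last exact: Lf.
have L1 u : L2r u -> L2r (lap (lapmul (re sigma) u)).
  by move=> su; apply: sqint_lap; exact: sqint_lapmul b1 _.
have L2_ u : L2r u -> L2r (lap (lapmul (im sigma) u)).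
  by move=> su; apply: sqint_lap; exact: sqint_lapmul b2 _.
rewrite -[in X in X + _ <= _]/(sqdist (lap (lapmul (re sigma) (re f)))
  (lap (lapmul (im sigma) (im f)))).
have d1 := sqdist_le (L1 _ f1) (L2_ _ f2).
have d2 := ipD_le mR (L2_ _ f1) (L1 _ f2).
apply: le_trans (lerD d1 d2) _ => {d1 d2}.
have -> : (2 * (pi ^+ 2 * `|M|)) ^+ 2 = 4 * (pi ^+ 2 * M) ^+ 2.
  rewrite mulrA exprMn real_normK ?num_real//; ring.
have E (a1 a2 a3 a4 B n1 n2 : R) : a1 <= B * n1 -> a2 <= B * n2 ->
    a3 <= B * n1 -> a4 <= B * n2 ->
    2 * (a1 + a2) + 2 * (a3 + a4) <= 4 * B * (n1 + n2) by lra.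
exact: (E _ _ _ _ _ _ _ (ip_lap_lapmul_le b1 f1) (ip_lap_lapmul_le b2 f2)
  (ip_lap_lapmul_le b2 f1) (ip_lap_lapmul_le b1 f2)).
Qed.

(** The functional sees the convolution only through its Laplace transform [conj (L f1) (L f2)]. The
    antilinear pairing conjugates once more and leaves the integral of [sigma (L f1) conj (L f2)],
    whose terms are grouped here as in [RintegralBD_ip]. *)
Lemma hankel_form (h s : (R -> C) -> C) sigma f1 f2 :
  is_sigma_function h s -> Linfty sigma -> represented_by s sigma ->
  test_function f1 -> test_function f2 ->
  h (conj_convolution f1 f2) = Complex
    (sigma_form (re sigma) (re f1) (re f2) - sigma_form (im sigma) (im f1) (re f2) +
     (sigma_form (im sigma) (re f1) (im f2) + sigma_form (re sigma) (im f1) (im f2)))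
    (sigma_form (im sigma) (im f1) (im f2) - sigma_form (re sigma) (re f1) (im f2) +
     (sigma_form (im sigma) (re f1) (re f2) + sigma_form (re sigma) (im f1) (re f2))).
Proof.
move=> [_ hs] /Linfty_ae_bounded[M [b1 b2]] ss t1 t2.
have t12 := test_conj_convolution t1 t2.
rewrite hs// ss; last by exists (conj_convolution f1 f2).
have /L2P[r1 i1] := L2_test t1; have /L2P[r2 i2] := L2_test t2.
have B1 u : L2r u -> L2r (lapmul (re sigma) u) by exact: sqint_lapmul b1.
have B2 u : L2r u -> L2r (lapmul (im sigma) u) by exact: sqint_lapmul b2.
rewrite /cintegral; congr Complex.
  rewrite -(RintegralBD_ip (B1 _ r1) (B2 _ i1) (B2 _ r1) (B1 _ i1)
    (sqint_lap r2) (sqint_lap i2)).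
  apply: eq_Rintegral => l; rewrite inE => /RplusE l0.
  rewrite /re laplace_conj_convolution// !laplaceE /lapmul.
  rewrite -[im sigma l]/(complex.Im (sigma l)).
  move: (sigma l) (lap _ _) (lap _ _) (lap _ _) (lap _ _) => [s1 s2] x1 x2 x3 x4 /=.
  ring.
rewrite -(RintegralBD_ip (B2 _ i1) (B1 _ r1) (B2 _ r1) (B1 _ i1)
  (sqint_lap i2) (sqint_lap r2)).
apply: eq_Rintegral => l; rewrite inE => /RplusE l0.
rewrite /im laplace_conj_convolution// !laplaceE /lapmul.
rewrite -[re sigma l]/(complex.Re (sigma l)).
move: (sigma l) (lap _ _) (lap _ _) (lap _ _) (lap _ _) => [s1 s2] x1 x2 x3 x4 /=.
ring.
Qed.

(** Symmetry of [L] moves the outer factor of [L sigma L] to the second argument of the inner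
    product, which gives the form of [hankel_form]. *)
Lemma hankel_sigma_operator (h s : (R -> C) -> C) sigma :
  is_sigma_function h s -> Linfty sigma -> represented_by s sigma ->
  is_hankel_operator h (sigma_operator sigma).
Proof.
move=> hs bs ss; have bK := bounded_sigma_operator bs; split => // f1 f2 t1 t2.
rewrite (hankel_form hs bs ss t1 t2).
move: bs => /Linfty_ae_bounded[M [b1 b2]].
have Lf1 := L2_test t1; have Lf2 := L2_test t2.
have LK : L2 (sigma_operator sigma f1) by case: bK => H _ _; exact: H.
have /L2P[r1 i1] := Lf1; have /L2P[r2 i2] := Lf2.
have B1 u : L2r u -> L2r (lapmul (re sigma) u) by exact: sqint_lapmul b1.
have B2 u : L2r u -> L2r (lapmul (im sigma) u) by exact: sqint_lapmul b2.
have ipT1 u v : L2r u -> L2r v ->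
    '[lap (lapmul (re sigma) u), v] = sigma_form (re sigma) u v.
  by move=> su sv; exact: (ip_lapC (B1 _ su) sv).
have ipT2 u v : L2r u -> L2r v ->
    '[lap (lapmul (im sigma) u), v] = sigma_form (im sigma) u v.
  by move=> su sv; exact: (ip_lapC (B2 _ su) sv).
apply: complex_ext; rewrite ?L2inner_Re ?L2inner_Im//=.
  apply: etrans (congr2 +%R (ipBl mR (sqint_lap (B1 _ r1)) (sqint_lap (B2 _ i1)) r2)
    (ipDl mR (sqint_lap (B2 _ r1)) (sqint_lap (B1 _ i1)) i2)) _.
  congr (_ - _ + (_ + _));
    [exact: ipT1 r1 r2|exact: ipT2 i1 r2|exact: ipT2 r1 i2|exact: ipT1 i1 i2].
apply: etrans (congr2 (fun a b => a - b)
  (ipDl mR (sqint_lap (B2 _ r1)) (sqint_lap (B1 _ i1)) r2)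
  (ipBl mR (sqint_lap (B1 _ r1)) (sqint_lap (B2 _ i1)) i2)) _.
rewrite opprB addrC; congr (_ - _ + (_ + _));
  [exact: ipT2 i1 i2|exact: ipT1 r1 i2|exact: ipT2 r1 r2|exact: ipT1 i1 r2].
Qed.

End SigmaOperator.

(** * The unitary operator [U0] and its inverse *)

Section U0.
Context {R : realType}.
Local Notation C := R[i].
Local Notation mu := (@lebesgue_measure R).
Local Notation Rplus := (@Rplus R).
Local Notation L2r := (sqint mu Rplus).
Local Notation "'[ u , v ]" := (ip mu Rplus u v).
Implicit Types (u v w : R -> R) (f F : R -> C) (g : nat -> C).

Hint Resolve measurable_Rplus measurable_RplusR : core.
Let mR : measurable (Rplus : set (measurableTypeR R)) := measurable_Rplus.

Local Notation Reg g := (fun n => complex.Re (g n)).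
Local Notation Img g := (fun n => complex.Im (g n)).

Lemma laguerre_sumE g N t : 0 < t ->
  laguerre_sum g N t = Complex (lagsum (Reg g) N t) (lagsum (Img g) N t).
Proof.
move=> t0; rewrite /laguerre_sum big_mkord; apply: complex_ext.
  rewrite Re_sum; apply: eq_bigr => n _.
  by rewrite ReM /= mulr0 subr0 laguerre0E.
rewrite Im_sum; apply: eq_bigr => n _.
by rewrite ImM /= mulr0 add0r laguerre0E.
Qed.

Lemma re_sub_laguerre_sum f g N :
  {in Rplus, (fun t => re f t - lagsum (Reg g) N t) =1
             re (fun t => f t - laguerre_sum g N t)}.
Proof. by move=> t; rewrite inE => /RplusE t0; rewrite /re ReB laguerre_sumE. Qed.

Lemma im_sub_laguerre_sum f g N :
  {in Rplus, (fun t => im f t - lagsum (Img g) N t) =1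
             im (fun t => f t - laguerre_sum g N t)}.
Proof. by move=> t; rewrite inE => /RplusE t0; rewrite /im ImB laguerre_sumE. Qed.

Lemma L2_sub_laguerre_sum f g N : L2 f -> L2 (fun t => f t - laguerre_sum g N t).
Proof.
move=> /L2P[f1 f2]; apply/L2P; split.
  apply: (eq_sqint mR (re_sub_laguerre_sum f g N)).
  exact: (sqintB mR f1 (sqint_lagsum (Reg g) N)).
apply: (eq_sqint mR (im_sub_laguerre_sum f g N)).
exact: (sqintB mR f2 (sqint_lagsum (Img g) N)).
Qed.

Lemma L2norm_sub_laguerre_sum f g N : L2 f ->
  L2norm (fun t => f t - laguerre_sum g N t) ^+ 2 =
  sqdist (re f) (lagsum (Reg g) N) + sqdist (im f) (lagsum (Img g) N).
Proof.
move=> Lf; rewrite (L2norm_sqr (L2_sub_laguerre_sum g N Lf)).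
congr (_ + _); apply/esym/eq_ip.
- exact: re_sub_laguerre_sum.
- exact: re_sub_laguerre_sum.
- exact: im_sub_laguerre_sum.
- exact: im_sub_laguerre_sum.
Qed.

Lemma is_U0P g f : is_U0 g f <-> [/\ L2 f,
  sqdist (re f) (lagsum (Reg g) N) @[N --> \oo] --> (0 : R) &
  sqdist (im f) (lagsum (Img g) N) @[N --> \oo] --> (0 : R)].
Proof.
split=> [[Lf fg]|[Lf d1 d2]].
  have d : L2norm (fun t => f t - laguerre_sum g N t) ^+ 2 @[N --> \oo] --> (0 : R).
    by rewrite -[X in _ --> X](mul0r 0); apply: cvgM.
  split => //; apply: (@squeeze_cvgr _ _ _ _ (cst 0) _ _ _ _ _ d);
    try exact: cvg_cst; apply: nearW => N;
    by rewrite L2norm_sub_laguerre_sum// sqdist_ge0 ?lerDl ?lerDr sqdist_ge0.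
split => //.
rewrite (_ : (fun N => _) = (fun N => Num.sqrt (sqdist (re f) (lagsum (Reg g) N) +
    sqdist (im f) (lagsum (Img g) N)))); last first.
  by apply/funext => N; rewrite -L2norm_sub_laguerre_sum// sqrtr_sqr ger0_norm ?L2norm_ge0.
rewrite -[X in _ --> X]sqrtr0; apply: continuous_cvg; first exact: sqrt_continuous.
by rewrite -[X in _ --> X](addr0 0); apply: cvgD.
Qed.

Lemma is_U0_coef g f n : is_U0 g f ->
  complex.Re (g n) = '[re f, lagfun n] /\ complex.Im (g n) = '[im f, lagfun n].
Proof.
move=> /is_U0P[/L2P[f1 f2] d1 d2]; split.
  exact: (lagsum_coef n f1 d1).
exact: (lagsum_coef n f2 d2).
Qed.

Lemma ell2P g : ell2 g <->
  cvgn (fun N => \sum_(n < N) complex.Re (g n) ^+ 2) /\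
  cvgn (fun N => \sum_(n < N) complex.Im (g n) ^+ 2).
Proof.
have E N : (\sum_(0 <= n < N) (modulus (g n) ^+ 2)%:E)%E =
    (\sum_(n < N) complex.Re (g n) ^+ 2 + \sum_(n < N) complex.Im (g n) ^+ 2)%:E.
  rewrite -big_split/= sumEFin big_mkord; congr EFin.
  by apply: eq_bigr => n _; rewrite modulus_sqr.
have g0 n : (0%N <= n)%N -> true -> (0 <= (modulus (g n) ^+ 2)%:E)%E.
  by move=> _ _; rewrite lee_fin sqr_ge0.
split=> [fin|[/cvg_ex[/= a ca] /cvg_ex[/= b cb]]].
  have fing : (\sum_(0 <= n <oo) ((modulus (g n)) ^+ 2)%:E)%E \is a fin_num.
    by rewrite ge0_fin_numE// nneseries_ge0.
  have ub N : \sum_(n < N) complex.Re (g n) ^+ 2 + \sum_(n < N) complex.Im (g n) ^+ 2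
      <= fine (\sum_(0 <= n <oo) ((modulus (g n)) ^+ 2)%:E)%E.
    by rewrite -lee_fin fineK// -E; apply: nneseries_lim_ge.
  split; apply: nondecreasing_is_cvgn.
  - by apply/nondecreasing_seqP => N; rewrite big_ord_recr/= lerDl sqr_ge0.
  - exists (fine (\sum_(0 <= n <oo) ((modulus (g n)) ^+ 2)%:E)%E) => _ [N _ <-].
    by apply: le_trans (ub N); rewrite lerDl sumr_ge0// => n _; exact: sqr_ge0.
  - by apply/nondecreasing_seqP => N; rewrite big_ord_recr/= lerDl sqr_ge0.
  - exists (fine (\sum_(0 <= n <oo) ((modulus (g n)) ^+ 2)%:E)%E) => _ [N _ <-].
    by apply: le_trans (ub N); rewrite lerDr sumr_ge0// => n _; exact: sqr_ge0.
rewrite /ell2 (_ : limn _ = (a + b)%:E) ?ltry//; apply/cvg_lim => //.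
rewrite (_ : (fun N => _) = (fun N => (\sum_(n < N) complex.Re (g n) ^+ 2 +
  \sum_(n < N) complex.Im (g n) ^+ 2)%:E)); last by apply/funext.
by apply: cvg_EFin; [exact: nearW|exact: cvgD].
Qed.

(** Square summability makes the Laguerre series of both components converge, so the choice in [U0]
    is made from a nonempty set and not replaced by its default value. *)
Lemma U0P g : ell2 g -> is_U0 g (U0 g).
Proof.
move=> /ell2P[c1 c2].
have [u su ud] := @lagsum_cvg _ (Reg g) c1.
have [v sv vd] := @lagsum_cvg _ (Img g) c2.
apply: (@xgetPex _ (fun=> 0) [set f : R -> C | is_U0 g f]).
by exists (fun t => Complex (u t) (v t)); apply/is_U0P; split => //; apply/L2P.
Qed.

(** Completeness: orthogonality to all Laguerre functions forces the Laplace transform of [u - v] to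
    vanish, and [L] is injective. *)
Lemma lagfun_separates u v : L2r u -> L2r v ->
  (forall n, '[u, lagfun n] = '[v, lagfun n]) ->
  {ae mu, forall t, Rplus t -> u t = v t}.
Proof.
move=> su sv uv; have suv := sqintB mR su sv.
have h : {ae mu, forall t, Rplus t -> u t - v t = 0}.
  apply: lap_inj => // l l0; apply: lagfun_orthogonal_lap => // n.
  by rewrite (ipBl mR su sv (sqint_lagfun n)) uv subrr.
apply: (@filterS _ _ (ae_filter_ringOfSetsType mu) _ _ _ h) => t /[apply] /eqP.
by rewrite subr_eq0 => /eqP.
Qed.

(** The witness is the sequence of Laguerre coefficients of [F]. It is square summable by Bessel's
    inequality, and [U0] maps it to a function with the same coefficients, hence to [F] almost
    everywhere. *)
Lemma U0invP F : L2 F -> ell2 (U0inv F) /\ L2eq (U0 (U0inv F)) F.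
Proof.
move=> /L2P[F1 F2].
apply: (@xgetPex _ (fun=> 0) [set g : nat -> C | ell2 g /\ L2eq (U0 g) F]).
pose g n : C := Complex '[re F, lagfun n] '[im F, lagfun n].
have g2 : ell2 g by apply/ell2P; split; exact: cvg_lag_bessel.
exists g; split => //.
have gU := U0P g2; have [/L2P[U1 U2] _] := gU.
have e1 : {ae mu, forall t, Rplus t -> re (U0 g) t = re F t}.
  by apply: lagfun_separates => // n; have [<-] := is_U0_coef n gU.
have e2 : {ae mu, forall t, Rplus t -> im (U0 g) t = im F t}.
  by apply: lagfun_separates => // n; have [_ <-] := is_U0_coef n gU.
apply: (@filterS2 _ _ (ae_filter_ringOfSetsType mu) _ _ _ _ e1 e2) => t r i Rt.
by apply: complex_ext; [exact: r|exact: i].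
Qed.

(** Whichever sequence the choice returns, its terms are the coefficients of its image under [U0],
    which is [F] almost everywhere. *)
Lemma U0inv_coef F n : L2 F ->
  U0inv F n = Complex '[re F, lagfun n] '[im F, lagfun n].
Proof.
move=> LF; have [g2 UF] := U0invP LF; have gU := U0P g2.
have [c1 c2] := is_U0_coef n gU; have [/L2P[U1 U2] _] := gU.
have /L2P[F1 F2] := LF; apply: complex_ext => /=.
  rewrite c1; apply: (ae_eq_ip mR U1 F1 (sqint_lagfun n)).
  by apply: (@filterS _ _ (ae_filter_ringOfSetsType mu) _ _ _ UF) => t h /h; rewrite /re => ->.
rewrite c2; apply: (ae_eq_ip mR U2 F2 (sqint_lagfun n)).
by apply: (@filterS _ _ (ae_filter_ringOfSetsType mu) _ _ _ UF) => t h /h; rewrite /im => ->.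
Qed.

End U0.

(** * Bounded operators that are linear up to null sets *)

Section BoundedOperators.
Context {R : realType}.
Local Notation C := R[i].
Local Notation mu := (@lebesgue_measure R).
Local Notation Rplus := (@Rplus R).
Local Notation L2r := (sqint mu Rplus).
Local Notation "'[ u , v ]" := (ip mu Rplus u v).
Implicit Types (u v w : R -> R) (f F : R -> C) (H : (R -> C) -> R -> C).

Hint Resolve measurable_Rplus measurable_RplusR : core.
Let mR : measurable (Rplus : set (measurableTypeR R)) := measurable_Rplus.

Lemma bounded_operator_sqdist H : bounded_operator H -> exists B : R,
  forall f g, L2 f -> L2 g ->
    sqdist (re (H f)) (re (H g)) + sqdist (im (H f)) (im (H g)) <=
    B * (sqdist (re f) (re g) + sqdist (im f) (im g)).
Proof.
move=> [HL Hlin [M HM]]; exists (M ^+ 2) => f g Lf Lg.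
pose d t := f t - g t.
have red : re d = (fun t => re f t - re g t) by apply/funext => t; rewrite /re ReB.
have imd : im d = (fun t => im f t - im g t) by apply/funext => t; rewrite /im ImB.
have [f1 f2] := (L2P f).1 Lf; have [g1 g2] := (L2P g).1 Lg.
have Ld : L2 d.
  by apply/L2P; rewrite red imd; split; [exact: (sqintB mR f1 g1)|exact: (sqintB mR f2 g2)].
(* Linearity is available for [c f + g]: writing [f] as [1 * d + g] makes [H f - H g] equal to [H d]
   almost everywhere, which the inner products do not distinguish. *)
have := Hlin 1 d g Ld Lg.
rewrite (_ : (fun t => 1 * d t + g t) = f); last by apply/funext => t; rewrite mul1r subrK.
move=> fdg.
have [hf1 hf2] := (L2P _).1 (HL f Lf); have [hg1 hg2] := (L2P _).1 (HL g Lg).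
have [hd1 hd2] := (L2P _).1 (HL d Ld).
have -> : sqdist (re (H f)) (re (H g)) = '[re (H d), re (H d)].
  apply: (ae_eq_ipxx mR (sqintB mR hf1 hg1) hd1).
  apply: (@filterS _ _ (ae_filter_ringOfSetsType mu) _ _ _ fdg) => t h /h e.
  by rewrite /re e mul1r ReD addrK.
have -> : sqdist (im (H f)) (im (H g)) = '[im (H d), im (H d)].
  apply: (ae_eq_ipxx mR (sqintB mR hf2 hg2) hd2).
  apply: (@filterS _ _ (ae_filter_ringOfSetsType mu) _ _ _ fdg) => t h /h e.
  by rewrite /im e mul1r ImD addrK.
rewrite -(L2norm_sqr (HL d Ld)) /sqdist -red -imd -(L2norm_sqr Ld) -exprMn.
have h := HM d Ld.
by apply: lerXn2r => //; rewrite nnegrE ?L2norm_ge0// (le_trans _ h)// L2norm_ge0.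
Qed.

Lemma bounded_operator_cvg H f (fn : nat -> R -> C) : bounded_operator H ->
  L2 f -> (forall n, L2 (fn n)) ->
  sqdist (re f) (re (fn n)) @[n --> \oo] --> (0 : R) ->
  sqdist (im f) (im (fn n)) @[n --> \oo] --> (0 : R) ->
  forall w, L2r w ->
    '[re (H (fn n)), w] @[n --> \oo] --> '[re (H f), w] /\
    '[im (H (fn n)), w] @[n --> \oo] --> '[im (H f), w].
Proof.
move=> bH Lf Lfn d1 d2 w sw; have [B HB] := bounded_operator_sqdist bH.
have [HL _ _] := bH.
have d : B * (sqdist (re f) (re (fn n)) + sqdist (im f) (im (fn n)))
    @[n --> \oo] --> (0 : R).
  rewrite -[X in _ --> X](mulr0 B); apply: cvgM; first exact: cvg_cst.
  by rewrite -[X in _ --> X](addr0 0); apply: cvgD.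
have [h1 h2] := (L2P _).1 (HL f Lf).
have hn n := (L2P _).1 (HL _ (Lfn n)).
split; apply: cvg_ip => //.
- by move=> n; case: (hn n).
- apply: (@squeeze_cvgr _ _ _ _ (cst 0) _ _ _ _ _ d); last exact: cvg_cst.
  apply: nearW => n; rewrite sqdist_ge0/=.
  by apply: le_trans (HB _ _ Lf (Lfn n)); rewrite lerDl sqdist_ge0.
- by move=> n; case: (hn n).
- apply: (@squeeze_cvgr _ _ _ _ (cst 0) _ _ _ _ _ d); last exact: cvg_cst.
  apply: nearW => n; rewrite sqdist_ge0/=.
  by apply: le_trans (HB _ _ Lf (Lfn n)); rewrite lerDr sqdist_ge0.
Qed.

(** A coefficient depends only on the class of [F]; through it the almost everywhere linearity of
    [H] becomes an exact identity. *)
Definition lagcoord F n : C := Complex '[re F, lagfun n] '[im F, lagfun n].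

Lemma lagcoord_lin H (c : C) f g n : bounded_operator H -> L2 f -> L2 g ->
  lagcoord (H (fun t => c * f t + g t)) n =
  c * lagcoord (H f) n + lagcoord (H g) n.
Proof.
move=> [HL Hlin _] Lf Lg; have L := Hlin c f g Lf Lg.
have [f1 f2] := (L2P _).1 (HL f Lf); have [g1 g2] := (L2P _).1 (HL g Lg).
have sn := @sqint_lagfun R n.
have Lr (a b : R) := sqintB mR (sqintZ mR a f1) (sqintZ mR b f2).
have Li (a b : R) := sqintD mR (sqintZ mR a f2) (sqintZ mR b f1).
have [h1 h2] : L2r (re (H (fun t => c * f t + g t))) /\
    L2r (im (H (fun t => c * f t + g t))).
  apply: (L2P _).1; apply: HL; apply/L2P.
  have [ff1 ff2] := (L2P _).1 Lf; have [gg1 gg2] := (L2P _).1 Lg; split.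
    rewrite (_ : re _ = (fun t => complex.Re c * re f t - complex.Im c * im f t + re g t)).
      exact: (sqintD mR (sqintB mR (sqintZ mR _ ff1) (sqintZ mR _ ff2)) gg1).
    by apply/funext => t; rewrite /re ReD ReM.
  rewrite (_ : im _ = (fun t => complex.Re c * im f t + complex.Im c * re f t + im g t)).
    exact: (sqintD mR (sqintD mR (sqintZ mR _ ff2) (sqintZ mR _ ff1)) gg2).
  by apply/funext => t; rewrite /im ImD ImM.
apply: complex_ext; rewrite ?ReD ?ReM ?ImD ?ImM /lagcoord /=.
  rewrite (ae_eq_ip mR h1 (sqintD mR (Lr (complex.Re c) (complex.Im c)) g1) sn).
    rewrite (ipDl mR (Lr _ _) g1 sn) (ipBl mR (sqintZ mR _ f1) (sqintZ mR _ f2) sn).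
    by rewrite (ipZl mR _ f1 sn) (ipZl mR _ f2 sn).
  apply: (@filterS _ _ (ae_filter_ringOfSetsType mu) _ _ _ L) => t h /h e.
  by rewrite /re e ReD ReM.
rewrite (ae_eq_ip mR h2 (sqintD mR (Li (complex.Re c) (complex.Im c)) g2) sn).
  rewrite (ipDl mR (Li _ _) g2 sn) (ipDl mR (sqintZ mR _ f2) (sqintZ mR _ f1) sn).
  by rewrite (ipZl mR _ f2 sn) (ipZl mR _ f1 sn).
apply: (@filterS _ _ (ae_filter_ringOfSetsType mu) _ _ _ L) => t h /h e.
by rewrite /im e ImD ImM.
Qed.

End BoundedOperators.

(** * The matrix of the Hankel operator in the Laguerre basis *)

Section HankelMatrix.
Context {R : realType}.
Local Notation C := R[i].
Local Notation mu := (@lebesgue_measure R).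
Local Notation Rplus := (@Rplus R).
Local Notation L2r := (sqint mu Rplus).
Local Notation "'[ u , v ]" := (ip mu Rplus u v).
Implicit Types (u v w : R -> R) (f F : R -> C) (H : (R -> C) -> R -> C).

Hint Resolve measurable_Rplus measurable_RplusR : core.
Let mR : measurable (Rplus : set (measurableTypeR R)) := measurable_Rplus.

Lemma sqdist_cutoff u : L2r u ->
  sqdist u (fun t => cutoff k t * u t) @[k --> \oo] --> (0 : R).
Proof.
move=> su; have [mu_ _] := su.
have mc k : measurable_fun Rplus (cutoff k : R -> R).
  apply: measurable_funTS; apply: continuous_measurable_fun.
  exact/rsmooth_continuous/rsmooth_cutoff.
rewrite /sqdist /ip.
rewrite (_ : 0 = \int[mu]_(t in Rplus) 0); last by rewrite /Rintegral integral0.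
apply: (Rdominated_convergence (mu := mu) mR (g := fun t => u t ^+ 2)).
- move=> k; have m : measurable_fun Rplus (fun t => u t - cutoff k t * u t).
    by apply: measurable_funB => //; exact: measurable_funM.
  exact: measurable_funM.
- exact: measurable_cst.
- apply: aeW => t /RplusE t0.
  rewrite -[X in _ --> X](mul0r 0).
  have h : u t - cutoff k t * u t @[k --> \oo] --> (0 : R).
    rewrite -[X in _ --> X](subrr (1 * u t)); apply: cvgB.
      by rewrite mul1r; exact: cvg_cst.
    by apply: cvgM; [exact: cvg_cutoff|exact: cvg_cst].
  exact: cvgM.
- exact: (sqint_integrable_sqr mR su).
- move=> k t _; rewrite -expr2 ger0_norm ?sqr_ge0//.
  have E (c x : R) : 0 <= c -> c <= 1 -> (x - c * x) ^+ 2 <= x ^+ 2.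
    move=> c0 c1; have c2 : 0 <= 2 - c by lra.
    by have := mulr_ge0 (sqr_ge0 x) (mulr_ge0 c0 c2); lra.
  by apply: E; [exact: cutoff_ge0|exact: cutoff_le1].
Qed.

Lemma eq_cvg_unique (a b : nat -> R) (x y : R) : a =1 b ->
  a @ \oo --> x -> b @ \oo --> y -> x = y.
Proof. by move=> /funext <- ax ay; exact: (cvg_unique _ ax ay). Qed.

(** The basis functions are real, so the matrix elements only involve [H] on real functions, where
    six of the eight forms vanish. *)
Definition ofr u : R -> C := fun t => Complex (u t) 0.

Lemma L2_ofr u : L2r u -> L2 (ofr u).
Proof. by move=> su; apply/L2P; split => //; exact: sqint0. Qed.

Lemma test_ofr u : rtest u -> test_function (ofr u).
Proof.
move=> tu; apply/test_functionP; split => //; split; first exact: rsmooth_cst.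
by exists 1, 1; split.
Qed.

(** Written this way, the form depends on [u] through an inner product with a fixed square
    integrable function, hence continuously. *)
Lemma sigma_form_ipr M s u v : ae_bounded M s -> L2r u -> L2r v ->
  sigma_form s u v = '[u, lap (lapmul s v)].
Proof.
move=> bs su sv; rewrite -(ip_lapC su (sqint_lapmul bs sv)).
by apply: eq_Rintegral => l _; rewrite /lapmul mulrCA mulrA.
Qed.

Lemma lap0 l : lap (fun=> 0) l = 0 :> R.
Proof.
rewrite /lap (@eq_Rintegral _ _ _ _ _ (cst 0)) => [|t _]; last by rewrite mulr0.
by rewrite /Rintegral integral0.
Qed.

Lemma sigma_form0l s v : sigma_form s (fun=> 0) v = 0 :> R.
Proof.
rewrite /sigma_form (_ : lapmul _ _ = fun=> 0) ?ip0l//.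
by apply/funext => l; rewrite /lapmul lap0 mulr0.
Qed.

Lemma sigma_form0r s v : sigma_form s v (fun=> 0) = 0 :> R.
Proof.
rewrite /sigma_form (_ : lap _ = fun=> 0); first by rewrite ipC ip0l.
by apply/funext => l; exact: lap0.
Qed.

Variables (h s : (R -> C) -> C) (sigma : R -> C) (H : (R -> C) -> R -> C).
Hypotheses (hs : is_sigma_function h s) (bs : Linfty sigma).
Hypotheses (ss : represented_by s sigma) (hH : is_hankel_operator h H).

Lemma hankel_ofr_rtest u v : rtest u -> rtest v ->
  '[re (H (ofr u)), v] = sigma_form (re sigma) u v /\
  '[im (H (ofr u)), v] = sigma_form (im sigma) u v.
Proof.
move=> tu tv; have [[HL _ _] form] := hH.
have Tu := test_ofr tu; have Tv := test_ofr tv.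
have := form _ _ Tu Tv; rewrite (hankel_form hs bs ss Tu Tv) => E.
have LH := HL _ (L2_test Tu); have Lv := L2_test Tv.
have z : im (ofr u) = fun=> 0 by [].
have z' : im (ofr v) = fun=> 0 by [].
have := congr1 (@complex.Re _) E; have := congr1 (@complex.Im _) E.
rewrite (L2inner_Re LH Lv) (L2inner_Im LH Lv) z z' /= !sigma_form0l !sigma_form0r.
rewrite (ipC mu Rplus (re _)) (ipC mu Rplus (im _) (fun=> 0)) !ip0l.
by rewrite !(subr0, addr0, add0r) => <- <-.
Qed.

(** Cutoffs are inserted in one argument at a time. In [u], against a test function, the limit uses
    the boundedness of [H]; in [v], with [u] already general, only the continuity of the inner
    product. *)
Lemma hankel_ofr_smooth u v : L2r u -> rsmooth u -> L2r v -> rsmooth v ->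
  '[re (H (ofr u)), v] = sigma_form (re sigma) u v /\
  '[im (H (ofr u)), v] = sigma_form (im sigma) u v.
Proof.
move=> su smu sv smv; have [bH _] := hH; have [HL _ _] := bH.
have [M [b1 b2]] := Linfty_ae_bounded bs.
have t_ k w : rsmooth w -> rtest (fun t => cutoff k t * w t) by exact: rtest_cutoff.
have st k w : rsmooth w -> L2r (fun t => cutoff k t * w t).
  by move=> sw; apply: sqint_rtest; exact: t_.
have H1 w : rtest w -> '[re (H (ofr u)), w] = sigma_form (re sigma) u w /\
    '[im (H (ofr u)), w] = sigma_form (im sigma) u w.
  move=> tw; have sw := sqint_rtest tw.
  have d2 : sqdist (im (ofr u)) (im (ofr (fun t => cutoff k t * u t)))
      @[k --> \oo] --> (0 : R).
    rewrite (_ : (fun k => _) = fun=> 0); first exact: cvg_cst.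
    apply/funext => k; rewrite -[RHS](ip0l mu Rplus (fun=> 0)).
    by apply: eq_ip => t _; rewrite /im/= subr0.
  have [c1 c2] := bounded_operator_cvg bH (L2_ofr su)
    (fun k => L2_ofr (st k u smu)) (sqdist_cutoff su) d2 sw.
  rewrite (sigma_form_ipr b1 su sw) (sigma_form_ipr b2 su sw).
  have e1 := cvg_ip (fun k => st k u smu) su (sqint_lap (sqint_lapmul b1 sw))
    (sqdist_cutoff su).
  have e2 := cvg_ip (fun k => st k u smu) su (sqint_lap (sqint_lapmul b2 sw))
    (sqdist_cutoff su).
  split.
    apply: eq_cvg_unique c1 e1 => k.
    have [-> _] := hankel_ofr_rtest (t_ k u smu) tw.
    exact: (sigma_form_ipr b1 (st k u smu) sw).
  apply: eq_cvg_unique c2 e2 => k.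
  have [_ ->] := hankel_ofr_rtest (t_ k u smu) tw.
  exact: (sigma_form_ipr b2 (st k u smu) sw).
have [h1 h2] := (L2P _).1 (HL _ (L2_ofr su)).
(* Passage to the limit in the second argument: products with test functions determine the product
   with [v]. *)
have ext w w' : L2r w -> L2r w' ->
    (forall a, rtest a -> '[w, a] = '[w', a]) -> '[w, v] = '[w', v].
  move=> sw sw' ww'; rewrite (ipC mu Rplus w) (ipC mu Rplus w').
  have e := cvg_ip (fun k => st k v smv) sv sw (sqdist_cutoff sv).
  have e' := cvg_ip (fun k => st k v smv) sv sw' (sqdist_cutoff sv).
  apply: eq_cvg_unique e e' => k.
  by rewrite (ipC mu Rplus _ w) (ipC mu Rplus _ w'); apply: ww'; exact: t_.
have lapC s' w : ae_bounded M s' -> L2r w ->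
    sigma_form s' u w = '[lap (lapmul s' u), w].
  by move=> b sw; rewrite -[LHS](ip_lapC (sqint_lapmul b su) sw).
split.
  rewrite (lapC _ _ b1 sv); apply: ext => //.
    exact: sqint_lap (sqint_lapmul b1 su).
  by move=> a ta; have [-> _] := H1 a ta; exact: lapC b1 (sqint_rtest ta).
rewrite (lapC _ _ b2 sv); apply: ext => //.
  exact: sqint_lap (sqint_lapmul b2 su).
by move=> a ta; have [_ ->] := H1 a ta; exact: lapC b2 (sqint_rtest ta).
Qed.

(** The two transforms multiply to [(l - 1/2)^(n+m) / (l + 1/2)^(n+m+2)]: the power [n + m] of
    [moebius l], and the two remaining factors of the denominator are the Jacobian. *)
Lemma sigma_form_lagfun (e t : R -> R) n m : measurable_fun Rplus t ->
  (forall l, 0 < l -> e (moebius l) = t l) ->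
  sigma_form t (lagfun m) (lagfun n) =
  \int[mu]_(x in `]-1, 1[) (e x * x ^+ (n + m)).
Proof.
move=> mt et; rewrite (moebius_change (n + m) mt et).
apply: eq_Rintegral_Rplus => l l0; rewrite /lapmul !lap_lagfun//.
rewrite /moebius /moebius_weight expr_div_n !exprD !exprS expr0.
have : l + 2^-1 != 0 by rewrite gt_eqF// addr_gt0// invr_gt0.
move: (l + 2^-1) (l - 2^-1) => a b a0; field.
by rewrite a0 !expf_neq0.
Qed.

End HankelMatrix.

Section MatrixElements.
Context {R : realType}.
Local Notation C := R[i].
Local Notation mu := (@lebesgue_measure R).
Local Notation Rplus := (@Rplus R).
Local Notation L2r := (sqint mu Rplus).
Local Notation "'[ u , v ]" := (ip mu Rplus u v).

Hint Resolve measurable_Rplus measurable_RplusR : core.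
Let mR : measurable (Rplus : set (measurableTypeR R)) := measurable_Rplus.

Variables (h s : (R -> C) -> C) (sigma eta : R -> C) (q : nat -> C).
Variable H : (R -> C) -> R -> C.
Hypotheses (hs : is_sigma_function h s) (bs : Linfty sigma).
Hypotheses (ss : represented_by s sigma) (hH : is_hankel_operator h H).
Hypothesis eta_def : forall l : R, 0 < l ->
  eta ((l - 1 / 2) / (l + 1 / 2)) = sigma l.
Hypothesis q_def : forall n : nat, q n =
  cintegral `]-1, 1[ (fun m : R => eta m * ofreal (m ^+ n)).

Lemma lagcoord_hankel_lagfun n m :
  lagcoord (H (ofr (lagfun m))) n = q (n + m)%N.
Proof.
have [M [[m1 _] [m2 _]]] := Linfty_ae_bounded bs.
have etaE l : 0 < l -> eta (moebius l) = sigma l.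
  by move=> l0; rewrite -eta_def// /moebius div1r.
have [e1 e2] := hankel_ofr_smooth hs bs ss hH (sqint_lagfun m) (rsmooth_lagfun m)
  (sqint_lagfun n) (rsmooth_lagfun n).
rewrite q_def /lagcoord /cintegral e1 e2.
rewrite (@sigma_form_lagfun _ (re eta) _ _ _ m1); last by move=> l l0; rewrite /re etaE.
rewrite (@sigma_form_lagfun _ (im eta) _ _ _ m2); last by move=> l l0; rewrite /im etaE.
congr Complex; apply: eq_Rintegral => x _; rewrite /re /im ?ReM ?ImM /=.
  by rewrite mulr0 subr0.
by rewrite mulr0 add0r.
Qed.

(** The partial sums of [U0 g], written with the explicit Laguerre functions; they agree with
    [laguerre_sum] on the half-line. *)
Definition clagsum (g : nat -> C) N : R -> C := fun t =>
  Complex (lagsum (fun n => complex.Re (g n)) N t) (lagsum (fun n => complex.Im (g n)) N t).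

Lemma L2_clagsum g N : L2 (clagsum g N).
Proof. by apply/L2P; split; exact: sqint_lagsum. Qed.

Lemma clagsumS g N :
  clagsum g N.+1 = (fun t => g N * ofr (lagfun N) t + clagsum g N t).
Proof.
apply/funext => t; rewrite /clagsum /lagsum !big_ord_recr/=; apply: complex_ext => /=.
  by rewrite ReD ReM /= mulr0 subr0 addrC.
by rewrite ImD ImM /= mulr0 add0r addrC.
Qed.

Lemma lagcoord_hankel_clagsum g N n :
  lagcoord (H (clagsum g N)) n = \sum_(0 <= m < N) q (n + m)%N * g m.
Proof.
have [bH _] := hH; elim: N => [|N ih].
  rewrite big_geq//.
  (* The empty sum is [-1 * 0 + 0], so linearity with [c = -1] shows that [H] of it has zero
     coefficients. *)
  have := lagcoord_lin (-1) n bH (L2_clagsum g 0) (L2_clagsum g 0).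
  rewrite mulN1r addNr => <-; congr lagcoord; congr H; apply/funext => t.
  by rewrite mulN1r addNr; apply: complex_ext; rewrite /= /lagsum big_ord0.
rewrite big_nat_recr//= -ih clagsumS.
rewrite (lagcoord_lin _ _ bH (L2_ofr (sqint_lagfun N)) (L2_clagsum g N)).
by rewrite lagcoord_hankel_lagfun addrC mulrC.
Qed.

(** [clagsum g N] tends to [U0 g] in the mean and [H] is bounded, so the coefficients of the images
    converge. By [lagcoord_hankel_clagsum] they are the partial sums of the matrix series, whose
    convergence thus follows without any estimate of [q]. *)
Lemma hankel_matrix_operator : is_hankel_matrix_operator q (fun g => U0inv (H (U0 g))).
Proof.
move=> g g2; have [bH _] := hH; have [HL _ _] := bH.
have /is_U0P[LU d1 d2] := U0P g2.
have LF := HL _ LU; split; first by case: (U0invP LF).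
move=> n; rewrite (U0inv_coef n LF) -/(lagcoord _ n).
have [c1 c2] := bounded_operator_cvg bH LU (L2_clagsum g) d1 d2 (sqint_lagfun n).
under eq_fun do rewrite -lagcoord_hankel_clagsum.
apply: cvg_modulus0.
  under eq_fun do rewrite ReB.
  by rewrite -(subrr (complex.Re (lagcoord (H (U0 g)) n))); apply: cvgB => //;
    exact: cvg_cst.
under eq_fun do rewrite ImB.
by rewrite -(subrr (complex.Im (lagcoord (H (U0 g)) n))); apply: cvgB => //;
  exact: cvg_cst.
Qed.

End MatrixElements.

Theorem proposition7p4 (R : realType) (h s : (R -> R[i]) -> R[i])
    (sigma eta : R -> R[i]) (q : nat -> R[i])
    (h_dist : test_distribution h)
    (s_sigma : is_sigma_function h s)
    (sigma_bounded : Linfty sigma)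
    (s_repr : represented_by s sigma)
    (eta_def : forall l : R, 0 < l ->
      eta ((l - 1 / 2) / (l + 1 / 2)) = sigma l)
    (q_def : forall n : nat, q n =
      cintegral `]-1, 1[ (fun m : R => eta m * ofreal (m ^+ n))) :
  (exists H, is_hankel_operator h H) /\
  forall H : (R -> R[i]) -> (R -> R[i]), is_hankel_operator h H ->
    is_hankel_matrix_operator q (fun g => U0inv (H (U0 g))).
Proof.
split.
  exists (sigma_operator sigma).
  exact: (hankel_sigma_operator s_sigma sigma_bounded s_repr).
by move=> H hH; exact: (hankel_matrix_operator s_sigma sigma_bounded s_repr hH eta_def q_def).
Qed.
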